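(* Let $\varpi$ be a weight function on $\Omega$ that admits Assertions 1, 3 and 5 (see context). Let $f\in L^p(\Omega,\varpi)$ if $1\le p<\infty$ and $f\in C(\Omega)$ if $p=\infty$. Then for $r>0$ and $n=1,2,\dots$ the following hold, with constants $c$ independent of $f$ and $n$: (i) the direct estimate $$E_n(f)_{p,\varpi}\le c\,K_r(f;n^{-1})_{p,\varpi};$$ (ii) the inverse estimate $$K_r(f;n^{-1})_{p,\varpi}\le c\,n^{-r}\sum_{k=0}^n(k+1)^{r-1}E_k(f)_{p,\varpi}.$$
   Context: Setting. $\Omega$ is a domain in $\mathbb R^d$ (either a set with nonempty interior or an algebraic surface) with a metric $\mathsf d$; $B(x,r)=\{y\in\Omega:\mathsf d(x,y)<r\}$; $\mathsf m$ is the Lebesgue measure on $\Omega$, assumed doubling with respect to $\mathsf d$, with $\min_{x}\mathsf m(B(x,\varepsilon))\ge c_\varepsilon>0$ for each $\varepsilon>0$. $\varpi$ is a nonnegative weight with $\int_\Omega\varpi\,\mathrm d\mathsf m=1$, $\varpi(E)=\int_E\varpi\,\mathrm d\mathsf m$, and $\varpi$ is a doubling weight: $\varpi(B(x,2r))\le L\,\varpi(B(x,r))$ for all $x\in\Omega$, $r>0$. $\|\cdot\|_{p,\varpi}$ is the norm of $L^p(\Omega,\varpi)$, with $C(\Omega)$ and the uniform norm for $p=\infty$. $\Pi_n(\Omega)$ is the space of polynomials of degree at most $n$ restricted to $\Omega$; $\mathcal V_n(\Omega,\varpi)$ is the space of polynomials in $\Pi_n(\Omega)$ orthogonal to $\Pi_{n-1}(\Omega)$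 for $\langle f,g\rangle_\varpi=\int_\Omega fg\varpi\,\mathrm d\mathsf m$; $P_n(\varpi;\cdot,\cdot)$ is its reproducing kernel and $\operatorname{proj}_n(\varpi;f,x)=\int_\Omega f(y)P_n(\varpi;x,y)\varpi(y)\,\mathrm d\mathsf m(y)$. Standing assumptions on $\varpi$: (A) There is a second order derivation operator $\mathfrak D_\varpi$ with $\mathfrak D_\varpi Y=-\mu(n)Y$ for all $Y\in\mathcal V_n(\Omega,\varpi)$, $n\ge0$, where $\mu$ is a nonnegative quadratic polynomial. (B) Addition formula: for some $\alpha\ge\beta\ge-\frac12$, $P_n(\varpi;x,y)=\int_{[-1,1]^m}Z_n^{(\alpha,\beta)}(\xi(x,y;u))\,\mathrm d\tau(u)$ with $Z_n^{(\alpha,\beta)}(t)=P_n^{(\alpha,\beta)}(1)P_n^{(\alpha,\beta)}(t)/h_n^{(\alpha,\beta)}$, where $P_n^{(\alpha,\beta)}$ is the Jacobi polynomial, $h_n^{(\alpha,\beta)}$ its squared $L^2$ norm for the Jacobi weight $(1-t)^\alpha(1+t)^\beta$ normalized to unit integral on $[-1,1]$, $m$ is a positive integer, $\xi(x,y;u)\in[-1,1]$ is symmetric in $x,y$, and $\tau$ is a probability measure on $[-1,1]^m$ (possibly with finite support). A nonnegative $\widehat a\in C^\infty(\mathbb R)$ is an admissible cut-off function if either (a) $\operatorname{supp}\widehat a\subset[0,2]$ and $\widehat a(t)=1$ for $t\in[0,1]$ (as a function on $[0,\infty)$), or (b) $\operatorname{supp}\widehat a\subset[1/2,2]$. Put $L_n(\varpi;x,y)=\sum_{k\ge0}\widehat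 a(k/n)P_k(\varpi;x,y)$ and, for $r>0$, $L_n^{(r)}(\varpi;x,y)=\sum_{k\ge0}\widehat a(k/n)[\mu(k)]^{r/2}P_k(\varpi;x,y)$. For admissible $\widehat a$ and $n=1,2,\dots$, with constants independent of $n,x,y$: Assertion 1: for every $\kappa>0$, $|L_n(\varpi;x,y)|\le c_\kappa\big[\varpi(B(x,n^{-1}))\varpi(B(y,n^{-1}))\big]^{-1/2}(1+n\,\mathsf d(x,y))^{-\kappa}$ for $x,y\in\Omega$. Assertion 3: for sufficiently large $\kappa>0$, $\int_\Omega\frac{\varpi(y)}{\varpi(B(y,n^{-1}))(1+n\,\mathsf d(x,y))^\kappa}\,\mathrm d\mathsf m(y)\le c$ for $x\in\Omega$. Assertion 5: for every $r>0$ and $\kappa>0$, $|L_n^{(r)}(\varpi;x,y)|\le c_\kappa\,n^r\big[\varpi(B(x,n^{-1}))\varpi(B(y,n^{-1}))\big]^{-1/2}(1+n\,\mathsf d(x,y))^{-\kappa}$ for $x,y\in\Omega$. Best approximation: $E_n(f)_{p,\varpi}=\inf_{g\in\Pi_n(\Omega)}\|f-g\|_{p,\varpi}$. The Sobolev space $W_p^r(\Omega,\varpi)$ consists of $f\in L^p(\Omega,\varpi)$ ($C(\Omega)$ if $p=\infty$) for which there is a function in $L^p(\Omega,\varpi)$ ($C(\Omega)$ if $p=\infty$), denoted $(-\mathfrak D_\varpi)^{r/2}f$, with $\operatorname{proj}_n(\varpi;(-\mathfrak D_\varpi)^{r/2}f)=\mu(n)^{r/2}\operatorname{proj}_n(\varpi;f)$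 for all $n\ge0$. The $K$-functional is $K_r(f;t)_{p,\varpi}=\inf_{g\in W_p^r(\Omega,\varpi)}\{\|f-g\|_{p,\varpi}+t^r\|(-\mathfrak D_\varpi)^{r/2}g\|_{p,\varpi}\}$. *)

(* Defs.v *)
From HB Require Import structures.
From mathcomp Require Import all_boot all_order all_algebra.
From mathcomp Require Import all_classical all_reals all_analysis.
From mathcomp.multinomials Require mpoly.
Import (canonicals, coercions) mpoly.
Import Order.TTheory GRing.Theory Num.Theory.
Import numFieldNormedType.Exports.

Set Implicit Arguments.
Unset Strict Implicit.
Unset Printing Implicit Defensive.

Local Open Scope classical_set_scope.
Local Open Scope ring_scope.

(* Points of R^d are row vectors.  [borelV R d] is the same type, carrying the
   Borel sigma-algebra. *)
Notation borelV R d := (g_sigma_algebraType (@open 'rV[R]_d)).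

Section Lebesgue_measure.
Context {R : realType} {d : nat}.
Implicit Types (A Omega : set 'rV[R]_d).

(* The norm of 'rV[R]_d in the library is the sup norm. *)
Definition euclid_dist (x y : 'rV[R]_d) : R :=
  Num.sqrt (\sum_(i < d) (x ord0 i - y ord0 i) ^+ 2).

Definition box (a b : 'rV[R]_d) : set 'rV[R]_d :=
  [set x | forall i, a ord0 i < x ord0 i <= b ord0 i].

Definition lebesgue_outer A : \bar R :=
  ereal_inf [set s | exists a b : nat -> 'rV[R]_d,
    [/\ forall k i, a k ord0 i <= b k ord0 i,
        A `<=` \bigcup_k box (a k) (b k) &
        s = (\sum_(0 <= k <oo)
               (\prod_(i < d) (b k ord0 i - a k ord0 i))%:E)%E]].

(* Volume of the Euclidean unit ball of R^k. *)
Fixpoint unit_ball_volume (k : nat) : R :=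
  match k with
  | 0%N => 1
  | 1%N => 2
  | k'.+2 => 2 * pi / k%:R * unit_ball_volume k'
  end.

(* k-dimensional Hausdorff outer measure, for k > 0, with the normalization
   that makes it the surface area of k-dimensional surfaces.  The numbers
   [rho j] are upper bounds for the diameters of the covering sets [S j]. *)
Definition hausdorff_outer (k : nat) A : \bar R :=
  ereal_sup [set
    ereal_inf [set s | exists (S : nat -> set 'rV[R]_d) (rho : nat -> R),
      [/\ forall j, 0 <= rho j <= delta,
          forall j x y, S j x -> S j y -> euclid_dist x y <= rho j,
          A `<=` \bigcup_j S j &
          s = (\sum_(0 <= j <oo)
                 (unit_ball_volume k * (rho j / 2) ^+ k)%:E)%E]]
    | delta in [set delta : R | 0 < delta]].

(* Volume on a solid domain, surface area on a domain contained in an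
   algebraic variety.  The dimension [k] need not be prescribed: it is
   determined by the measure being positive and finite on balls. *)
Definition lebesgue_measure_on Omega
    (m : {measure set (borelV R d) -> \bar R}) : Prop :=
  (Omega° !=set0 /\
   forall A, measurable (A : set (borelV R d)) ->
     m A = lebesgue_outer (A `&` Omega))
  \/
  (exists2 q : mpoly.mpoly d R, q != 0 &
     Omega `<=` [set x | mpoly.meval (fun i => x ord0 i) q = 0]) /\
  (exists2 k : nat, (0 < k < d)%N &
     forall A, measurable (A : set (borelV R d)) ->
       m A = hausdorff_outer k (A `&` Omega)).

End Lebesgue_measure.

Section Setting.
Context {R : realType} {d : nat}.
Variables (Omega : set 'rV[R]_d) (dist : 'rV[R]_d -> 'rV[R]_d -> R).
Variable m : {measure set (borelV R d) -> \bar R}.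

Definition mball (x : 'rV[R]_d) (r : R) : set 'rV[R]_d :=
  [set y | Omega y /\ dist x y < r].

Record metric_on : Prop := MetricOn {
  dist_eq0 : forall x y, Omega x -> Omega y -> (dist x y = 0 <-> x = y);
  dist_sym : forall x y, Omega x -> Omega y -> dist x y = dist y x;
  dist_triangle : forall x y z, Omega x -> Omega y -> Omega z ->
    dist x z <= dist x y + dist y z;
  (* the metric induces on Omega the topology inherited from R^d *)
  dist_fine : forall x (e : R), Omega x -> 0 < e ->
    exists2 e' : R, 0 < e' &
      forall y, Omega y -> dist x y < e' -> euclid_dist x y < e;
  dist_coarse : forall x (e : R), Omega x -> 0 < e ->
    exists2 e' : R, 0 < e' &
      forall y, Omega y -> euclid_dist x y < e' -> dist x y < e
}.

Record homogeneous_domain : Prop := HomogeneousDomain {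
  hd_dim : (0 < d)%N;
  hd_measurable : measurable (Omega : set (borelV R d));
  hd_metric : metric_on;
  hd_lebesgue : lebesgue_measure_on Omega m;
  hd_finite : forall x (r : R), Omega x -> 0 < r -> (m (mball x r) < +oo)%E;
  hd_doubling : exists C : R, forall x (r : R), Omega x -> 0 < r ->
    (m (mball x (2 * r)) <= C%:E * m (mball x r))%E;
  hd_lower : forall e : R, 0 < e -> exists2 c : R, 0 < c &
    forall x, Omega x -> (c%:E <= m (mball x e))%E
}.

(* A function on Omega is represented by any function on R^d extending it;
   only its values on Omega matter below. *)
Definition polys (n : nat) : set ('rV[R]_d -> R) :=
  [set f | exists2 q : mpoly.mpoly d R,
     (mpoly.msize q <= n.+1)%N &
     forall x, Omega x -> f x = mpoly.meval (fun i => x ord0 i) q].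

Variable w : 'rV[R]_d -> R.

Definition wmeas (E : set 'rV[R]_d) : R := \int[m]_(y in E) w y.

Record doubling_weight : Prop := DoublingWeight {
  dw_ge0 : forall x, Omega x -> 0 <= w x;
  dw_measurable : measurable_fun (Omega : set (borelV R d))
                    (w : borelV R d -> R);
  dw_unit : (\int[m]_(x in Omega) (w x)%:E = 1)%E;
  dw_doubling : exists L : R, forall x (r : R), Omega x -> 0 < r ->
    wmeas (mball x (2 * r)) <= L * wmeas (mball x r);
  (* needed for the inner product of polynomials to make sense *)
  dw_moments : forall n f, polys n f ->
    m.-integrable Omega (fun x => (f x * w x)%:E)
}.

Definition winner (f g : 'rV[R]_d -> R) : R :=
  \int[m]_(x in Omega) (f x * g x * w x).

Definition orthopolys (n : nat) : set ('rV[R]_d -> R) :=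
  [set Y | polys n Y /\
     forall k g, (k < n)%N -> polys k g -> winner Y g = 0].

Variable P : nat -> 'rV[R]_d -> 'rV[R]_d -> R.

Definition reproducing_kernel (n : nat) : Prop :=
  forall x, Omega x ->
    orthopolys n (P n x) /\
    forall Y, orthopolys n Y -> winner Y (P n x) = Y x.

Definition proj (n : nat) (f : 'rV[R]_d -> R) (x : 'rV[R]_d) : R :=
  \int[m]_(y in Omega) (f y * P n x y * w y).

(* Second order differential operator without zero order term, acting on the
   restrictions of polynomials to Omega (on a surface: a tangential operator,
   written in ambient coordinates). *)
Definition second_order_derivation
    (D : ('rV[R]_d -> R) -> 'rV[R]_d -> R) : Prop :=
  exists (a : 'I_d -> 'I_d -> 'rV[R]_d -> R) (b : 'I_d -> 'rV[R]_d -> R),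
  forall (q : mpoly.mpoly d R) (f : 'rV[R]_d -> R),
    (forall x, Omega x -> f x = mpoly.meval (fun i => x ord0 i) q) ->
    forall x, Omega x ->
      let ev := mpoly.meval (fun i => x ord0 i) in
      D f x =
        \sum_(i < d) \sum_(j < d)
           a i j x * ev (mpoly.mderiv i (mpoly.mderiv j q))
        + \sum_(i < d) b i x * ev (mpoly.mderiv i q).

Variable mu : {poly R}.

Definition eigen_assumption (D : ('rV[R]_d -> R) -> 'rV[R]_d -> R) : Prop :=
  [/\ second_order_derivation D,
      size mu = 3%N,
      forall n : nat, 0 <= mu.[n%:R] &
      forall n Y, orthopolys n Y ->
        forall x, Omega x -> D Y x = - mu.[n%:R] * Y x].

End Setting.

Section Jacobi.
Context {R : realType}.

Definition gbinom (a : R) (k : nat) : R :=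
  (\prod_(i < k) (a - i%:R)) / k`!%:R.

(* Rodrigues' formula, expanded by the Leibniz rule. *)
Definition jacobi (alpha beta : R) (n : nat) (t : R) : R :=
  \sum_(s < n.+1)
    gbinom (n%:R + alpha) (n - s) * gbinom (n%:R + beta) s
    * ((t - 1) / 2) ^+ s * ((t + 1) / 2) ^+ (n - s).

Definition jacobi_weight (alpha beta t : R) : R :=
  (1 - t) `^ alpha * (1 + t) `^ beta.

Definition jacobi_norm2 (alpha beta : R) (n : nat) : R :=
  (\int[lebesgue_measure]_(t in `[(-1 : R), 1])
     (jacobi alpha beta n t ^+ 2 * jacobi_weight alpha beta t))
  / \int[lebesgue_measure]_(t in `[(-1 : R), 1]) jacobi_weight alpha beta t.

Definition zonal (alpha beta : R) (n : nat) (t : R) : R :=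
  jacobi alpha beta n 1 * jacobi alpha beta n t / jacobi_norm2 alpha beta n.

Definition cube {k : nat} : set 'rV[R]_k :=
  [set u | forall i, -1 <= u ord0 i <= 1].

Definition addition_formula {d : nat} (Omega : set 'rV[R]_d)
    (P : nat -> 'rV[R]_d -> 'rV[R]_d -> R) : Prop :=
  exists (alpha beta : R) (k : nat)
         (xi : 'rV[R]_d -> 'rV[R]_d -> 'rV[R]_k -> R)
         (tau : probability (borelV R k) R),
  [/\ - 2^-1 <= beta <= alpha, (0 < k)%N, tau cube = 1%E,
      forall x y, Omega x -> Omega y ->
        [/\ measurable_fun (cube : set (borelV R k))
              (xi x y : borelV R k -> R),
            forall u, cube u -> -1 <= xi x y u <= 1 &
            forall u, cube u -> xi x y u = xi y x u] &
      forall n x y, Omega x -> Omega y ->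
        P n x y = \int[tau]_(u in cube) zonal alpha beta n (xi x y u)].

End Jacobi.

Section Assertions.
Context {R : realType} {d : nat}.
Variables (Omega : set 'rV[R]_d) (dist : 'rV[R]_d -> 'rV[R]_d -> R).
Variable m : {measure set (borelV R d) -> \bar R}.
Variable w : 'rV[R]_d -> R.
Variable P : nat -> 'rV[R]_d -> 'rV[R]_d -> R.
Variable mu : {poly R}.

(* In the first alternative the cut-off function is considered on [0, +oo[
   only. *)
Definition admissible (a : R -> R) : Prop :=
  [/\ forall n t, derivable (derive1n n a) t 1,
      forall t, 0 <= a t &
      (forall t, 0 <= t <= 1 -> a t = 1) /\ (forall t, 2 < t -> a t = 0)
      \/ closure [set t | a t != 0] `<=` `[2^-1, 2]].

(* For an admissible [a] the terms with k > 2 n vanish, so the two sums below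
   are the sums over all k >= 0. *)
Definition Lker (a : R -> R) (n : nat) (x y : 'rV[R]_d) : R :=
  \sum_(0 <= k < (2 * n).+1) a (k%:R / n%:R) * P k x y.

Definition Lker_pow (r : R) (a : R -> R) (n : nat) (x y : 'rV[R]_d) : R :=
  \sum_(0 <= k < (2 * n).+1)
    a (k%:R / n%:R) * mu.[k%:R] `^ (r / 2) * P k x y.

Let wball (x : 'rV[R]_d) (r : R) : R := wmeas m w (mball Omega dist x r).

Definition local_bound (kappa : R) (n : nat) (x y : 'rV[R]_d) : R :=
  (wball x n%:R^-1 * wball y n%:R^-1) `^ (- 2^-1)
  * (1 + n%:R * dist x y) `^ (- kappa).

Definition assertion1 : Prop :=
  forall a, admissible a -> forall kappa : R, 0 < kappa ->
  exists c : R, forall n x y, (0 < n)%N -> Omega x -> Omega y ->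
    `|Lker a n x y| <= c * local_bound kappa n x y.

Definition assertion3 : Prop :=
  exists kappa0 : R, forall kappa : R, 0 < kappa -> kappa0 <= kappa ->
  exists c : R, forall n x, (0 < n)%N -> Omega x ->
    (\int[m]_(y in Omega)
       (w y / (wball y n%:R^-1 * (1 + n%:R * dist x y) `^ kappa))%:E
     <= c%:E)%E.

Definition assertion5 : Prop :=
  forall a, admissible a -> forall r kappa : R, 0 < r -> 0 < kappa ->
  exists c : R, forall n x y, (0 < n)%N -> Omega x -> Omega y ->
    `|Lker_pow r a n x y| <= c * n%:R `^ r * local_bound kappa n x y.

End Assertions.

Section Approximation.
Context {R : realType} {d : nat}.
Variable Omega : set 'rV[R]_d.
Variable m : {measure set (borelV R d) -> \bar R}.
Variable w : 'rV[R]_d -> R.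
Variable P : nat -> 'rV[R]_d -> 'rV[R]_d -> R.
Variable mu : {poly R}.

(* The uniform norm for p = +oo; the value at -oo is irrelevant. *)
Definition wnorm (p : \bar R) (f : 'rV[R]_d -> R) : \bar R :=
  match p with
  | q%:E => ((\int[m]_(x in Omega) (`|f x| `^ q * w x)%:E) `^ q^-1)%E
  | +oo%E => ereal_sup [set `|f x|%:E | x in Omega]
  | -oo%E => 0%E
  end.

(* L^p(Omega, w) for p finite, C(Omega) for p = +oo (bounded continuous
   functions, so that the uniform norm is a norm; there is no difference when
   Omega is compact). *)
Definition wspace (p : \bar R) : set ('rV[R]_d -> R) :=
  [set f | (if p is +oo%E then {within Omega, continuous f}
            else measurable_fun (Omega : set (borelV R d))
                   (f : borelV R d -> R))
           /\ (wnorm p f < +oo)%E].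

Definition best_approx (p : \bar R) (n : nat) (f : 'rV[R]_d -> R) : \bar R :=
  ereal_inf [set wnorm p (f \- g) | g in polys Omega n].

(* [h] is (- D)^(r/2) g. *)
Definition frac_power (r : R) (g h : 'rV[R]_d -> R) : Prop :=
  forall n x, Omega x ->
    proj Omega m w P n h x = mu.[n%:R] `^ (r / 2) * proj Omega m w P n g x.

(* The Sobolev space W_p^r is the set of the [g] occurring here. *)
Definition K_functional (p : \bar R) (r t : R) (f : 'rV[R]_d -> R) : \bar R :=
  ereal_inf [set s | exists g h : 'rV[R]_d -> R,
    [/\ wspace p g, wspace p h, frac_power r g h &
        s = (wnorm p (f \- g)%R + (t `^ r)%:E * wnorm p h)%E]].

End Approximation.

(* Main.v *)
(* Assertions 1 and 3 bound the multiplier operators attached to admissible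
   cut-offs uniformly on every L^p (Schur's test).  Let low_j be the multiplier
   with symbol cutoff(k / 2^j); low_{j+1} - low_j has a symbol dyadic(k / 2^{j+1})
   living at frequencies about 2^j.  There the eigenvalue mu(k) is of order 4^j, and
   mu(k)^{r/2} costs 2^{jr} by Assertion 5, while mu(k)^{-r/2} gains 2^{-jr}.

   Direct estimate: for g in the Sobolev space the telescoping sum of
   (low_{j+1} - low_j) g is then geometric, so that g - low_j g is O(2^{-jr}) and
   low_j g is a near-best polynomial.

   Inverse estimate: low_J f is a competitor in the K-functional.  The block
   low_{j+1} - low_j kills polynomials of degree at most 2^j, so that its r-th
   fractional power is at most 2^{jr} E_{2^j}(f), and the dyadic sum of these bounds is
   compared with the sum over all degrees. *)

From HB Require Import structures.
Require Import Defs.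
From mathcomp Require Import all_boot all_order all_algebra.
From mathcomp Require Import all_classical all_reals all_analysis.
From mathcomp Require Import measurable_realfun.
From mathcomp.multinomials Require mpoly.
From mathcomp Require Import ring lra.
Import (canonicals, coercions) mpoly.
Import Order.TTheory GRing.Theory Num.Theory.
Import numFieldNormedType.Exports.
Set Implicit Arguments.
Unset Strict Implicit.
Unset Printing Implicit Defensive.
Local Open Scope classical_set_scope.
Local Open Scope ring_scope.

(** * Smooth cut-off functions *)

(** The multiplier bounds alone do not give [low_j g -> g]: density of polynomials in the weighted
    spaces is not among the hypotheses. Duality replaces it. The kernel of [low_j] integrates to 1
    and has first moment of order 2^-j, so [low_j phi -> phi] uniformly for Lipschitz [phi];
    self-adjointness turns this into convergence of [low_j g] tested against [phi], which identifies
    the almost everywhere limit of the telescoping sum as [g]. The second obstacle is mu^(-r/2). As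
    mu(k) is not homogeneous in k, this symbol is not a dilate of one admissible cut-off. On the
    block of frequencies about 2^j, 1/mu(k) differs from 1/(al k^2) by a term of relative size 2^-j;
    for large j this error is absorbed, and finitely many j remain. Polynomials must be bounded
    although [Omega] is not assumed compact. A doubling weight of total mass 1 forces a bounded
    diameter, so balls of a fixed radius have mass bounded below, and Assertion 1 on the diagonal
    then bounds the kernels. *)

Section Smooth.
Context {R : realType}.
Implicit Types (f g : R -> R) (n : nat).

(** Naming a derivative at each level lets closure under products, inverses and affine substitutions
    go by induction on [n]; the iterated [derive1n] demanded by [admissible] appear only in
    [smooth_derivable]. *)
Fixpoint smoothn n f : Prop :=
  if n is n'.+1 then
    exists2 g : R -> R, (forall x : R, is_derive x (1 : R) f (g x)) & smoothn n' g
  else True.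

Definition smooth f := forall n, smoothn n f.

Lemma smoothnW n f : smoothn n.+1 f -> smoothn n f.
Proof.
elim: n f => [//|n IH] f [g fg sg].
by exists g => //; exact: IH.
Qed.

Lemma smooth_derivable f : smooth f ->
  forall n t, derivable (derive1n n f) t 1.
Proof.
move=> sf n; have := sf n.+1; elim: n f {sf} => [|n IH] f.
  by case=> g fg _ t; rewrite derive1n0; case: (fg t).
case=> g fg sg t; rewrite derive1Sn.
have -> : (f^`())%classic = g.
  by apply/funext => x; rewrite derive1E; case: (fg x).
exact: IH.
Qed.

Lemma smoothn_cst n (c : R) : smoothn n (fun=> c).
Proof.
elim: n c => [//|n IH] c; exists (fun=> 0) => // x.
exact: is_derive_cst.
Qed.

Lemma smoothn_id n : smoothn n id.
Proof.
case: n => [//|n]; exists (fun=> 1); last exact: smoothn_cst.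
by move=> x; exact: is_derive_id.
Qed.

Lemma smoothnD n f g : smoothn n f -> smoothn n g ->
  smoothn n (fun x => f x + g x).
Proof.
elim: n f g => [//|n IH] f g [f' ff' sf'] [g' gg' sg'].
exists (fun x => f' x + g' x); last exact: IH.
by move=> x; exact: is_deriveD.
Qed.

Lemma smoothnM n f g : smoothn n f -> smoothn n g ->
  smoothn n (fun x => f x * g x).
Proof.
elim: n f g => [//|n IH] f g sf sg.
have [f' ff' sf'] := sf; have [g' gg' sg'] := sg.
exists (fun x => f x * g' x + g x * f' x).
  by move=> x; exact: is_deriveM.
by apply: smoothnD; apply: IH => //; exact: smoothnW.
Qed.

(** The derivative of 1/f is a product of two copies of 1/f and of f', so the induction hypothesis
    for 1/f itself closes the argument. *)
Lemma smoothnV n f : (forall x, f x != 0) -> smoothn n f ->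
  smoothn n (fun x => (f x)^-1).
Proof.
move=> f0; elim: n => [//|n IH] sf.
have [f' ff' sf'] := sf.
exists (fun x => (- 1) * ((f x)^-1 * ((f x)^-1 * f' x))).
  move=> x; have := @is_deriveV R f x _ _ (f0 x) (ff' x).
  move=> H; apply: is_derive_eq H _.
  by rewrite scaleNr /GRing.scale/= expr2 invfM mulN1r mulrA.
have sV := IH (smoothnW sf).
by apply: smoothnM; [exact: smoothn_cst|do 2 apply: smoothnM => //].
Qed.

Lemma smoothn_affine n f (a b : R) : smoothn n f ->
  smoothn n (fun x => f (a * x + b)).
Proof.
elim: n f => [//|n IH] f [f' ff' sf'].
exists (fun x => f' (a * x + b) * a); last first.
  by apply: smoothnM; [exact: IH|exact: smoothn_cst].
move=> x.
have H : is_derive x (1 : R) (fun x => a * x + b) a.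
  have dZ : is_derive x (1 : R) (fun x => a * x) a.
    have := @is_deriveZ R R R id a x 1 1 (is_derive_id x 1).
    by rewrite /GRing.scale/= mulr1.
  have := is_deriveD dZ (is_derive_cst b x (1 : R)).
  by rewrite addr0.
exact: (@is_derive1_comp R f (fun x => a * x + b)).
Qed.

(* The derivative of [flat k] is [flat k.+2 - k * flat k.+1]. *)
Definition flat (k : nat) (x : R) : R :=
  if 0 < x then x^-1 ^+ k * expR (- x^-1) else 0.

Lemma flat_le k x : 0 < x -> `|flat k x| <= k.+1`!%:R * x.
Proof.
move=> x0; rewrite /flat x0 ger0_norm; last first.
  by rewrite mulr_ge0 ?expR_ge0// exprn_ge0// invr_ge0 ltW.
rewrite expRN ler_pdivrMr ?expR_gt0//.
have u0 : 0 <= x^-1 by rewrite invr_ge0 ltW.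
have H := @expR_ge1Dxn R x^-1 k u0.
have f0 : 0 < (k.+1`!%:R : R) by rewrite ltr0n fact_gt0.
have H' : x^-1 ^+ k.+1 / k.+1`!%:R <= expR x^-1.
  by apply: le_trans H; rewrite lerDr.
have -> : x^-1 ^+ k = k.+1`!%:R * x * (x^-1 ^+ k.+1 / k.+1`!%:R).
  by rewrite exprS; field; rewrite ?gt_eqF.
by rewrite ler_wpM2l// mulr_ge0// ltW.
Qed.

Lemma is_derive_flat k x :
  is_derive x (1 : R) (flat k) (flat k.+2 x - k%:R * flat k.+1 x).
Proof.
have [x0|x0|x0] := ltgtP x 0.
- have -> : flat k.+2 x - k%:R * flat k.+1 x = 0.
    by rewrite /flat ltNge (ltW x0)/= mulr0 subrr.
  apply: (near_eq_is_derive _ (is_derive_cst (0 : R) x 1)).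
  near=> y.
  by rewrite /flat ltNge ltW//=; near: y; exact: lt_nbhsl.
- have -> : flat k.+2 x - k%:R * flat k.+1 x =
      (x^-1 ^+ k.+2 - k%:R * x^-1 ^+ k.+1) * expR (- x^-1).
    by rewrite /flat x0; ring.
  pose e (y : R) : R := (y^-1) ^+ k * expR (- y^-1).
  apply: (@near_eq_is_derive _ _ _ e).
  + near=> y.
    have y0 : 0 < y by near: y; exact: lt_nbhsr.
    by rewrite /flat y0.
  rewrite {}/e.
  have xn0 : x != 0 by rewrite gt_eqF.
  have dV : is_derive x (1 : R) (fun y : R => y^-1) (- x ^- 2).
    have := @is_deriveV R id x _ _ xn0 (is_derive_id x 1).
    by rewrite /GRing.scale/= mulr1.
  have dX := @is_deriveX R _ (fun y : R => y^-1) k x 1 _ dV.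
  have dE : is_derive x (1 : R) (fun y => expR (- y^-1))
      (expR (- x^-1) * (x ^- 2)).
    have dN : is_derive x (1 : R) (fun y : R => - y^-1) (x ^- 2).
      have := @is_deriveN _ _ _ (fun y : R => y^-1) x 1 _ dV.
      by rewrite opprK.
    exact: (@is_derive1_comp R expR (fun y : R => - y^-1)).
  case: k dX => [|k] dX.
    have -> : (fun y : R => y^-1 ^+ 0 * expR (- y^-1)) =
              (fun y => expR (- y^-1)) by apply/funext => y; rewrite mul1r.
    apply: is_derive_eq dE _.
    by rewrite mul0r subr0 mulrC exprVn.
  have dX' : is_derive x (1 : R) (fun y : R => y^-1 ^+ k.+1)
      ((k.+1%:R * x^-1 ^+ k) * (- x ^- 2)).
    by have := dX; rewrite exprfctE.
  have := is_deriveM dX' dE.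
  move=> H; apply: is_derive_eq H _.
  rewrite /GRing.scale/= -exprVn !exprS expr0.
  ring.
- rewrite x0.
  have -> : flat k.+2 0 - k%:R * flat k.+1 0 = 0.
    by rewrite /flat ltxx mulr0 subrr.
  have H : (fun h : R => h^-1 *: ((flat k \o shift 0) (h *: 1) - flat k 0)) @ 0^'
            --> (0 : R).
    apply/cvgrPdist_le => e e0; near=> h.
    have h0 : h != 0 by near: h; exact: nbhs_dnbhs_neq.
    have he : `|h| <= e / k.+2`!%:R.
      near: h; apply: dnbhs0_le.
      by rewrite divr_gt0// ltr0n fact_gt0.
    rewrite sub0r normrN /GRing.scale/= mulr1 addr0 {2}/flat ltxx subr0.
    rewrite /flat; case: ifPn => h1; last by rewrite mulr0 normr0 ltW.
    have := flat_le k.+1 h1; rewrite /flat h1 exprS -mulrA => /le_trans; apply.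
    by rewrite mulrC -ler_pdivlMr ?ltr0n ?fact_gt0// (le_trans (ler_norm _)).
  constructor; first by apply/cvg_ex; exists 0.
  by apply/cvg_lim.
Unshelve. all: by end_near. Qed.

(** Differentiation stays in the family but raises the index, hence the induction on the order for
    all [k] at once. *)
Lemma smooth_flat k : smooth (flat k).
Proof.
move=> n; elim: n k => [//|n IH] k.
exists (fun x => flat k.+2 x + (- k%:R) * flat k.+1 x).
  by move=> x; rewrite mulNr; exact: is_derive_flat.
by apply: smoothnD => //; apply: smoothnM => //; exact: smoothn_cst.
Qed.

Lemma flat_ge0 k x : 0 <= flat k x.
Proof.
rewrite /flat; case: ifPn => // x0.
by rewrite mulr_ge0 ?expR_ge0// exprn_ge0// invr_ge0 ltW.
Qed.

Lemma flat_gt0 k x : 0 < x -> 0 < flat k x.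
Proof.
move=> x0; rewrite /flat x0.
by rewrite mulr_gt0 ?expR_gt0// exprn_gt0// invr_gt0.
Qed.

Lemma flat0 k x : x <= 0 -> flat k x = 0.
Proof. by rewrite /flat ltNge => ->. Qed.

(** The classical smooth step from 1 on t <= 1 to 0 on t >= 2. The two terms of the denominator
    vanish on disjoint half lines, so it is positive. *)
Definition cutoff (t : R) : R :=
  flat 0 (2 - t) / (flat 0 (2 - t) + flat 0 (t - 1)).

Lemma cutoff_den_gt0 t : 0 < flat 0 (2 - t) + flat 0 (t - 1).
Proof.
have [t2|t2] := ltP t 2.
  by rewrite ltr_pwDl ?flat_ge0// flat_gt0// subr_gt0.
rewrite ltr_wpDl ?flat_ge0// flat_gt0// subr_gt0.
by apply: lt_le_trans t2; rewrite ltr1n.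
Qed.

Lemma smooth_cutoff : smooth cutoff.
Proof.
move=> n.
have s1 : smoothn n (fun t => flat 0 (2 - t)).
  have := smoothn_affine (-1) 2 (@smooth_flat 0 n).
  by congr smoothn; apply/funext => t; rewrite mulN1r addrC.
have s2 : smoothn n (fun t => flat 0 (t - 1)).
  have := smoothn_affine 1 (-1) (@smooth_flat 0 n).
  by congr smoothn; apply/funext => t; rewrite mul1r.
apply: smoothnM => //; apply: smoothnV; last exact: smoothnD.
by move=> x; rewrite gt_eqF// cutoff_den_gt0.
Qed.

Lemma cutoff_ge0 t : 0 <= cutoff t.
Proof. by rewrite divr_ge0 ?flat_ge0// ltW// cutoff_den_gt0. Qed.

Lemma cutoff_le1 t : cutoff t <= 1.
Proof. by rewrite ler_pdivrMr ?cutoff_den_gt0// mul1r lerDl flat_ge0. Qed.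

Lemma cutoff1 t : t <= 1 -> cutoff t = 1.
Proof.
move=> t1; rewrite /cutoff (@flat0 0 (t - 1)) ?subr_le0// addr0 divff//.
by rewrite gt_eqF// flat_gt0// subr_gt0 (le_lt_trans t1)// ltr1n.
Qed.

Lemma cutoff0 t : 2 <= t -> cutoff t = 0.
Proof. by move=> t2; rewrite /cutoff flat0 ?mul0r// subr_le0. Qed.

Lemma admissible_cutoff : admissible cutoff.
Proof.
split; [exact/smooth_derivable/smooth_cutoff|exact: cutoff_ge0|left].
split=> [t /andP[_ /cutoff1]//|t t2].
by rewrite cutoff0// ltW.
Qed.

(* A smooth dyadic partition of unity on the half line. *)
Definition dyadic (t : R) : R := cutoff t - cutoff (2 * t).

Lemma dyadic_ge0 t : 0 <= dyadic t.
Proof.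
rewrite subr_ge0; have [t1|t1] := leP t 1; first by rewrite (cutoff1 t1) cutoff_le1.
have t2 : 2 <= 2 * t by lra.
by rewrite (cutoff0 t2) cutoff_ge0.
Qed.

Lemma dyadic0l t : t <= 2^-1 -> dyadic t = 0.
Proof. by move=> ht; rewrite /dyadic !cutoff1 ?subrr//; lra. Qed.

Lemma dyadic0r t : 2 <= t -> dyadic t = 0.
Proof. by move=> ht; rewrite /dyadic !cutoff0 ?subrr//; lra. Qed.

(** The sum telescopes to cutoff(t/2) - cutoff(4t). Hence a block together with its two neighbours
    acts as the identity on the block, which makes it possible to invert symbols there. *)
Lemma dyadic_sum3 t : 2^-1 <= t <= 2 ->
  dyadic (t / 2) + dyadic t + dyadic (2 * t) = 1.
Proof.
move=> /andP[t1 t2]; rewrite /dyadic mulrCA divff ?mulr1 ?pnatr_eq0//.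
rewrite (@cutoff1 (t / 2)); last lra.
rewrite (@cutoff0 (2 * (2 * t))); last lra.
ring.
Qed.

Lemma smooth_dyadic : smooth dyadic.
Proof.
move=> n; apply: smoothnD; first exact: smooth_cutoff.
have := smoothn_affine 2 0 (@smooth_cutoff n).
move=> /(smoothnM (smoothn_cst n (-1))).
by congr smoothn; apply/funext => t; rewrite mulN1r addr0.
Qed.

(** The sign of [g] matters only where [dyadic] does not vanish; this allows odd factors such as t *
    [invsq t]. *)
Lemma admissible_dyadicM g : smooth g -> (forall t, 2^-1 <= t -> 0 <= g t) ->
  admissible (fun t => dyadic t * g t).
Proof.
move=> sg g0; split.
- by apply: smooth_derivable => n; apply: smoothnM => //; exact: smooth_dyadic.
- move=> t; have [/dyadic0l ->|/ltW/g0] := leP t 2^-1; first by rewrite mul0r.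
  by move=> ?; rewrite mulr_ge0// dyadic_ge0.
have cl : closed (`[2^-1, 2] : set R) by exact: interval_closed.
right; rewrite [X in _ `<=` X](closure_id _).1//.
apply: closure_subset => t /=; rewrite in_itv/= => H; apply/andP; split.
- by rewrite leNgt; apply/negP => /ltW/dyadic0l h; rewrite h mul0r eqxx in H.
- by rewrite leNgt; apply/negP => /ltW/dyadic0r h; rewrite h mul0r eqxx in H.
Qed.

(* The added cut-off removes the singularity of 1 / t^2 at 0 and vanishes for t >= 1/2. *)
Definition invsq (t : R) : R := (t * t + cutoff (4 * t))^-1.

Lemma invsqE t : 2^-1 <= t -> invsq t = t ^- 2.
Proof.
move=> ht; have t2 : 2 <= 4 * t by lra.
by rewrite /invsq (cutoff0 t2) addr0 expr2.
Qed.

Lemma invsq_den_gt0 t : 0 < t * t + cutoff (4 * t).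
Proof.
have [t1|t1] := leP t 4^-1.
  by rewrite cutoff1 ?ltr_wpDl ?ltr01// ?sqr_ge0 -?expr2 ?sqr_ge0//; lra.
by rewrite ltr_pwDl ?cutoff_ge0// mulr_gt0; lra.
Qed.

Lemma smooth_invsq : smooth invsq.
Proof.
move=> n; apply: smoothnV.
  by move=> t; rewrite gt_eqF// invsq_den_gt0.
apply: smoothnD; first by apply: smoothnM; exact: smoothn_id.
have := smoothn_affine 4 0 (@smooth_cutoff n).
by congr smoothn; apply/funext => t; rewrite addr0.
Qed.

(** This localized t^-2 and the localized t^-1 that follows are the leading term and the correction
    in the expansion of 1/mu. *)
Lemma admissible_dyadic2 : admissible (fun t => dyadic t * invsq t).
Proof.
apply: admissible_dyadicM => [|t _]; first exact: smooth_invsq.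
by rewrite invr_ge0 ltW// invsq_den_gt0.
Qed.

Lemma admissible_dyadic1 : admissible (fun t => dyadic t * (t * invsq t)).
Proof.
apply: admissible_dyadicM => [n|t t0].
  by apply: smoothnM; [exact: smoothn_id|exact: smooth_invsq].
by rewrite mulr_ge0 ?invr_ge0 ?(ltW (invsq_den_gt0 _))//; lra.
Qed.

Lemma admissible_dyadic : admissible dyadic.
Proof.
have := @admissible_dyadicM (fun=> 1) (smoothn_cst^~ 1) (fun _ _ => ler01).
by congr admissible; apply/funext => t; rewrite mulr1.
Qed.

End Smooth.

(** * The weighted measure as a probability measure *)

Section Density.
Local Open Scope ereal_scope.
Import HBNNSimple.
Context d (T : measurableType d) (R : realType).
Variables (mu : {measure set T -> \bar R}) (g : T -> R).

(** The two proofs are parameters so that the measure structure declared below can be inferred from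
    the term alone. *)
Definition density_measure (g0 : forall x, (0 <= g x)%R)
    (mg : measurable_fun setT g) (A : set T) : \bar R :=
  \int[mu]_(x in A) (g x)%:E.

Hypothesis g0 : forall x, (0 <= g x)%R.
Hypothesis mg : measurable_fun setT g.
Hypothesis g1 : \int[mu]_x (g x)%:E = 1.

Local Notation nu := (density_measure g0 mg).

Let mEg : measurable_fun setT (EFin \o g).
Proof. exact/measurable_EFinP. Qed.

Let nu0 : nu set0 = 0. Proof. exact: integral_set0. Qed.

Let nu_ge0 A : 0 <= nu A.
Proof. by apply: integral_ge0 => x _; rewrite lee_fin. Qed.

Let nu_sigma_additive : semi_sigma_additive nu.
Proof.
move=> F mF tF mUF; rewrite /density_measure; apply: cvg_toP.
  apply: ereal_nondecreasing_is_cvgn => m n mn.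
  by apply: lee_sum_nneg_natr => // k _ _; exact: nu_ge0.
rewrite ge0_integral_bigcup//; first exact: measurable_funTS.
by move=> x _; rewrite lee_fin.
Qed.

HB.instance Definition _ := isMeasure.Build _ _ _ nu nu0 nu_ge0 nu_sigma_additive.

Let integral_density_nnsfun (h : {nnsfun T >-> R}) E : measurable E ->
  \int[nu]_(x in E) (h x)%:E = \int[mu]_(x in E) ((h x)%:E * (g x)%:E).
Proof.
move=> mE; have mh r : measurable (h @^-1` [set r]) by exact: measurable_sfunP.
have mhi r : measurable_fun E (fun x => (r * \1_(h @^-1` [set r]) x)%:E).
  by apply/measurable_EFinP/measurable_funTS; exact: measurable_funM.
have -> : \int[nu]_(x in E) (h x)%:E = \int[nu]_(x in E)
    (\sum_(r \in range h) (r * \1_(h @^-1` [set r]) x)%:E).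
  by apply: eq_integral => x _; rewrite fimfunE fsumEFin.
have -> : \int[mu]_(x in E) ((h x)%:E * (g x)%:E) = \int[mu]_(x in E)
    (\sum_(r \in range h) (r * \1_(h @^-1` [set r]) x)%:E * (g x)%:E).
  apply: eq_integral => x _; rewrite -ge0_mule_fsuml; last first.
    by move=> r; exact: nnfun_muleindic_ge0.
  by rewrite fsumEFin// -fimfunE.
have mhg r : measurable_fun E
    (fun x => (r * \1_(h @^-1` [set r]) x)%:E * (g x)%:E).
  by apply: emeasurable_funM => //; exact: measurable_funTS.
have hi0 r x : 0 <= (r * \1_(h @^-1` [set r]) x)%:E.
  exact: nnfun_muleindic_ge0.
rewrite [LHS]ge0_integral_fsum; [|exact: mE|exact: mhi|by move=> ? ? ?; exact: hi0|exact: fimfunP].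
rewrite [RHS]ge0_integral_fsum; [|exact: mE|exact: mhg| |exact: fimfunP]; last first.
  by move=> r x _; rewrite mule_ge0 ?hi0 ?lee_fin.
apply: eq_fsbigr => r; rewrite inE => -[t _ <-].
have ht : (0 <= h t)%R by [].
have mi : measurable_fun E (fun x => (\1_(h @^-1` [set h t]) x)%:E : \bar R).
  by apply/measurable_EFinP/measurable_funTS.
have mig : measurable_fun E (fun x => (\1_(h @^-1` [set h t]) x)%:E * (g x)%:E).
  by apply: emeasurable_funM => //; exact: measurable_funTS.
under eq_integral do rewrite EFinM.
under [RHS]eq_integral do rewrite EFinM -muleA.
rewrite [LHS]ge0_integralZl//.
rewrite [RHS]ge0_integralZl//; last by move=> x _; rewrite mule_ge0 ?lee_fin.
congr (_ * _); rewrite integral_indic// setIC /= /density_measure.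
rewrite integral_mkcondr; apply: eq_integral => x _.
rewrite patchE indicE; case: (x \in _); by rewrite ?mul1e ?mul0e.
Qed.

(** Simple functions are settled by linearity; monotone convergence along the approximations [h n]
    does the rest on both sides. *)
Lemma ge0_integral_density (f : T -> \bar R) E : measurable E ->
  measurable_fun E f -> (forall x, E x -> 0 <= f x) ->
  \int[nu]_(x in E) f x = \int[mu]_(x in E) (f x * (g x)%:E).
Proof.
move=> mE mf f0; pose h := nnsfun_approx mE mf.
have cvgh x : E x -> (h n x)%:E @[n --> \oo] --> f x.
  by move=> Ex; exact: cvg_nnsfun_approx.
have ndh x a b : (a <= b)%N -> (h a x <= h b x)%R.
  by move=> ab; exact/lefP/nd_nnsfun_approx.
transitivity (\int[nu]_(x in E) limn (fun n => (h n x)%:E)).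
  by apply: eq_integral => x /[!inE] Ex; apply/esym/cvg_lim => //; exact: cvgh.
transitivity (\int[mu]_(x in E) limn (fun n => (h n x)%:E * (g x)%:E)); last first.
  apply: eq_integral => x /[!inE] Ex; apply/cvg_lim => //.
  by apply: cvgeZr => //; exact: cvgh.
have mh n : measurable_fun E (fun x => (h n x)%:E).
  by apply/measurable_EFinP/measurable_funTS.
rewrite [LHS]monotone_convergence//; last 2 first.
- by move=> n x _; rewrite lee_fin.
- by move=> x _ a b ab; rewrite lee_fin ndh.
rewrite [RHS]monotone_convergence//; last 3 first.
- by move=> n; apply: emeasurable_funM => //; exact: measurable_funTS.
- by move=> n x _; rewrite mule_ge0 ?lee_fin.
- by move=> x _ a b ab; rewrite lee_wpmul2r ?lee_fin// ndh.
by under eq_fun do rewrite integral_density_nnsfun//.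
Qed.

Let nu_setT : nu setT = 1. Proof. exact: g1. Qed.

HB.instance Definition _ := Measure_isProbability.Build _ _ _ nu nu_setT.

Lemma density_probability : exists P : probability T R,
  forall (f : T -> \bar R) E, measurable E ->
  measurable_fun E f -> (forall x, E x -> 0 <= f x) ->
  \int[P]_(x in E) f x = \int[mu]_(x in E) (f x * (g x)%:E).
Proof. by exists nu; exact: ge0_integral_density. Qed.

End Density.

(** * Convexity of powers and Schur's test *)

Section WeightedPower.
Context {R : realType}.

(** The graph of s^q lies above its tangent at a. For q > 1 and a > 0 this is Young's inequality for
    s and a^(q-1) with the conjugate exponents q and q/(q-1). *)
Lemma powR_tangent (q a s : R) : 1 <= q -> 0 <= a -> 0 <= s ->
  q * a `^ (q - 1) * s <= s `^ q + (q - 1) * a `^ q.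
Proof.
rewrite le_eqVlt => /predU1P[<-|q1] a0 s0.
  by rewrite subrr powRr0 powRr1// mul0r addr0 !mul1r.
have q0 : 0 < q by lra.
move: a0; rewrite le_eqVlt => /predU1P[<-|a0].
  by rewrite !powR0 ?subr_eq0 ?gt_eqF// !mulr0 mul0r addr0 powR_ge0.
have p0 : 0 < q / (q - 1) by rewrite divr_gt0// subr_gt0.
have qp : q^-1 + (q / (q - 1))^-1 = 1.
  by rewrite invf_div; field; rewrite gt_eqF.
have := conjugate_powR s0 (powR_ge0 a (q - 1)) q0 p0 qp.
rewrite -powRrM (_ : (q - 1) * (q / (q - 1)) = q); last first.
  by field; rewrite gt_eqF// subr_gt0.
rewrite -(ler_pM2l q0) => h.
have -> : q * a `^ (q - 1) * s = q * (s * a `^ (q - 1)) by ring.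
apply: (le_trans h); rewrite le_eqVlt; apply/orP; left; apply/eqP.
by rewrite invf_div; field; rewrite gt_eqF.
Qed.

End WeightedPower.

Section Schur.
Local Open Scope ereal_scope.
Context d (T : measurableType d) (R : realType).

(** Jensen's inequality for the measure of density [k], of mass at most [C]: the tangent inequality
    at a point a is integrated against [k], and a is then optimized. *)
Lemma integral_powR_le (mu : {measure set T -> \bar R}) (k f : T -> R) (q C : R) :
  (1 <= q)%R -> (0 < C)%R ->
  measurable_fun setT k -> measurable_fun setT f ->
  (forall x, (0 <= k x)%R) -> (forall x, (0 <= f x)%R) ->
  \int[mu]_x (k x)%:E <= C%:E ->
  (\int[mu]_x (k x * f x)%:E) `^ q <=
  (C `^ (q - 1))%:E * \int[mu]_x (k x * f x `^ q)%:E.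
Proof.
move=> q1 C0 mk mf k0 f0 kC.
have mkf : measurable_fun setT (fun x => (k x * f x)%:E).
  by apply/measurable_EFinP; exact: measurable_funM.
have mkfq : measurable_fun setT (fun x => (k x * f x `^ q)%:E).
  apply/measurable_EFinP; apply: measurable_funM => //.
  exact: (measurableT_comp (measurable_powR q)).
have kf0 x : 0 <= (k x * f x)%:E by rewrite lee_fin mulr_ge0.
have kfq0 x : 0 <= (k x * f x `^ q)%:E by rewrite lee_fin mulr_ge0// powR_ge0.
have mk' : measurable_fun setT (fun x => (k x)%:E) by exact/measurable_EFinP.
have ineq (a : R) : (0 < a)%R ->
    (q * a `^ (q - 1))%:E * \int[mu]_x (k x * f x)%:E <=
    \int[mu]_x (k x * f x `^ q)%:E + ((q - 1) * a `^ q)%:E * \int[mu]_x (k x)%:E.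
  move=> a0; have aq0 : (0 <= (q - 1) * a `^ q)%R.
    by rewrite mulr_ge0 ?powR_ge0// subr_ge0.
  have qa0 : (0 <= q * a `^ (q - 1))%R.
    by rewrite mulr_ge0 ?powR_ge0//; lra.
  rewrite -!ge0_integralZl//; last by move=> x _; rewrite lee_fin.
  rewrite -ge0_integralD//; last 2 first.
    by move=> x _; rewrite mule_ge0// lee_fin.
    exact: measurable_funeM.
  apply: ge0_le_integral => //.
  - by move=> x _; rewrite mule_ge0.
  - exact: measurable_funeM.
  - by apply: emeasurable_funD => //; exact: measurable_funeM.
  move=> x _ /=; rewrite -!EFinM -EFinD lee_fin.
  have := ler_wpM2l (k0 x) (powR_tangent q1 (ltW a0) (f0 x)).
  lra.
have k_fin : \int[mu]_x (k x)%:E \is a fin_num.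
  rewrite ge0_fin_numE ?(le_lt_trans kC) ?ltry//.
  by apply: integral_ge0 => x _; rewrite lee_fin.
have I0 : 0 <= \int[mu]_x (k x * f x)%:E by exact: integral_ge0.
have P0 : 0 <= \int[mu]_x (k x * f x `^ q)%:E by exact: integral_ge0.
have [->|Pfin] := eqVneq (\int[mu]_x (k x * f x `^ q)%:E) +oo.
  by rewrite gt0_muley ?leey// lte_fin powR_gt0.
have {}Pfin : \int[mu]_x (k x * f x `^ q)%:E \is a fin_num.
  by rewrite ge0_fin_numE// ltey.
(* The tangent at a = 1 already bounds q times this integral by finite quantities. *)
have Ifin : \int[mu]_x (k x * f x)%:E \is a fin_num.
  rewrite ge0_fin_numE//.
  have := ineq 1%R ltr01; rewrite !powR1 !mulr1 => h.
  have {h} : q%:E * \int[mu]_x (k x * f x)%:E < +oo.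
    by apply: le_lt_trans h _; rewrite lte_add_pinfty// ltey_eq ?fin_numM// Pfin.
  case: (\int[mu]_x (k x * f x)%:E) I0 => [r _ _|_|//]; first exact: ltry.
  by rewrite gt0_muley// lte_fin (lt_le_trans _ q1).
move: kC ineq I0 P0; rewrite -(fineK k_fin) -(fineK Pfin) -(fineK Ifin).
set I := fine (\int[mu]_x (k x * f x)%:E).
set P := fine (\int[mu]_x (k x * f x `^ q)%:E).
set kk := fine (\int[mu]_x (k x)%:E).
rewrite poweR_EFin -EFinM !lee_fin => kC ineq I0 P0.
have [I00|Ine0] := eqVneq I 0%R.
  have q0 : q != 0%R by apply/eqP; lra.
  by rewrite I00 powR0// mulr_ge0// powR_ge0.
have {Ine0}I0 : (0 < I)%R by rewrite lt_neqAle eq_sym Ine0.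
(* The optimal tangent point is I / C: there the inequality reduces to C (I / C)^q <= P, since [kk]
   is at most [C]. *)
have a0 : (0 < I / C)%R by rewrite divr_gt0.
have := ineq _ a0; rewrite -!EFinM -EFinD lee_fin => h.
have {}h : (C * (I / C) `^ q <= P)%R.
  have e1 : ((I / C) `^ (q - 1) * I = C * (I / C) `^ q)%R.
    rewrite -(@mulr_powRB1 _ (I / C) q) ?(ltW a0)//; last lra.
    by field; rewrite gt_eqF.
  have e2 : ((q - 1) * (I / C) `^ q * kk <= (q - 1) * (I / C) `^ q * C)%R.
    by rewrite ler_wpM2l// mulr_ge0 ?powR_ge0//; lra.
  have e3 : (q * (I / C) `^ (q - 1) * I = q * (C * (I / C) `^ q))%R.
    by rewrite -e1; ring.
  move: h; rewrite e3; nra.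
have -> : (I `^ q = C `^ (q - 1) * (C * (I / C) `^ q))%R.
  rewrite mulrA [(_ * C)%R]mulrC mulr_powRB1 ?(ltW C0)//; last lra.
  by rewrite -powRM ?(ltW C0)// ?(ltW a0)// mulrC divfK// gt_eqF.
by rewrite ler_wpM2l// powR_ge0.
Qed.

Section Curried.
Variables (mu : {sigma_finite_measure set T -> \bar R}) (F : T -> T -> \bar R).
Hypothesis mF : measurable_fun setT (fun z : T * T => F z.1 z.2).
Hypothesis F0 : forall z : T * T, 0 <= F z.1 z.2.

Lemma measurable_fun_curried1 : measurable_fun setT (fun x => \int[mu]_y F x y).
Proof. exact: (@measurable_fun_fubini_tonelli_F _ _ T T R mu _ mF F0). Qed.

Lemma measurable_fun_curried2 : measurable_fun setT (fun y => \int[mu]_x F x y).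
Proof. exact: (@measurable_fun_fubini_tonelli_G _ _ T T R mu _ mF F0). Qed.

Lemma tonelli_curried :
  \int[mu]_x \int[mu]_y F x y = \int[mu]_y \int[mu]_x F x y.
Proof. exact: (@fubini_tonelli _ _ T T R mu mu _ mF F0). Qed.

End Curried.

Lemma integral_poweR_le (mu : {measure set T -> \bar R}) (G F : T -> \bar R)
    (q c : R) : (0 <= c)%R -> measurable_fun setT G -> measurable_fun setT F ->
  (forall x, 0 <= F x) -> (forall x, G x `^ q <= c%:E * F x) ->
  \int[mu]_x G x `^ q <= c%:E * \int[mu]_x F x.
Proof.
move=> c0 mG mF F0 GF; rewrite -ge0_integralZl ?lee_fin//.
apply: ge0_le_integral => //.
- by move=> x _; exact: poweR_ge0.
- exact: (measurableT_comp (measurable_poweR q) mG).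
- exact: measurable_funeM.
Qed.

Lemma integral_mulr_le (mu : {measure set T -> \bar R}) (k : T -> R) (c C : R) :
  measurable_fun setT k -> (forall x, (0 <= k x)%R) -> (0 <= c)%R ->
  \int[mu]_x (k x)%:E <= C%:E -> \int[mu]_x (k x * c)%:E <= C%:E * c%:E.
Proof.
move=> mk k0 c0 kC; under eq_integral do rewrite EFinM muleC.
rewrite ge0_integralZl ?lee_fin//.
- by rewrite muleC lee_wpmul2r// lee_fin.
- exact/measurable_EFinP.
- by move=> x _; rewrite lee_fin.
Qed.

(** Jensen along each row costs C^(q-1); after Tonelli the column bound contributes the last factor
    C. *)
Lemma schur_test (mu : {sigma_finite_measure set T -> \bar R})
    (K : T -> T -> R) (f : T -> R) (q C : R) :
  (1 <= q)%R -> (0 < C)%R ->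
  measurable_fun setT (fun z => K z.1 z.2) -> measurable_fun setT f ->
  (forall x, \int[mu]_y (`|K x y|)%:E <= C%:E) ->
  (forall y, \int[mu]_x (`|K x y|)%:E <= C%:E) ->
  \int[mu]_x (\int[mu]_y (`|K x y| * `|f y|)%:E) `^ q <=
  (C `^ q)%:E * \int[mu]_x (`|f x| `^ q)%:E.
Proof.
move=> q1 C0 mK mf K1 K2.
have Cq : (C `^ q = C `^ (q - 1) * C)%R.
  by rewrite mulrC mulr_powRB1 ?(ltW C0)//; lra.
have Cq0 : (0 <= C `^ (q - 1))%R by rewrite powR_ge0.
have C0E : 0 <= C%:E by rewrite lee_fin ltW.
have mfq : measurable_fun setT (fun y => `|f y| `^ q)%R.
  apply: (measurableT_comp (measurable_powR q)).
  exact: measurableT_comp.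
have mKn : measurable_fun setT (fun z : T * T => `|K z.1 z.2|)%R.
  exact: measurableT_comp.
have mfn : measurable_fun setT (fun y => `|f y|)%R by exact: measurableT_comp.
have mKx x : measurable_fun setT (fun y => `|K x y|)%R.
  exact: (measurableT_comp mKn (pair1_measurable x)).
have mKy y : measurable_fun setT (fun x => `|K x y|)%R.
  exact: (measurableT_comp mKn (pair2_measurable y)).
have mF : measurable_fun setT (fun z : T * T => (`|K z.1 z.2| * `|f z.2| `^ q)%:E).
  apply/measurable_EFinP; apply: measurable_funM => //.
  exact: (measurableT_comp mfq measurable_snd).
have F0 (z : T * T) : 0 <= (`|K z.1 z.2| * `|f z.2| `^ q)%:E.
  by rewrite lee_fin mulr_ge0// powR_ge0.
have mG : measurable_fun setT (fun z : T * T => (`|K z.1 z.2| * `|f z.2|)%:E).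
  apply/measurable_EFinP; apply: measurable_funM => //.
  exact: (measurableT_comp mfn measurable_snd).
have G0 (z : T * T) : 0 <= (`|K z.1 z.2| * `|f z.2|)%:E.
  by rewrite lee_fin mulr_ge0.
have mGx : measurable_fun setT (fun x => \int[mu]_y (`|K x y| * `|f y|)%:E).
  exact: (@measurable_fun_curried1 mu (fun x y => (`|K x y| * `|f y|)%:E)).
have mFx : measurable_fun setT
    (fun x => \int[mu]_y (`|K x y| * `|f y| `^ q)%:E).
  exact: (@measurable_fun_curried1 mu (fun x y => (`|K x y| * `|f y| `^ q)%:E)).
have mFy : measurable_fun setT
    (fun y => \int[mu]_x (`|K x y| * `|f y| `^ q)%:E).
  exact: (@measurable_fun_curried2 mu (fun x y => (`|K x y| * `|f y| `^ q)%:E)).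
have swap : \int[mu]_x \int[mu]_y (`|K x y| * `|f y| `^ q)%:E =
            \int[mu]_y \int[mu]_x (`|K x y| * `|f y| `^ q)%:E.
  exact: (@tonelli_curried mu (fun x y => (`|K x y| * `|f y| `^ q)%:E)).
have step x : (\int[mu]_y (`|K x y| * `|f y|)%:E) `^ q <=
    (C `^ (q - 1))%:E * \int[mu]_y (`|K x y| * `|f y| `^ q)%:E.
  by apply: integral_powR_le.
have Fx0 x : 0 <= \int[mu]_y (`|K x y| * `|f y| `^ q)%:E.
  exact: integral_ge0.
apply: (le_trans (integral_poweR_le mu Cq0 mGx mFx Fx0 step)).
rewrite swap {}Cq EFinM -muleA; apply: lee_wpmul2l; first by rewrite lee_fin.
have mfqE : measurable_fun setT (fun x => (`|f x| `^ q)%:E).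
  exact/measurable_EFinP.
have fq0 (x : T) : setT x -> 0 <= (`|f x| `^ q)%:E.
  by move=> _; rewrite lee_fin powR_ge0.
rewrite -(ge0_integralZl mu measurableT mfqE fq0 C0E).
apply: (ge0_le_integral mu measurableT _ mFy); first by move=> y _; exact: integral_ge0.
  exact: measurable_funeM.
by move=> y _; apply: integral_mulr_le => //; exact: powR_ge0.
Qed.

End Schur.

(** * Polynomials on the domain *)

Section Polynomials.
Context {R : realType} {d : nat}.
Variable Omega : set 'rV[R]_d.
Implicit Types (f g : 'rV[R]_d -> R) (n : nat).

Lemma polys_ext n f g : (forall x, Omega x -> f x = g x) ->
  polys Omega n g -> polys Omega n f.
Proof.
move=> fg [q sq gq]; exists q => // x Ox.
by rewrite fg// gq.
Qed.

Lemma polys_cst n (c : R) : polys Omega n (fun=> c).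
Proof.
exists (mpoly.mpolyC d c) => [|x _]; last by rewrite mpoly.mevalC.
by rewrite mpoly.msizeC; case: eqP.
Qed.

Lemma polysW n k f : (n <= k)%N -> polys Omega n f -> polys Omega k f.
Proof.
by move=> nk [q sq fq]; exists q => //; rewrite (leq_trans sq).
Qed.

Lemma polys_lin n (c : R) f g : polys Omega n f -> polys Omega n g ->
  polys Omega n (fun x => c * f x + g x).
Proof.
move=> [p sp fp] [q sq gq]; exists (c *: p + q) => [|x Ox].
  apply: (leq_trans (mpoly.msizeD_le _ _)); rewrite geq_max sq andbT.
  exact: leq_trans (mpoly.msizeZ_le _ _) sp.
by rewrite mpoly.mevalD mpoly.mevalZ fp// gq.
Qed.

Lemma polysM n k f g : polys Omega n f -> polys Omega k g ->
  exists l, polys Omega l (fun x => f x * g x).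
Proof.
move=> [p _ fp] [q _ gq]; exists (mpoly.msize (p * q)).
exists (p * q) => [|x Ox]; first exact: leqnSn.
by rewrite mpoly.mevalM fp// gq.
Qed.

Lemma polys_sum n (I : Type) (s : seq I) (F : I -> 'rV[R]_d -> R) :
  (forall i, polys Omega n (F i)) -> polys Omega n (fun x => \sum_(i <- s) F i x).
Proof.
move=> FP; elim: s => [|i s IH].
  by apply: polys_ext (polys_cst n 0) => x _; rewrite big_nil.
apply: polys_ext (polys_lin 1 (FP i) IH) => x _.
by rewrite big_cons mul1r.
Qed.

Lemma polysZ n (c : R) f : polys Omega n f -> polys Omega n (fun x => c * f x).
Proof.
move=> fP; apply: polys_ext (polys_lin c fP (polys_cst n 0)) => x _.
by rewrite addr0.
Qed.

Lemma continuous_bigprod (T : topologicalType) (I : Type) (s : seq I)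
    (F : I -> T -> R) : (forall i, continuous (F i)) ->
  continuous (fun x => \prod_(i <- s) F i x).
Proof.
move=> Fc; elim: s => [|i s IH].
  by under eq_fun do rewrite big_nil; exact: cst_continuous.
under eq_fun do rewrite big_cons.
by move=> x; apply: continuousM; [exact: Fc|exact: IH].
Qed.

Lemma continuous_bigsum (T : topologicalType) (I : Type) (s : seq I)
    (F : I -> T -> R) : (forall i, continuous (F i)) ->
  continuous (fun x => \sum_(i <- s) F i x).
Proof.
move=> Fc; elim: s => [|i s IH].
  by under eq_fun do rewrite big_nil; exact: cst_continuous.
under eq_fun do rewrite big_cons.
by move=> x; apply: continuousD; [exact: Fc|exact: IH].
Qed.

(** The monomials of degree at most [n]. They may be linearly dependent on [Omega], for instance on
    a surface, so they are only claimed to span; finiteness is what [interpolation] needs. *)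
Lemma polys_span n : exists (I : finType) (e : I -> 'rV[R]_d -> R),
  (forall i, continuous (e i)) /\
  forall f, polys Omega n f -> exists c : I -> R,
    forall x, Omega x -> f x = \sum_i c i * e i x.
Proof.
exists (mpoly.bmultinom d n.+1 : finType).
exists (fun m x => mpoly.mmap1 (fun i => x ord0 i) (mpoly.bmnm m)); split.
  move=> m; rewrite /mpoly.mmap1; apply: continuous_bigprod => i.
  have := @coord_continuous R 1 d ord0 i.
  elim: ((mpoly.bmnm m : 'I_d -> nat) i) => [|k IH] cc.
    by under eq_fun do rewrite expr0; exact: cst_continuous.
  under eq_fun do rewrite exprS.
  by move=> x; exact: (continuousM (cc x) (IH cc x)).
move=> f [q sq fq]; exists (fun m => mpoly.mcoeff (mpoly.bmnm m) q) => x Ox.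
by rewrite fq// /mpoly.meval (mpoly.mmapE _ sq).
Qed.

Lemma polys_continuous n f : polys Omega n f ->
  exists2 g, continuous g & forall x, Omega x -> f x = g x.
Proof.
have [I [e [ec es]]] := polys_span n => /es[c fE].
exists (fun x => \sum_i c i * e i x) => //.
apply: continuous_bigsum => i x; apply: continuousM; last exact: ec.
exact: cst_continuous.
Qed.

Lemma second_order_derivation_cst D (c : R) x :
  second_order_derivation Omega D -> Omega x -> D (fun=> c) x = 0.
Proof.
move=> [a [b Dab]] Ox; rewrite (Dab (mpoly.mpolyC d c)) => //; last first.
  by move=> y _; rewrite mpoly.mevalC.
rewrite /= [X in X + _]big1 ?add0r; last first.
  move=> i _; apply: big1 => j _.
  by rewrite mpoly.mderivC linear0 mpoly.meval0 mulr0.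
by apply: big1 => i _; rewrite mpoly.mderivC mpoly.meval0 mulr0.
Qed.

End Polynomials.

(** * Interpolation at finitely many points in a finite-dimensional space of functions *)

Section Interpolation.
Context {R : fieldType} {T : Type}.
Variables (Omega : set T) (V : set (T -> R)).
Hypothesis Vlin : forall (c : R) f g, V f -> V g -> V (fun x => c * f x + g x).

Let dual n := exists (x : 'I_n -> T) (l : 'I_n -> T -> R),
  [/\ forall i, Omega (x i), forall i, V (l i) &
      forall i j, l i (x j) = (i == j)%:R].

Let Vsum (J : Type) (s : seq J) (c : J -> R) (F : J -> T -> R) f :
  V f -> (forall j, V (F j)) -> V (fun x => \sum_(j <- s) c j * F j x + f x).
Proof.
move=> Vf VF; elim: s => [|j s IH].
  by move: Vf; congr V; apply/funext => x; rewrite big_nil add0r.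
move: (Vlin (c j) (VF j) IH); congr V; apply/funext => x.
by rewrite big_cons addrA.
Qed.

(** Nodes with dual functions form systems of bounded size, and a system that does not reproduce all
    of [V] can be enlarged by one node. If no system reproduced [V], there would be systems of every
    size. *)
Lemma interpolation (I : finType) (e : I -> T -> R) :
  (forall f, V f -> exists c, forall x, Omega x -> f x = \sum_i c i * e i x) ->
  exists (n : nat) (x : 'I_n -> T) (l : 'I_n -> T -> R),
    [/\ forall i, Omega (x i), forall i, V (l i) &
      forall Y, V Y -> forall y, Omega y -> Y y = \sum_i Y (x i) * l i y].
Proof.
move=> span; apply: contrapT => noI.
(* Duality says that the identity matrix of size [n] is a product [C *m E] through dimension
   [#|I|]. *)
have dual_le n : dual n -> (n <= #|I|)%N.
  move=> [x [l [Ox Vl lx]]].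
  have [c cE] := choice (fun i => span _ (Vl i)).
  pose C : 'M[R]_(n, #|I|) := \matrix_(i, k) c i (enum_val k).
  pose E : 'M[R]_(#|I|, n) := \matrix_(k, j) e (enum_val k) (x j).
  apply: (@mulmx1_min _ _ _ C E); apply/matrixP => i j.
  rewrite !mxE -(lx i j) cE// [RHS](reindex_onto enum_val enum_rank)/=; last first.
    by move=> k _; rewrite enum_rankK.
  apply: eq_big => [k|k _]; last by rewrite !mxE.
  by rewrite enum_valK eqxx.
suff dualS n : dual n -> dual n.+1.
  have /dual_le : dual #|I|.+1.
    elim: #|I|.+1 => [|n]; last exact: dualS.
    by exists (fun i : 'I_0 => match notF (ltn_ord i) with end),
      (fun i _ => 0); split; case.
  by rewrite ltnn.
move=> [x [l [Ox Vl lx]]].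
have [Y [VY [y [Oy Yy]]]] : exists Y, V Y /\ exists y, Omega y /\
    Y y != \sum_i Y (x i) * l i y.
  apply: contrapT => H; apply: noI; exists n, x, l; split => // Y VY y Oy.
  apply/eqP/negPn/negP => Yy; apply: H; exists Y; split => //; exists y.
  by split.
(* The interpolation error of [Y] vanishes at the old nodes but not at [y]. Normalized to [W], it is
   the dual function of the new node [y]; the old dual functions are corrected by multiples of [W]
   to vanish at [y]. *)
pose Z t := \sum_i (- Y (x i)) * l i t + Y t.
have VZ : V Z by exact: Vsum.
have Zx j : Z (x j) = 0.
  rewrite /Z (bigD1 j)//= lx eqxx mulr1 big1 ?addr0 ?addNr// => i ij.
  by rewrite lx (negbTE ij) mulr0.
have Zy : Z y != 0.
  rewrite /Z; under eq_bigr do rewrite mulNr.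
  by rewrite sumrN addrC subr_eq0.
pose W t := (Z y)^-1 * Z t + 0 * Z t.
have VW : V W.
  have := Vlin ((Z y)^-1) VZ (Vlin (-1) VZ VZ).
  by congr V; apply/funext => t; rewrite /W mulN1r addNr mul0r.
have Wx j : W (x j) = 0 by rewrite /W Zx !mulr0 addr0.
have Wy : W y = 1 by rewrite /W mul0r addr0 mulVf.
exists (fun i => if unlift ord_max i is Some j then x j else y).
exists (fun i => if unlift ord_max i is Some j
  then fun t => (- l j y) * W t + l j t else W); split.
- by move=> i; case: unliftP.
- by move=> i; case: unliftP => // j _; exact: Vlin.
move=> i j; case: unliftP => [i' ->|->]; case: unliftP => [j' ->|->].
- by rewrite Wx mulr0 add0r lx (inj_eq lift_inj).
- by rewrite Wy mulr1 addNr eq_sym (negbTE (neq_lift _ _)).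
- by rewrite Wx (negbTE (neq_lift _ _)).
- by rewrite Wy eqxx.
Qed.

End Interpolation.

Section Weighted.
Local Open Scope ereal_scope.
Context d (T : measurableType d) (R : realType).
Variables (m : {measure set T -> \bar R}) (D : set T) (w : T -> R).
Hypothesis mD : measurable D.
Hypothesis mw : measurable_fun D w.
Hypothesis w0 : forall x, D x -> (0 <= w x)%R.

Definition weighted (nu : {measure set T -> \bar R}) :=
  forall f : T -> \bar R, measurable_fun D f -> (forall x, D x -> 0 <= f x) ->
  \int[nu]_(x in D) f x = \int[m]_(x in D) (f x * (w x)%:E).

Lemma weighted_probability : \int[m]_(x in D) (w x)%:E = 1 ->
  exists nu : probability T R, weighted nu /\ nu D = 1.
Proof.
move=> w1; pose g := w \_ D.
have g0 x : (0 <= g x)%R.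
  by rewrite /g patchE; case: ifPn => // /[!inE]; exact: w0.
have mg : measurable_fun setT g by exact/(measurable_restrictT _ _).1.
have g1 : \int[m]_x (g x)%:E = 1.
  by rewrite -w1 [RHS]integral_mkcond; apply: eq_integral => x _; rewrite restrict_EFin.
have [nu nuE] := density_probability g0 mg g1.
exists nu; split.
  move=> f mf f0; rewrite nuE//; apply: eq_integral => x xD.
  by rewrite /g patchE xD.
have -> : nu D = \int[nu]_(x in D) 1 by rewrite integral_cst// mul1e.
rewrite nuE// -[RHS]w1; apply: eq_integral => x xD.
by rewrite mul1e /g patchE xD.
Qed.

Variable nu : probability T R.
Hypothesis nuw : weighted nu.
Hypothesis nuD : nu D = 1.

Let mEw : measurable_fun D (EFin \o w). Proof. exact/measurable_EFinP. Qed.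

Lemma weighted_measure E : measurable E -> E `<=` D ->
  nu E = \int[m]_(x in E) (w x)%:E.
Proof.
move=> mE ED.
have -> : nu E = \int[nu]_(x in D) (\1_E x)%:E.
  by rewrite integral_indic// (setIidl ED).
rewrite nuw//.
  rewrite -{2}(setIidr ED) integral_mkcondr; apply: eq_integral => x _.
  by rewrite patchE indicE; case: (x \in E); rewrite ?mul1e ?mul0e.
by apply/measurable_EFinP/measurable_funTS.
Qed.

Lemma weighted_integral (f : T -> R) : measurable_fun D f ->
  \int[nu]_(x in D) (f x)%:E = \int[m]_(x in D) (f x * w x)%:E.
Proof.
move=> mf; rewrite [LHS]integralE [RHS]integralE.
have mEf : measurable_fun D (EFin \o f) by exact/measurable_EFinP.
have mp : measurable_fun D (EFin \o f)^\+ by exact: measurable_funepos.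
have mn : measurable_fun D (EFin \o f)^\- by exact: measurable_funeneg.
rewrite !nuw//; congr (_ - _); apply: eq_integral => x /[!inE] Dx.
- rewrite !funeposE -[0]/(0%R%:E) -!EFin_max -EFinM; congr EFin.
  by rewrite maxr_pMl ?w0// mul0r.
- rewrite !funenegE -[0]/(0%R%:E) -!EFinN -!EFin_max -EFinM; congr EFin.
  by rewrite maxr_pMl ?w0// mul0r mulNr.
Qed.

Lemma weighted_Rintegral (f : T -> R) : measurable_fun D f ->
  (\int[nu]_(x in D) f x = \int[m]_(x in D) (f x * w x))%R.
Proof. by move=> mf; rewrite /Rintegral weighted_integral. Qed.

Lemma weighted_integrable (f : T -> R) : measurable_fun D f ->
  nu.-integrable D (EFin \o f) <-> m.-integrable D (fun x => (f x * w x)%:E).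
Proof.
move=> mf; have mfn : measurable_fun D (fun x => `|f x|)%R.
  exact: measurableT_comp.
have E : \int[nu]_(x in D) `|(EFin \o f) x| = \int[m]_(x in D) `|(f x * w x)%:E|.
  transitivity (\int[nu]_(x in D) (`|f x|)%:E) => //.
  rewrite weighted_integral//; apply: eq_integral => x /[!inE] Dx.
  by rewrite abse_EFin normrM (ger0_norm (w0 Dx)).
split=> /integrableP[_]; first rewrite E; last rewrite -E;
  move=> fin; apply/integrableP; split => //.
- by apply/measurable_EFinP; exact: measurable_funM.
- exact/measurable_EFinP.
Qed.

Lemma weighted_restrict (f : T -> \bar R) : measurable_fun setT f ->
  (forall x, 0 <= f x) -> \int[nu]_x f x = \int[nu]_(x in D) f x.
Proof.
move=> mf f0; have mDC : measurable (~` D) by exact: measurableC.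
rewrite -{1}(setvU D) ge0_integral_setU//=; last first.
- by apply/disj_setPS; rewrite setICl.
- by rewrite setvU.
rewrite (_ : \int[nu]_(x in ~` D) f x = 0) ?add0e//.
apply: null_set_integral => //; first exact: measurable_funTS.
by apply: etrans (probability_setC nu mD) _; rewrite nuD subee.
Qed.

End Weighted.

(** The integral of a nonnegative function is a supremum over the simple functions below it, hence
    monotone without measurability. The integrand of Assertion 3 contains the mass of a ball as a
    function of its centre, whose measurability is not established. *)
Lemma le_integral_nomeas d (T : measurableType d) (R : realType)
    (mu : {measure set T -> \bar R}) (D : set T) (f g : T -> \bar R) :
  (forall x, D x -> (0 <= f x)%E) -> (forall x, D x -> (f x <= g x)%E) ->
  (\int[mu]_(x in D) f x <= \int[mu]_(x in D) g x)%E.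
Proof.
move=> f0 fg; rewrite (integral_mkcond D f) (integral_mkcond D g).
have fg' x : ((f \_ D) x <= (g \_ D) x)%E by exact: lee_restrict.
have f0' x : (0 <= (f \_ D) x)%E by exact: erestrict_ge0.
have g0' x : (0 <= (g \_ D) x)%E by exact: le_trans (f0' x) (fg' x).
rewrite !ge0_integralTE//; apply: ereal_sup_le => _ [h hf <-].
by exists h => // x; exact: le_trans (hf x) (fg' x).
Qed.

(** * Metric and doubling geometry *)

Section MetricTopology.
Context {R : realType} {d : nat}.
Variables (Omega : set 'rV[R]_d) (dist : 'rV[R]_d -> 'rV[R]_d -> R).
Hypothesis mOmega : measurable (Omega : set (borelV R d)).
Hypothesis hdist : metric_on Omega dist.

Lemma dist_xx x : Omega x -> dist x x = 0.
Proof. by move=> Ox; apply/(dist_eq0 hdist). Qed.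

Lemma dist_ge0 x y : Omega x -> Omega y -> 0 <= dist x y.
Proof.
move=> Ox Oy; have := dist_triangle hdist Ox Oy Ox.
rewrite dist_xx// (dist_sym hdist Oy Ox); lra.
Qed.

Lemma euclid_dist_coord (x y : 'rV[R]_d) i :
  `|x ord0 i - y ord0 i| <= euclid_dist x y.
Proof.
rewrite -sqrtr_sqr; apply: ler_wsqrtr.
by rewrite (bigD1 i)//= lerDl sumr_ge0// => j _; exact: sqr_ge0.
Qed.

Lemma euclid_dist_norm (x y : 'rV[R]_d) (e : R) : 0 < e ->
  (forall i, `|x ord0 i - y ord0 i| < e / d.+1%:R) -> euclid_dist x y < e.
Proof.
move=> e0 H; rewrite -[ltRHS](ger0_norm (ltW e0)) -sqrtr_sqr ltr_sqrt ?exprn_gt0//.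
have d0 : 0 < e / d.+1%:R by rewrite divr_gt0.
apply: (@le_lt_trans _ _ (\sum_(i < d) (e / d.+1%:R) ^+ 2)).
  apply: ler_sum => i _; rewrite -real_normK ?num_real//.
  by rewrite ler_pXn2r// ?nnegrE ?ltW.
rewrite sumr_const card_ord -[ltLHS]mulr_natr expr_div_n -mulrA gtr_pMr ?exprn_gt0//.
rewrite mulrC ltr_pdivrMr ?exprn_gt0// mul1r -natrX ltr_nat.
by rewrite expnS expn1 (@leq_trans d.+1)// leq_pmulr.
Qed.

Lemma nbhs_mball x (A : set 'rV[R]_d) : Omega x -> nbhs x A ->
  exists2 r : R, 0 < r & forall y, Omega y -> dist x y < r -> A y.
Proof.
move=> Ox /nbhs_ballP[e /= e0 xA].
have [r r0 re] := dist_fine hdist Ox e0.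
exists r => // y Oy xy; apply: xA.
split=> // i j; rewrite (ord1 i).
exact: le_lt_trans (euclid_dist_coord _ _ _) (re _ Oy xy).
Qed.

Lemma mball_nbhs x (e : R) : Omega x -> 0 < e ->
  \forall y \near x, Omega y -> dist x y < e.
Proof.
move=> Ox e0; have [r r0 re] := dist_coarse hdist Ox e0.
apply/nbhs_ballP; exists (r / d.+1%:R) => /=; first by rewrite divr_gt0.
move=> y [_ xy] Oy; apply: re => //; apply: euclid_dist_norm => // i.
exact: xy.
Qed.

Lemma dist_continuous_within (f : 'rV[R]_d -> R) :
  (forall x e, Omega x -> 0 < e -> exists2 r : R, 0 < r &
    forall y, Omega y -> dist x y < r -> `|f x - f y| < e) ->
  {within Omega, continuous f}.
Proof.
move=> fc; apply/subspace_continuousP => x Ox; apply/cvgrPdist_lt => e e0.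
have [r r0 rf] := fc _ _ Ox e0.
rewrite near_withinE; near=> y => Oy; apply: rf => //.
by move: Oy; near: y; exact: mball_nbhs.
Unshelve. all: by end_near. Qed.

Lemma within_continuous_measurable (f : 'rV[R]_d -> R) :
  {within Omega, continuous f} ->
  measurable_fun (Omega : set (borelV R d)) (f : borelV R d -> R).
Proof.
move=> /continuousP cf; apply: (measurability _ (RGenOpens.measurableE R)).
move=> _ [_ [a [b ->] <-]].
have := cf `]a, b[%classic (@interval_open R (BRight a) (BLeft b) isT isT).
move=> /open_subspaceP[U oU UE].
rewrite [X in measurable X](_ : _ = U `&` Omega).
  by apply: measurableI => //; exact: sub_sigma_algebra.
by rewrite UE setIC.
Qed.

Lemma lipschitz_within_continuous (f : 'rV[R]_d -> R) (k : R) :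
  (forall x y, Omega x -> Omega y -> `|f x - f y| <= k * dist x y) ->
  {within Omega, continuous f}.
Proof.
move=> fk; apply: dist_continuous_within => x e Ox e0.
exists (e / (`|k| + 1)) => [|y Oy xy]; first by rewrite divr_gt0// ltr_wpDl.
apply: le_lt_trans (fk _ _ Ox Oy) _; move: xy; rewrite ltr_pdivlMr ?ltr_wpDl//.
apply: le_lt_trans; rewrite mulrC; apply: ler_wpM2l; first exact: dist_ge0.
by rewrite (le_trans (ler_norm _))// lerDl.
Qed.

Lemma dist_lipschitz x y z : Omega x -> Omega y -> Omega z ->
  `|dist x y - dist x z| <= dist y z.
Proof.
move=> Ox Oy Oz.
have := dist_triangle hdist Ox Oy Oz; have := dist_triangle hdist Ox Oz Oy.
rewrite (dist_sym hdist Oz Oy) ler_norml => h1 h2; apply/andP; split; lra.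
Qed.

Lemma measurable_dist x : Omega x ->
  measurable_fun (Omega : set (borelV R d)) (dist x : borelV R d -> R).
Proof.
move=> Ox; apply: within_continuous_measurable.
apply: (@lipschitz_within_continuous _ 1) => y z Oy Oz.
by rewrite mul1r; exact: dist_lipschitz.
Qed.

Lemma measurable_mball x (r : R) : Omega x ->
  measurable (mball Omega dist x r : set (borelV R d)).
Proof.
move=> Ox; have := measurable_dist Ox mOmega (measurable_itv `]-oo, r[).
by congr measurable.
Qed.

End MetricTopology.

Section DoublingGeometry.
Context {R : realType} {d : nat}.
Variables (Omega : set 'rV[R]_d) (dist : 'rV[R]_d -> 'rV[R]_d -> R).
Variable m : {measure set (borelV R d) -> \bar R}.
Variable w : 'rV[R]_d -> R.
Variable nu : probability (borelV R d) R.
Hypothesis mOmega : measurable (Omega : set (borelV R d)).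
Hypothesis hdist : metric_on Omega dist.
Hypothesis hw : doubling_weight Omega dist m w.
Hypothesis nuw : weighted m Omega w nu.
Hypothesis nuO : nu Omega = 1%E.

Local Notation W x r := (wmeas m w (mball Omega dist x r)).

Lemma mball_sub x (r : R) : mball Omega dist x r `<=` Omega.
Proof. by move=> y []. Qed.

Lemma wmeas_ballE x (r : R) : Omega x ->
  (W x r)%:E = nu (mball Omega dist x r).
Proof.
move=> Ox; have mB := measurable_mball mOmega hdist r Ox.
rewrite (weighted_measure mOmega nuw mB)//;
  last exact: mball_sub.
rewrite /wmeas /Rintegral fineK//.
rewrite -(weighted_measure mOmega nuw mB)//;
  last exact: mball_sub.
exact: fin_num_measure.
Qed.

Lemma wball_ge0 x (r : R) : Omega x -> 0 <= W x r.
Proof. by move=> Ox; rewrite -lee_fin wmeas_ballE. Qed.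

Lemma wball_le x y (r s : R) : Omega x -> Omega y ->
  (forall z, Omega z -> dist x z < r -> dist y z < s) -> W x r <= W y s.
Proof.
move=> Ox Oy H; rewrite -lee_fin !wmeas_ballE//; apply: le_measure.
- by rewrite inE; exact: measurable_mball.
- by rewrite inE; exact: measurable_mball.
- by move=> z [Oz xz]; split => //; exact: H.
Qed.

Lemma wball_shift x y (r s : R) : Omega x -> Omega y -> dist x y + r <= s ->
  W y r <= W x s.
Proof.
move=> Ox Oy rs; apply: wball_le => // z Oz yz.
by have := dist_triangle hdist Ox Oy Oz; lra.
Qed.

Lemma wball_mono x (r s : R) : Omega x -> r <= s -> W x r <= W x s.
Proof. by move=> Ox rs; apply: wball_shift => //; rewrite (dist_xx hdist Ox) add0r. Qed.

Lemma domain_nonempty : exists x, Omega x.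
Proof.
apply/set0P/negP => /eqP O0; have := nuO; rewrite O0 measure0 => /eqP.
by rewrite eq_sym onee_eq0.
Qed.

Lemma wball_exhaust x (c : R) : Omega x -> c < 1 -> exists r : R, 0 < r /\ c < W x r.
Proof.
move=> Ox c1; pose F (k : nat) := mball Omega dist x k.+1%:R.
have mF k : measurable (F k : set (borelV R d)) by exact: measurable_mball.
have FO : \bigcup_k F k = Omega.
  apply/seteqP; split=> [y [k _ []]//|y Oy].
  exists (Num.truncn (dist x y)) => //; split => //.
  exact: truncnS_gt.
have ndF : nondecreasing_seq F.
  move=> a b ab; apply/subsetPset => y [Oy xy]; split => //.
  by apply: lt_le_trans xy _; rewrite ler_nat.
have mFO : measurable (\bigcup_k F k : set (borelV R d)) by rewrite FO.
have := nondecreasing_cvg_mu mF mFO ndF (mu := nu).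
rewrite [X in _ --> nu X]FO nuO => cv.
have c1E : (c%:E < 1%E :> \bar R)%E by rewrite lte_fin.
have [k _ /(_ k (leqnn k))] := cv _ (open_ereal_gt' c1E).
rewrite /= -wmeas_ballE// lte_fin => ck.
by exists k.+1%:R.
Qed.

(** The doubling constant is rounded up to a power of 2, so that iterated doubling becomes growth of
    order [s] in the ratio of the radii. *)
Lemma doubling_exp : exists s : nat, forall x (r : R), Omega x -> 0 < r ->
  W x (2 * r) <= 2 ^+ s * W x r.
Proof.
have [L HL] := dw_doubling hw.
exists (Num.truncn `|L|).+1 => x r Ox r0; apply: le_trans (HL x r Ox r0) _.
apply: ler_wpM2r; first exact: wball_ge0.
apply: le_trans (ler_norm _) _; apply: le_trans (ltW (truncnS_gt _)) _.
by rewrite -natrX ler_nat ltnW// ltn_expl.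
Qed.

Lemma doubling_iter s : (forall x (r : R), Omega x -> 0 < r ->
  W x (2 * r) <= 2 ^+ s * W x r) ->
  forall j x (r : R), Omega x -> 0 < r -> W x (2 ^+ j * r) <= (2 ^+ j) ^+ s * W x r.
Proof.
move=> H; elim=> [|j IH] x r Ox r0; first by rewrite expr0 expr1n !mul1r.
rewrite exprS -mulrA; apply: le_trans (H _ _ Ox _) _.
  by rewrite mulr_gt0// exprn_gt0.
by rewrite exprMn -mulrA ler_wpM2l ?exprn_ge0// IH.
Qed.

(** Suppose y lies at a large distance t from [x0]. The ball of radius 2t about y contains a ball
    about [x0] of mass above 1/2, so two doublings give the ball of radius t/2 about y mass above
    [c]. It is disjoint from the ball of radius t/2 about [x0], of mass above 1 - [c], and the total
    mass is 1. *)
Lemma domain_bounded : exists2 D : R, 0 < D &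
  forall x y, Omega x -> Omega y -> dist x y < D.
Proof.
have [s Hs] := doubling_exp.
have [x0 Ox0] := domain_nonempty.
have [r1 [r10 Hr1]] : exists r : R, 0 < r /\ 2^-1 < W x0 r.
  by apply: wball_exhaust => //; lra.
pose c : R := (2 ^+ s * 2 ^+ s * 2)^-1.
have c0 : 0 < c by rewrite invr_gt0 !mulr_gt0// exprn_gt0.
have [r2 [r20 Hr2]] : exists r : R, 0 < r /\ 1 - c < W x0 r.
  by apply: wball_exhaust => //; lra.
have far y : Omega y -> dist x0 y < r1 + 2 * r2.
  move=> Oy; rewrite ltNge; apply/negP => far.
  set t := dist x0 y in far.
  have t0 : 0 < t by lra.
  have h1 : 2^-1 < W y (2 * (2 * (t / 2))).
    apply: lt_le_trans Hr1 _; apply: wball_shift => //.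
    by rewrite (dist_sym hdist Oy Ox0) -/t; lra.
  have h2 : 2^-1 < 2 ^+ s * (2 ^+ s * W y (t / 2)).
    apply: lt_le_trans h1 _; apply: le_trans (Hs _ _ Oy _) _; first lra.
    by rewrite ler_wpM2l ?exprn_ge0// Hs//; lra.
  have h3 : c < W y (t / 2).
    rewrite -[ltLHS]mul1r ltr_pdivrMr ?mulr_gt0 ?exprn_gt0//.
    have -> : W y (t / 2) * (2 ^+ s * 2 ^+ s * 2) =
              2 * (2 ^+ s * (2 ^+ s * W y (t / 2))) by ring.
    lra.
  have h4 : W x0 r2 <= W x0 (t / 2) by apply: wball_mono => //; lra.
  have h5 : W x0 (t / 2) + W y (t / 2) <= 1.
    rewrite -lee_fin EFinD !wmeas_ballE// -measureU; last 3 first.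
    - exact: measurable_mball.
    - exact: measurable_mball.
    - apply/seteqP; split=> // z [[Oz xz] [_ yz]].
      have := dist_triangle hdist Ox0 Oz Oy.
      rewrite (dist_sym hdist Oz Oy) -/t; lra.
    by apply: probability_le1; apply: measurableU; exact: measurable_mball.
  lra.
exists (2 * (r1 + 2 * r2)) => [|x y Ox Oy]; first lra.
have := dist_triangle hdist Ox Ox0 Oy; have := far _ Ox; have := far _ Oy.
rewrite (dist_sym hdist Ox Ox0); lra.
Qed.

Lemma expr2_ge (t : R) : exists2 j, t <= 2 ^+ j & 1 <= t -> 2 ^+ j <= 2 * t.
Proof.
have [t1|t1] := ltP t 1.
  by exists 0%N => [|h]; rewrite expr0; lra.
have t0 : 0 <= t by lra.
have /andP[ta tb] := truncn_itv t0.
have tr0 : (0 < Num.truncn t)%N by rewrite -(ltr_nat R) ; apply: contraTT tb; rewrite -!leNgt => h; lra.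
exists (trunc_log 2 (Num.truncn t)).+1 => [|_].
  apply: le_trans (ltW tb) _.
  by rewrite -natrX ler_nat trunc_log_ltn.
rewrite exprS ler_wpM2l//; apply: le_trans ta.
by rewrite -natrX ler_nat trunc_logP.
Qed.

(** The diameter is bounded, so a fixed number of doublings of [r] reaches the whole domain, of mass
    1. *)
Lemma wball_lower (r : R) : 0 < r -> exists2 c : R, 0 < c &
  forall x, Omega x -> c <= W x r.
Proof.
move=> r0; have [s Hs] := doubling_exp; have [D D0 HD] := domain_bounded.
have [j Dj _] := expr2_ge (D / r).
have p0 : 0 < (2 ^+ j) ^+ s :> R by rewrite !exprn_gt0.
exists ((2 ^+ j) ^+ s)^-1 => [|x Ox]; first by rewrite invr_gt0.
have := doubling_iter Hs j Ox r0.
have -> : W x (2 ^+ j * r) = 1.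
  have /eqP := wmeas_ballE (2 ^+ j * r) Ox.
  rewrite (_ : mball _ _ _ _ = Omega); first by rewrite nuO => /eqP[].
  apply/seteqP; split=> [y []//|y Oy]; split => //.
  apply: lt_le_trans (HD _ _ Ox Oy) _.
  by rewrite -ler_pdivrMr.
by rewrite -ler_pdivrMl// mulr1.
Qed.

Lemma wball_gt0 x (r : R) : Omega x -> 0 < r -> 0 < W x r.
Proof.
move=> Ox /wball_lower[c c0 /(_ _ Ox)]; exact: lt_le_trans.
Qed.

(** The ball about [y] lies in the ball about [x] of radius r + d(x,y), which is reached from r by
    doublings. Masses at two centres thus differ by a power of the rescaled distance. *)
Lemma wball_ratio : exists s : nat, forall x y (r : R), Omega x -> Omega y ->
  0 < r -> W y r <= 2 ^+ s * (1 + r^-1 * dist x y) ^+ s * W x r.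
Proof.
have [s Hs] := doubling_exp; exists s => x y r Ox Oy r0.
have [j j1 j2] := expr2_ge (1 + r^-1 * dist x y).
have d0 := dist_ge0 hdist Ox Oy.
have q0 : 0 <= r^-1 * dist x y by rewrite mulr_ge0// invr_ge0 ltW.
apply: (@le_trans _ _ (W x (2 ^+ j * r))).
  apply: wball_shift => //.
  have := ler_wpM2r (ltW r0) j1; rewrite mulrDl mul1r mulrAC mulVf ?gt_eqF//.
  lra.
apply: le_trans (doubling_iter Hs j Ox r0) _.
apply: ler_wpM2r; first exact: wball_ge0.
by rewrite -exprMn lerXn2r ?nnegrE ?mulr_ge0 ?exprn_ge0 ?addr_ge0// j2// lerDl.
Qed.

(** The support of [nu] is all of [Omega]. For p = +oo this turns almost everywhere information
    about continuous functions into pointwise information. *)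
Lemma nbhs_wball x (A : set 'rV[R]_d) : Omega x -> nbhs x A ->
  measurable (A : set (borelV R d)) -> (0 < nu (A `&` Omega))%E.
Proof.
move=> Ox /(nbhs_mball hdist Ox)[r r0 rA] mA.
apply: (@lt_le_trans _ _ (nu (mball Omega dist x r))).
  by rewrite -wmeas_ballE// lte_fin wball_gt0.
apply: le_measure; rewrite ?inE; first exact: measurable_mball.
  exact: measurableI.
by move=> y [Oy xy]; split => //; exact: rA.
Qed.

End DoublingGeometry.

(** * Moments of localized kernels *)

Section Localization.
Context {R : realType} {d : nat}.
Variables (Omega : set 'rV[R]_d) (dist : 'rV[R]_d -> 'rV[R]_d -> R).
Variable m : {measure set (borelV R d) -> \bar R}.
Variable w : 'rV[R]_d -> R.
Variable nu : probability (borelV R d) R.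
Hypothesis mOmega : measurable (Omega : set (borelV R d)).
Hypothesis hdist : metric_on Omega dist.
Hypothesis hw : doubling_weight Omega dist m w.
Hypothesis nuw : weighted m Omega w nu.
Hypothesis nuO : nu Omega = 1%E.
Hypothesis h3 : assertion3 Omega dist m w.

Local Notation W x r := (wmeas m w (mball Omega dist x r)).

(** The common shape of Assertion 1, with [N n] = 1, and Assertion 5, with [N n] = n^r. *)
Definition localized (K : nat -> 'rV[R]_d -> 'rV[R]_d -> R) (N : nat -> R) :=
  forall kappa : R, 0 < kappa -> exists c : R, forall n x y, (0 < n)%N ->
    Omega x -> Omega y ->
    `|K n x y| <= c * N n * local_bound Omega dist m w kappa n x y.

(** Of the [s.+1] extra powers of decay, [s] pay for replacing the mass about [x] by the mass about
    [y], and one pays for the factor 1 + n d(x,y). *)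
Lemma local_bound_le s : (forall x y (r : R), Omega x -> Omega y ->
    0 < r -> W y r <= 2 ^+ s * (1 + r^-1 * dist x y) ^+ s * W x r) ->
  forall (k : R) n x y, (0 < n)%N -> Omega x -> Omega y ->
  local_bound Omega dist m w (k + s.+1%:R) n x y * (1 + n%:R * dist x y) <=
  2 ^+ s * (W y n%:R^-1 * (1 + n%:R * dist x y) `^ k)^-1.
Proof.
move=> Hs k n x y n0 Ox Oy.
have r0 : 0 < (n%:R^-1 : R) by rewrite invr_gt0 ltr0n.
have := Hs x y _ Ox Oy r0; rewrite invrK.
have d0 := dist_ge0 hdist Ox Oy.
have t1 : 1 <= 1 + n%:R * dist x y by rewrite lerDl mulr_ge0.
rewrite /local_bound; set t := 1 + n%:R * dist x y in t1 *.
have Wx0 := wball_gt0 mOmega hdist hw nuw nuO Ox r0.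
have Wy0 := wball_gt0 mOmega hdist hw nuw nuO Oy r0.
set a := W x _ in Wx0 *; set b := W y _ in Wy0 *.
have t0 : 0 < t by apply: lt_le_trans t1.
set B := 2 ^+ s * t ^+ s => ba.
have B1 : 1 <= B by rewrite /B -exprMn exprn_ege1// mulr_ege1// ler1n.
have B0 : 0 < B by apply: lt_le_trans B1.
have BE : B = 2 ^+ s * t ^+ s by [].
clearbody B.
(* Since b <= B a and 1 <= B, the inverse square root of a b is at most sqrt(B) / b, hence at most B
   / b. *)
have sq : (a * b) `^ (- 2^-1) <= B / b.
  have ab0 : 0 < a * b by exact: mulr_gt0.
  rewrite powRN powR12_sqrt ?(ltW ab0)// -[B / b]invf_div.
  rewrite lef_pV2 ?posrE ?sqrtr_gt0 ?divr_gt0//.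
  rewrite -[b / B](ger0_norm (ltW (divr_gt0 Wy0 B0))) -sqrtr_sqr ler_wsqrtr//.
  rewrite expr2 mulf_div ler_pdivrMr ?mulr_gt0//.
  have h1 : b * b <= b * (B * a) by rewrite ler_wpM2l// ltW.
  have X0 : 0 <= b * (B * a) by exact: ltW (mulr_gt0 Wy0 (mulr_gt0 B0 Wx0)).
  have h2 : b * (B * a) <= b * (B * a) * B by rewrite ler_peMr.
  by apply: le_trans h1 _; apply: le_trans h2 _; rewrite le_eqVlt; apply/orP; left; apply/eqP; ring.
have tk : t `^ (- (k + s.+1%:R)) = (t `^ k)^-1 * t ^- s.+1.
  have tn0 : (k + s.+1%:R == 0) ==> (t != 0) by rewrite (gt_eqF t0) implybT.
  by rewrite powRN (powRD tn0) powR_mulrn ?(ltW t0)// invfM.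
rewrite tk.
have -> : 2 ^+ s * (b * t `^ k)^-1 =
    B / b * ((t `^ k)^-1 * t ^- s.+1) * t.
  rewrite BE exprS; field.
  by rewrite !gt_eqF// ?exprn_gt0// powR_gt0.
apply: ler_wpM2r; first exact: ltW.
by apply: ler_wpM2r => //; rewrite mulr_ge0 ?invr_ge0 ?powR_ge0 ?exprn_ge0// ltW.
Qed.

(** One estimate serves twice: the factor 1 + n d(x,y) is at least 1, which gives the row bounds for
    Schur's test, and its second term is the first moment that makes the low-pass kernels an
    approximate identity. *)
Lemma localized_moment K N : (forall n, (0 < n)%N -> 0 < N n) ->
  (forall n x, Omega x ->
    measurable_fun (Omega : set (borelV R d)) (K n x : borelV R d -> R)) ->
  localized K N ->
  exists2 C : R, 0 < C & forall n x, (0 < n)%N -> Omega x ->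
    (\int[nu]_(y in Omega) (`|K n x y| * (1 + n%:R * dist x y))%:E
     <= (C * N n)%:E)%E.
Proof.
move=> N0 mK hK.
have [s Hs] := wball_ratio mOmega hdist hw nuw.
have [k0 Hk] := h3; pose k := `|k0| + 1.
have kp : 0 < k by rewrite /k ltr_wpDl.
have k0k : k0 <= k by rewrite /k (le_trans (ler_norm _))// lerDl.
have [c3 Hc3] := Hk _ kp k0k.
have [c Hc] := hK (k + s.+1%:R) (addr_gt0 kp (ltr0Sn _ _)).
have S0 : 0 < 2 ^+ s :> R by rewrite exprn_gt0.
exists ((`|c| + 1) * 2 ^+ s * (`|c3| + 1)) => [|n x n0 Ox].
  by rewrite !mulr_gt0// ltr_wpDl.
have {}N0 := N0 _ n0; set A := (`|c| + 1) * N n * 2 ^+ s.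
have A0 : 0 < A by rewrite !mulr_gt0// ltr_wpDl.
pose f y := `|K n x y| * (1 + n%:R * dist x y).
have f0 y : Omega y -> 0 <= f y.
  by move=> Oy; rewrite mulr_ge0// addr_ge0// mulr_ge0// (dist_ge0 hdist).
have mf : measurable_fun (Omega : set (borelV R d)) (f : borelV R d -> R).
  apply: measurable_funM; first by apply: measurableT_comp => //; exact: mK.
  apply: measurable_funD => //; apply: measurable_funM => //.
  exact: measurable_dist.
rewrite -/(f _) (@weighted_integral _ (borelV R d) _ m Omega w (dw_ge0 hw) nu nuw f mf).
pose g y := w y / (W y n%:R^-1 * (1 + n%:R * dist x y) `^ k).
have fg y : Omega y -> f y * w y / A <= g y.
  move=> Oy; rewrite ler_pdivrMr//.
  suff h : f y <= A * (W y n%:R^-1 * (1 + n%:R * dist x y) `^ k)^-1.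
    apply: le_trans (ler_wpM2r (dw_ge0 hw Oy) h) _.
    by rewrite le_eqVlt; apply/orP; left; apply/eqP; rewrite /g; ring.
  have h1 := Hc n x y n0 Ox Oy.
  have h2 := local_bound_le Hs k n0 Ox Oy.
  have d1 : 0 <= 1 + n%:R * dist x y.
    by rewrite addr_ge0// mulr_ge0// (dist_ge0 hdist).
  have lb0 : 0 <= local_bound Omega dist m w (k + s.+1%:R) n x y.
    by rewrite mulr_ge0// powR_ge0.
  have h3' : `|K n x y| <= (`|c| + 1) * N n *
      local_bound Omega dist m w (k + s.+1%:R) n x y.
    apply: le_trans h1 _; apply: ler_wpM2r => //; apply: ler_wpM2r; first exact: ltW.
    by apply: le_trans (ler_norm _) _; rewrite lerDl.
  apply: le_trans (ler_wpM2r d1 h3') _.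
  rewrite -[leLHS]mulrA [leRHS](_ : _ = (`|c| + 1) * N n *
    (2 ^+ s * (W y n%:R^-1 * (1 + n%:R * dist x y) `^ k)^-1)); last by rewrite /A; ring.
  by apply: ler_wpM2l => //; rewrite mulr_ge0 ?(ltW N0)// addr_ge0.
have mfwA : measurable_fun (Omega : set (borelV R d))
    (fun y => (f y * w y / A)%:E : \bar R).
  apply/measurable_EFinP; do 2 apply: measurable_funM => //.
  exact: (dw_measurable hw).
have fw0 y : Omega y -> 0 <= f y * w y / A.
  by move=> Oy; rewrite divr_ge0 ?(ltW A0)// mulr_ge0 ?f0// (dw_ge0 hw).
(* The constant is moved out of the integral on the side of [f], which is measurable; [g] is only
   reached through [le_integral_nomeas]. *)
have -> : (\int[m]_(y in Omega) (f y * w y)%:E =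
    A%:E * \int[m]_(y in Omega) (f y * w y / A)%:E)%E.
  rewrite -ge0_integralZl//; last 1 first.
    by rewrite lee_fin ltW.
  by apply: eq_integral => y _; rewrite -EFinM [in RHS]mulrC divfK// gt_eqF.
have -> : (`|c| + 1) * 2 ^+ s * (`|c3| + 1) * N n = A * (`|c3| + 1).
  by rewrite /A; ring.
rewrite [leRHS]EFinM; apply: lee_wpmul2l; first by rewrite lee_fin ltW.
apply: (@le_trans _ _ (\int[m]_(y in Omega) (g y)%:E)%E).
  by apply: le_integral_nomeas => y Oy; rewrite lee_fin; [exact: fw0|exact: fg].
apply: le_trans (Hc3 n x n0 Ox) _.
by rewrite lee_fin (le_trans (ler_norm _))// lerDl.
Qed.

End Localization.

(** * Calculus of integrable real functions for a probability measure *)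

Section FiniteIntegral.
Context d (T : measurableType d) (R : realType).
Variables (nu : probability T R) (D : set T).
Hypothesis mD : measurable D.
Implicit Types f g u : T -> R.

Definition L1 f := nu.-integrable D (EFin \o f).
Definition Pint f : R := \int[nu]_(x in D) f x.

Lemma L1_measurable f : L1 f -> measurable_fun D f.
Proof. by move=> /measurable_int/measurable_EFinP. Qed.

Lemma Int_eq f g : (forall x, D x -> f x = g x) -> Pint f = Pint g.
Proof. by move=> fg; apply: eq_Rintegral => x /[!inE]; exact: fg. Qed.

Lemma L1_eq f g : (forall x, D x -> f x = g x) -> L1 f -> L1 g.
Proof.
move=> fg; apply: (eq_integrable mD) => x /[!inE] Dx /=.
by rewrite fg.
Qed.

Lemma L1_lin (c : R) f g : L1 f -> L1 g -> L1 (fun x => c * f x + g x).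
Proof.
move=> If Ig; have := integrableD mD (integrableZl mD c If) Ig.
by apply: (eq_integrable mD) => x _ /=; rewrite -EFinM -EFinD.
Qed.

Lemma L1_Z (c : R) f : L1 f -> L1 (fun x => c * f x).
Proof.
move=> If; have := integrableZl mD c If.
by apply: (eq_integrable mD) => x _ /=; rewrite -EFinM.
Qed.

Lemma L1_D f g : L1 f -> L1 g -> L1 (fun x => f x + g x).
Proof.
move=> If Ig; have := integrableD mD If Ig.
by apply: (eq_integrable mD) => x _ /=; rewrite -EFinD.
Qed.

Lemma L1_B f g : L1 f -> L1 g -> L1 (fun x => f x - g x).
Proof.
move=> If Ig; have := integrableB mD If Ig.
by apply: (eq_integrable mD) => x _ /=; rewrite -EFinB.
Qed.

Lemma Int_Z (c : R) f : L1 f -> Pint (fun x => c * f x) = c * Pint f.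
Proof. exact: RintegralZl. Qed.

Lemma Int_D f g : L1 f -> L1 g -> Pint (fun x => f x + g x) = Pint f + Pint g.
Proof. exact: RintegralD. Qed.

Lemma Int_B f g : L1 f -> L1 g -> Pint (fun x => f x - g x) = Pint f - Pint g.
Proof. exact: RintegralB. Qed.

Lemma L1_bounded f (C : R) : measurable_fun D f ->
  (forall x, D x -> `|f x| <= C) -> L1 f.
Proof.
move=> mf fC; apply: (@le_integrable _ _ _ nu D mD _ (EFin \o cst C)).
- exact/measurable_EFinP.
- by move=> x Dx /=; rewrite lee_fin (le_trans (fC _ Dx))// ler_norm.
- apply/integrableP; split; first exact/measurable_EFinP.
  rewrite (eq_integral (cst `|C|%:E)) => [|x _]; last by [].
  rewrite integral_cst// lte_mul_pinfty ?lee_fin//.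
  exact: le_lt_trans (probability_le1 nu mD) (ltry _).
Qed.

Lemma L1_cst (c : R) : L1 (fun=> c).
Proof. by apply: (@L1_bounded _ `|c|). Qed.

Lemma L1_M f u (C : R) : L1 f -> measurable_fun D u ->
  (forall x, D x -> `|u x| <= C) -> L1 (fun x => f x * u x).
Proof.
move=> If mu uC; apply: (@le_integrable _ _ _ nu D mD _ (EFin \o (fun x => C * f x))).
- by apply/measurable_EFinP/measurable_funM => //; exact: L1_measurable.
- move=> x Dx /=; rewrite lee_fin !normrM mulrC ler_wpM2r//.
  by apply: le_trans (ler_norm _); exact: uC.
- exact: L1_Z.
Qed.

Lemma L1_sum (J : Type) (s : seq J) (F : J -> T -> R) :
  (forall j, L1 (F j)) -> L1 (fun x => \sum_(j <- s) F j x).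
Proof.
move=> LF; elim: s => [|j s IH].
  by apply: L1_eq (L1_cst 0) => x _; rewrite big_nil.
by apply: L1_eq (L1_D (LF j) IH) => x _; rewrite big_cons.
Qed.

Lemma Int_sum (J : Type) (s : seq J) (F : J -> T -> R) :
  (forall j, L1 (F j)) ->
  Pint (fun x => \sum_(j <- s) F j x) = \sum_(j <- s) Pint (F j).
Proof.
move=> LF; elim: s => [|j s IH].
  rewrite big_nil; transitivity (Pint (fun x => 0 * cst 0 x)).
    by apply: Int_eq => x _; rewrite big_nil mul0r.
  by rewrite Int_Z ?mul0r//; exact: L1_cst.
rewrite big_cons -IH -Int_D//; last exact: L1_sum.
by apply: Int_eq => x _; rewrite big_cons.
Qed.

Lemma L1_norm f : L1 f -> L1 (fun x => `|f x|).
Proof. exact: integrable_norm. Qed.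

Lemma Int_norm f : L1 f -> `|Pint f| <= Pint (fun x => `|f x|).
Proof. exact: le_normr_Rintegral. Qed.

Lemma Int_le f g : L1 f -> L1 g -> (forall x, D x -> f x <= g x) -> Pint f <= Pint g.
Proof. exact: le_Rintegral. Qed.

Lemma Int_ge0 f : (forall x, D x -> 0 <= f x) -> 0 <= Pint f.
Proof. exact: Rintegral_ge0. Qed.

Lemma Int_EFin f : L1 f -> (\int[nu]_(x in D) (f x)%:E)%E = (Pint f)%:E.
Proof. by move=> Lf; rewrite fineK//; exact: integrable_fin_num. Qed.

End FiniteIntegral.

(** * Reproducing kernels and projections *)

Section KernelAlgebra.
Context {R : realType} {d : nat}.
Variables (Omega : set 'rV[R]_d) (dist : 'rV[R]_d -> 'rV[R]_d -> R).
Variable m : {measure set (borelV R d) -> \bar R}.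
Variable w : 'rV[R]_d -> R.
Variable P : nat -> 'rV[R]_d -> 'rV[R]_d -> R.
Variable nu : probability (borelV R d) R.
Hypothesis mOmega : measurable (Omega : set (borelV R d)).
Hypothesis hdist : metric_on Omega dist.
Hypothesis hw : doubling_weight Omega dist m w.
Hypothesis nuw : weighted m Omega w nu.
Hypothesis nuO : nu Omega = 1%E.
Hypothesis hP : forall n, reproducing_kernel Omega m w P n.
Hypothesis h1 : assertion1 Omega dist m w P.

Local Notation L1 := (@L1 _ (borelV R d) R nu Omega).
Local Notation Int := (@Pint _ (borelV R d) R nu Omega).
Local Notation measurableO f :=
  (measurable_fun (Omega : set (borelV R d)) (f : borelV R d -> R)).
Local Notation V := (orthopolys Omega m w).
Local Notation proj := (Defs.proj Omega m w P).

Lemma polys_within_continuous n f : polys Omega n f -> {within Omega, continuous f}.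
Proof.
move=> /polys_continuous[g gc fg].
apply: (@subspace_eq_continuous _ Omega _ g) => [x /[!inE] Ox|].
  by rewrite /from_subspace fg.
exact: continuous_subspaceT.
Qed.

Lemma polys_measurable n f : polys Omega n f -> measurableO f.
Proof. by move=> /polys_within_continuous; exact: within_continuous_measurable. Qed.

Lemma polys_L1 n f : polys Omega n f -> L1 f.
Proof.
move=> fP; have mf := polys_measurable fP.
have [_ H] := @weighted_integrable _ (borelV R d) _ m Omega w
  (dw_measurable hw) (dw_ge0 hw) nu nuw f mf.
exact: H (dw_moments hw fP).
Qed.

Lemma winnerE n k f g : polys Omega n f -> polys Omega k g ->
  winner Omega m w f g = Int (fun x => f x * g x).
Proof.
move=> fP gP; have [l fgP] := polysM fP gP.
rewrite /winner -(@weighted_Rintegral _ (borelV R d) _ m Omega w (dw_ge0 hw) nu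
  nuw (fun x => f x * g x))//.
exact: polys_measurable fgP.
Qed.

Lemma orthopolysP n Y : V n Y -> polys Omega n Y.
Proof. by case. Qed.

Lemma orthopolys_lin n (c : R) f g : V n f -> V n g -> V n (fun x => c * f x + g x).
Proof.
move=> [fP fo] [gP go]; split; first exact: polys_lin.
move=> k h kn hP'; have hf := polys_lin c fP gP.
rewrite (winnerE hf hP').
have [l1 fhP] := polysM fP hP'; have [l2 ghP] := polysM gP hP'.
have Lf := polys_L1 fhP; have Lg := polys_L1 ghP.
have := fo _ _ kn hP'; have := go _ _ kn hP'.
rewrite (winnerE fP hP') (winnerE gP hP') => g0 f0.
transitivity (Int (fun x => c * (f x * h x) + g x * h x)).
  by apply: Int_eq => x _; rewrite mulrDl mulrA.
rewrite Int_D//; last exact: L1_Z.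
by rewrite Int_Z// f0 g0 mulr0 addr0.
Qed.

Lemma orthopolys_sum n (J : Type) (s : seq J) (c : J -> R) F :
  (forall j, V n (F j)) -> V n (fun x => \sum_(j <- s) c j * F j x).
Proof.
move=> FV; elim: s => [|j s IH].
  have [y Oy] := domain_nonempty nuO.
  have VP := (hP n Oy).1.
  have := orthopolys_lin (-1) VP VP.
  by congr (V n _); apply/funext => x; rewrite big_nil mulN1r addNr.
have := orthopolys_lin (c j) (FV j) IH.
by congr (V n _); apply/funext => x; rewrite big_cons.
Qed.

Lemma kernel_V n x : Omega x -> V n (P n x).
Proof. by move=> Ox; case: (hP n Ox). Qed.

Lemma kernel_polys n x : Omega x -> polys Omega n (P n x).
Proof. by move=> Ox; exact: orthopolysP (kernel_V n Ox). Qed.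

Lemma reproduce n Y x : V n Y -> Omega x -> Int (fun y => Y y * P n x y) = Y x.
Proof.
move=> VY Ox; rewrite -(winnerE (orthopolysP VY) (kernel_polys n Ox)).
by case: (hP n Ox) => _; exact.
Qed.

Lemma kernel_sym n x y : Omega x -> Omega y -> P n x y = P n y x.
Proof.
move=> Ox Oy; rewrite -(reproduce (kernel_V n Ox) Oy).
rewrite -(reproduce (kernel_V n Oy) Ox).
by apply: Int_eq => z _; rewrite mulrC.
Qed.

Lemma kernel_diag_ge0 n x : Omega x -> 0 <= P n x x.
Proof.
move=> Ox; rewrite -(reproduce (kernel_V n Ox) Ox).
by apply: Int_ge0 => y _; rewrite -expr2 sqr_ge0.
Qed.

(** By the reproducing property P(x,y) is the integral of a product a b while the diagonal values
    are the integrals of a^2 and b^2; |a b| <= a^2 + b^2 is enough. *)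
Lemma kernel_le_diag n x y : Omega x -> Omega y ->
  `|P n x y| <= P n x x + P n y y.
Proof.
move=> Ox Oy.
have prodL a b : Omega a -> Omega b -> L1 (fun z => P n a z * P n b z).
  move=> Oa Ob.
  by have [l /polys_L1] := polysM (kernel_polys n Oa) (kernel_polys n Ob).
rewrite -(reproduce (kernel_V n Ox) Oy) -(reproduce (kernel_V n Ox) Ox).
rewrite -(reproduce (kernel_V n Oy) Oy) -Int_D; [|exact: mOmega|exact: prodL..].
apply: le_trans (Int_norm mOmega (prodL _ _ Ox Oy)) _.
apply: Int_le => //; first exact/L1_norm/prodL.
  by apply: L1_D => //; exact: prodL.
move=> z _; rewrite ler_norml; set a := P n x z; set b := P n y z.
have e1 := sqr_ge0 (a - b); have e2 := sqr_ge0 (a + b).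
by rewrite -!expr2; apply/andP; split; nra.
Qed.

Lemma Lker_diag n x : Omega x -> P n x x <= Lker P (@cutoff R) n.+1 x x.
Proof.
move=> Ox; have nn : (n < (2 * n.+1).+1)%N.
  by rewrite ltnS (leq_trans (leqnSn n))// leq_pmull.
rewrite /Lker big_mkord (bigD1 (Ordinal nn))//= cutoff1; last first.
  by rewrite ler_pdivrMr// mul1r ler_nat.
rewrite mul1r lerDl sumr_ge0// => i _.
by rewrite mulr_ge0 ?cutoff_ge0// kernel_diag_ge0.
Qed.

(** On the diagonal P is one term of a nonnegative sum [Lker], which Assertion 1 bounds by the
    inverse mass of a ball of fixed radius. The degree [n.+1] in [Lker] avoids the excluded degree
    0. *)
Lemma kernel_bounded n : exists2 C : R, 0 < C &
  forall x y, Omega x -> Omega y -> `|P n x y| <= C.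
Proof.
have [c Hc] := h1 (@admissible_cutoff R) ltr01.
have r0 : 0 < (n.+1%:R^-1 : R) by rewrite invr_gt0.
have [b b0 Hb] := wball_lower mOmega hdist hw nuw nuO r0.
have bound x : Omega x -> P n x x <= `|c| / b.
  move=> Ox; apply: le_trans (Lker_diag n Ox) _.
  apply: le_trans (ler_norm _) _.
  apply: le_trans (Hc n.+1 x x (ltn0Sn n) Ox Ox) _.
  rewrite /local_bound (dist_xx hdist Ox) mulr0 addr0 powR1 mulr1.
  have bW := Hb _ Ox; have W0 := lt_le_trans b0 bW.
  rewrite powRN powR12_sqrt ?mulr_ge0 ?(ltW W0)//.
  rewrite -expr2 sqrtr_sqr ger0_norm ?(ltW W0)//.
  apply: (@le_trans _ _ (`|c| / wmeas m w (mball Omega dist x n.+1%:R^-1))).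
    by apply: ler_wpM2r (ler_norm _); rewrite invr_ge0 ltW.
  by apply: ler_wpM2l => //; rewrite lef_pV2 ?posrE.
exists (2 * (`|c| / b) + 1) => [|x y Ox Oy].
  by rewrite ltr_wpDl// mulr_ge0// divr_ge0// ltW.
apply: le_trans (kernel_le_diag n Ox Oy) _.
by have := bound _ Ox; have := bound _ Oy; lra.
Qed.

Lemma orthopolys_bounded n Y : V n Y -> exists C : R,
  forall x, Omega x -> `|Y x| <= C.
Proof.
move=> VY; have [C C0 HC] := kernel_bounded n.
have LY := polys_L1 (orthopolysP VY).
exists (C * Int (fun y => `|Y y|)) => x Ox.
have mP := polys_measurable (kernel_polys n Ox).
have LYP : L1 (fun y => Y y * P n x y).
  by apply: (L1_M mOmega LY mP) => y Oy; exact: HC.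
rewrite -(reproduce VY Ox) -Int_Z//; last exact: L1_norm.
apply: le_trans (Int_norm mOmega LYP) _.
apply: Int_le => //; [exact: L1_norm|by apply: L1_Z => //; exact: L1_norm|].
by move=> y Oy; rewrite normrM mulrC ler_wpM2r// HC.
Qed.

(* By interpolation at finitely many points; this makes the operators of the
   theory finite rank, hence measurable without any joint measurability. *)
Lemma kernel_split n : exists (J : nat) (u l : 'I_J -> 'rV[R]_d -> R),
  [/\ forall i, V n (u i), forall i, V n (l i) &
    forall x y, Omega x -> Omega y -> P n x y = \sum_i u i x * l i y].
Proof.
have [I [e [_ es]]] := polys_span Omega n.
have [J [x [l [Ox Vl lE]]]] := @interpolation R _ Omega (V n)
  (@orthopolys_lin n) I e (fun f Vf => es f (orthopolysP Vf)).
exists J, (fun i => P n (x i)), l; split => // [i|y z Oy Oz].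
  exact: kernel_V.
rewrite (lE _ (kernel_V n Oy) z Oz); apply: eq_bigr => i _.
by rewrite (kernel_sym n Oy (Ox i)).
Qed.

Lemma projE n f x : measurableO f -> Omega x ->
  proj n f x = Int (fun y => f y * P n x y).
Proof.
move=> mf Ox; rewrite /Defs.proj -(@weighted_Rintegral _ (borelV R d) _ m Omega w
  (dw_ge0 hw) nu nuw (fun y => f y * P n x y))//.
by apply: measurable_funM => //; exact: polys_measurable (kernel_polys n Ox).
Qed.

Lemma L1_MV n f Y : L1 f -> V n Y -> L1 (fun x => f x * Y x).
Proof.
move=> Lf VY; have [C HC] := orthopolys_bounded VY.
exact: (L1_M mOmega Lf (polys_measurable (orthopolysP VY)) HC).
Qed.

(** The second expansion comes from the symmetry of the kernel. Using one expansion for each factor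
    proves self-adjointness of [proj] without Fubini. *)
Lemma proj_split n : exists (J : nat) (u l : 'I_J -> 'rV[R]_d -> R),
  [/\ forall i, V n (u i), forall i, V n (l i) &
    forall f x, L1 f -> Omega x ->
      proj n f x = \sum_i Int (fun y => f y * l i y) * u i x /\
      proj n f x = \sum_i Int (fun y => f y * u i y) * l i x].
Proof.
have [J [u [l [Vu Vl PE]]]] := kernel_split n.
exists J, u, l; split => // f x Lf Ox.
rewrite projE//; last exact: (L1_measurable Lf).
split.
  transitivity (Int (fun y => \sum_i u i x * (f y * l i y))).
    apply: Int_eq => y Oy; rewrite PE// mulr_sumr; apply: eq_bigr => i _; ring.
  rewrite Int_sum//; last by move=> i; apply: L1_Z => //; exact: L1_MV (Vl i).
  apply: eq_bigr => i _.
  by rewrite (Int_Z mOmega _ (L1_MV Lf (Vl i))) mulrC.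
transitivity (Int (fun y => \sum_i l i x * (f y * u i y))).
  apply: Int_eq => y Oy; rewrite kernel_sym// PE// mulr_sumr.
  by apply: eq_bigr => i _; ring.
rewrite Int_sum//; last by move=> i; apply: L1_Z => //; exact: L1_MV (Vu i).
apply: eq_bigr => i _.
  by rewrite (Int_Z mOmega _ (L1_MV Lf (Vu i))) mulrC.
Qed.

Lemma orthopolys_ext n f g : (forall x, Omega x -> f x = g x) -> V n g -> V n f.
Proof.
move=> fg [gP go]; split; first exact: polys_ext fg gP.
move=> k h kn hk; rewrite -(go k h kn hk).
by apply: eq_Rintegral => x /[!inE] Ox; rewrite fg.
Qed.

Lemma proj_V n f : L1 f -> V n (proj n f).
Proof.
move=> Lf; have [J [u [l [Vu Vl pE]]]] := proj_split n.
apply: (@orthopolys_ext _ _ (fun x => \sum_i Int (fun y => f y * l i y) * u i x)).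
  by move=> x Ox; case: (pE f x Lf Ox).
exact: orthopolys_sum.
Qed.

Lemma proj_selfadjoint n f g : L1 f -> L1 g ->
  Int (fun x => proj n f x * g x) = Int (fun x => f x * proj n g x).
Proof.
move=> Lf Lg; have [J [u [l [Vu Vl pE]]]] := proj_split n.
transitivity (\sum_i Int (fun y => f y * l i y) * Int (fun y => g y * u i y)).
  transitivity (Int (fun x => \sum_i Int (fun y => f y * l i y) * (g x * u i x))).
    apply: Int_eq => x Ox; have [-> _] := pE f x Lf Ox.
    by rewrite mulr_suml; apply: eq_bigr => i _; ring.
  rewrite Int_sum//; last by move=> i; apply: L1_Z => //; exact: L1_MV (Vu i).
  by apply: eq_bigr => i _; rewrite (Int_Z mOmega _ (L1_MV Lg (Vu i))).
symmetry.
transitivity (Int (fun x => \sum_i Int (fun y => g y * u i y) * (f x * l i x))).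
  apply: Int_eq => x Ox; have [_ ->] := pE g x Lg Ox.
  by rewrite mulr_sumr; apply: eq_bigr => i _; ring.
rewrite Int_sum//; last by move=> i; apply: L1_Z => //; exact: L1_MV (Vl i).
apply: eq_bigr => i _.
  by rewrite (Int_Z mOmega _ (L1_MV Lf (Vl i))) mulrC.
Qed.

Lemma proj_lin n (c : R) f g x : L1 f -> L1 g -> Omega x ->
  proj n (fun y => c * f y + g y) x = c * proj n f x + proj n g x.
Proof.
move=> Lf Lg Ox; have Lfg := L1_lin mOmega c Lf Lg.
rewrite !projE//; [|exact: (L1_measurable Lg)|exact: (L1_measurable Lf)|exact: (L1_measurable Lfg)].
have LfP := L1_MV Lf (kernel_V n Ox); have LgP := L1_MV Lg (kernel_V n Ox).
rewrite -Int_Z// -Int_D//; last exact: L1_Z.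
by apply: Int_eq => y _; ring.
Qed.

Lemma proj_ext n f g x : (forall y, Omega y -> f y = g y) -> proj n f x = proj n g x.
Proof.
by move=> fg; apply: eq_Rintegral => y /[!inE] Oy; rewrite fg.
Qed.

Lemma proj_id n Y x : V n Y -> Omega x -> proj n Y x = Y x.
Proof.
move=> VY Ox; rewrite projE ?reproduce//.
exact: polys_measurable (orthopolysP VY).
Qed.

Lemma proj_orth n k Y x : V k Y -> k != n -> Omega x -> proj n Y x = 0.
Proof.
move=> VY kn Ox; have YP := orthopolysP VY.
rewrite projE//; last exact: polys_measurable YP.
have PP := kernel_polys n Ox.
move: kn; rewrite neq_ltn => /orP[kn|nk].
  have [_ /(_ _ _ kn YP)] := kernel_V n Ox.
  rewrite (winnerE PP YP) => <-; apply: Int_eq => y _; exact: mulrC.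
by have [_ /(_ _ _ nk PP)] := VY; rewrite (winnerE YP PP).
Qed.

Lemma proj_sum n (s : seq nat) (c : nat -> R) (F : nat -> 'rV[R]_d -> R) x :
  (forall j, L1 (F j)) -> Omega x ->
  proj n (fun y => \sum_(j <- s) c j * F j y) x = \sum_(j <- s) c j * proj n (F j) x.
Proof.
move=> LF Ox; elim: s => [|j s IH].
  have L0 : L1 (cst 0) by exact: L1_cst.
  have H := proj_lin n (-1) L0 L0 Ox; rewrite mulN1r addNr in H.
  rewrite big_nil -[RHS]H.
  by apply: proj_ext => y _; rewrite big_nil mulr0 addr0.
rewrite big_cons -IH -proj_lin//.
  by apply: proj_ext => y _; rewrite big_cons.
by apply: L1_sum => // i; exact: L1_Z.
Qed.

(** Strong induction on the degree: [g] minus its projections of degree below [n] is orthogonal to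
    all lower degrees, so it lies in [V n] and equals its own projection, which is that of [g]. *)
Lemma polys_proj n g x : polys Omega n g -> Omega x ->
  g x = \sum_(0 <= k < n.+1) proj k g x.
Proof.
elim/ltn_ind: n g x => n IH g x gP Ox.
have Lg := polys_L1 gP.
pose u y := \sum_(0 <= k < n) 1 * proj k g y.
have projP k : polys Omega k (proj k g) by exact: orthopolysP (proj_V k Lg).
have Lproj k f : L1 f -> L1 (proj k f).
  by move=> Lf; exact: polys_L1 (orthopolysP (proj_V k Lf)).
have uP : polys Omega n u.
  rewrite /u; under eq_fun do rewrite big_mkord.
  apply: polys_sum => i; apply: polysZ; apply: polysW (projP i).
  exact: ltnW.
have Lu := polys_L1 uP.
pose Y y := (-1) * u y + g y.
have YP : polys Omega n Y by exact: polys_lin.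
have LY := polys_L1 YP.
have projY k y : (k < n)%N -> Omega y -> proj k Y y = 0.
  move=> kn Oy; rewrite proj_lin// /u proj_sum//; last by move=> j; exact: Lproj.
  rewrite big_mkord (bigD1 (Ordinal kn))//= [X in _ * (_ + X) + _]big1 ?addr0; last first.
    by move=> j jk; rewrite (proj_orth (proj_V j Lg) _ Oy) ?mulr0//.
  by rewrite mul1r (proj_id (proj_V k Lg) Oy) mulN1r addNr.
(* A test polynomial [v] of lower degree is expanded by the induction hypothesis, and
   self-adjointness moves each projection onto [Y], where it vanishes. *)
have VY : V n Y.
  split=> // k v kn vP; have Lv := polys_L1 vP.
  rewrite (winnerE YP vP).
  transitivity (Int (fun y => \sum_(0 <= j < k.+1) Y y * proj j v y)).
    apply: Int_eq => y Oy; rewrite {1}(IH k kn v y vP Oy).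
    by rewrite mulr_sumr.
  rewrite Int_sum//; last by move=> j; exact: L1_MV (proj_V j Lv).
  rewrite big_mkord big1// => j _.
  rewrite -proj_selfadjoint//; transitivity (Int (fun y => 0 * v y)).
    apply: Int_eq => y Oy; rewrite projY ?mul0r//.
    exact: leq_trans (ltn_ord j) kn.
  by rewrite (Int_Z mOmega _ Lv) mul0r.
rewrite big_nat_recr//=.
have -> : proj n g x = Y x.
  rewrite -(proj_id VY Ox) proj_lin// /u proj_sum//; last by move=> j; exact: Lproj.
  rewrite big_mkord big1 ?mulr0 ?add0r// => j _.
  by rewrite (proj_orth (proj_V j Lg) _ Ox) ?mulr0// neq_ltn ltn_ord.
have <- : u x = \sum_(0 <= k < n) proj k g x.
  by apply: eq_bigr => k _; rewrite mul1r.
by rewrite /Y mulN1r addrA subrr add0r.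
Qed.

Lemma polys_bounded n g : polys Omega n g -> exists C : R,
  forall x, Omega x -> `|g x| <= C.
Proof.
move=> gP; have Lg := polys_L1 gP.
have [C HC] := choice (fun k => orthopolys_bounded (proj_V k Lg)).
exists (\sum_(0 <= k < n.+1) C k) => x Ox; rewrite (polys_proj gP Ox).
apply: le_trans (ler_norm_sum _ _ _) _.
by apply: ler_sum => k _; exact: HC.
Qed.

End KernelAlgebra.

Lemma poweR_le (R : realType) (r : R) (x y : \bar R) : 0 <= r -> (0 <= x)%E -> (x <= y)%E ->
  (x `^ r <= y `^ r)%E.
Proof.
move=> r0 x0 xy; apply: gt0_ler_poweR => //.
- by rewrite in_itv/= x0 leey.
- by rewrite in_itv/= (le_trans x0 xy) leey.
Qed.

(** * Weighted spaces and integral operators *)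

Section WeightedLp.
Context {R : realType} {d : nat}.
Variables (Omega : set 'rV[R]_d) (dist : 'rV[R]_d -> 'rV[R]_d -> R).
Variable m : {measure set (borelV R d) -> \bar R}.
Variable w : 'rV[R]_d -> R.
Variable nu : probability (borelV R d) R.
Hypothesis mOmega : measurable (Omega : set (borelV R d)).
Hypothesis hdist : metric_on Omega dist.
Hypothesis hw : doubling_weight Omega dist m w.
Hypothesis nuw : weighted m Omega w nu.
Hypothesis nuO : nu Omega = 1%E.

Local Notation L1 := (@L1 _ (borelV R d) R nu Omega).
Local Notation Int := (@Pint _ (borelV R d) R nu Omega).
Local Notation measurableO f :=
  (measurable_fun (Omega : set (borelV R d)) (f : borelV R d -> R)).
Local Notation measurableA f :=
  (measurable_fun (setT : set (borelV R d)) (f : borelV R d -> R)).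
Local Notation wnorm := (wnorm Omega m w).
Local Notation wspace := (wspace Omega m w).

Lemma measurable_ext0 f : measurableO f -> measurableA (f \_ Omega).
Proof. by move=> mf; exact/(measurable_restrictT _ _).1. Qed.

Lemma integral_prob_cst (c : R) : (\int[nu]_x (cst c%:E x) = c%:E)%E.
Proof.
transitivity (c%:E * 1)%E; last by rewrite mule1.
rewrite integral_cst//; apply: (congr1 (fun z => c%:E * z)%E).
exact: probability_setT.
Qed.

Lemma Int_cst (c : R) : Int (fun=> c) = c.
Proof.
suff H : (\int[nu]_(x in Omega) (cst c%:E x) = c%:E)%E by rewrite /Pint /Rintegral H.
rewrite integral_cst//; transitivity (c%:E * 1)%E; last by rewrite mule1.
exact: (congr1 (fun z => c%:E * z)%E nuO).
Qed.

Definition normw (p : \bar R) (f : 'rV[R]_d -> R) : R := fine (wnorm p f).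

Lemma wnorm_ge0 p f : (0 <= wnorm p f)%E.
Proof.
case: p => [q||]//=; first exact: poweR_ge0.
have [x Ox] := domain_nonempty nuO.
apply: le_trans (ereal_sup_ubound _); last by exists x.
by rewrite lee_fin.
Qed.

Lemma wspaceE p f : wspace p f -> wnorm p f = (normw p f)%:E.
Proof. by case=> _ ?; rewrite fineK// ge0_fin_numE// wnorm_ge0. Qed.

Lemma normw_ge0 p f : 0 <= normw p f.
Proof. exact/fine_ge0/wnorm_ge0. Qed.

Lemma wnorm_ext p f g : (forall x, Omega x -> f x = g x) -> wnorm p f = wnorm p g.
Proof.
move=> fg; case: p => [q||] /=; last by [].
  apply: (congr1 (fun z => z `^ q^-1)%E).
  by apply: eq_integral => x /[!inE] Ox; rewrite fg.
apply: (congr1 (@ereal_sup R)); by apply/seteqP; split=> _ [x Ox <-]; exists x => //; rewrite fg.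
Qed.

Lemma wspace_measurable p f : wspace p f -> measurableO f.
Proof. by case: p => [q||] [cf _]//; exact: within_continuous_measurable. Qed.

Lemma wspace_ext p f g : (forall x, Omega x -> f x = g x) -> wspace p f -> wspace p g.
Proof.
move=> fg [mf nf]; split; last by rewrite -(wnorm_ext p fg).
case: p mf {nf} => [q||] mf.
- by apply: eq_measurable_fun mf => x /[!inE]; exact: fg.
- by apply: (subspace_eq_continuous _ mf) => x /[!inE] Ox; exact: fg.
- by apply: eq_measurable_fun mf => x /[!inE]; exact: fg.
Qed.

Lemma wnorm_fin q f : measurableO f ->
  wnorm q%:E f = ((\int[nu]_x (`|(f \_ Omega) x| `^ q)%:E) `^ q^-1)%E.
Proof.
move=> mf; rewrite /= -(@weighted_integral _ (borelV R d) _ m Omega w (dw_ge0 hw)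
  nu nuw (fun x => `|f x| `^ q)); last first.
  apply: (measurableT_comp (measurable_powR q)).
  exact: measurableT_comp.
rewrite (@weighted_restrict _ (borelV R d) _ Omega mOmega nu nuO); first last.
- by move=> x; rewrite lee_fin powR_ge0.
- apply/measurable_EFinP; apply: (measurableT_comp (measurable_powR q)).
  apply: measurableT_comp => //.
  exact: measurable_ext0.
apply: (congr1 (fun z => z `^ q^-1)%E).
by apply: eq_integral => x xO; rewrite patchE xO.
Qed.

Lemma wnorm_Lnorm q f : measurableO f ->
  wnorm q%:E f = Lnorm nu q%:E (EFin \o (f \_ Omega)).
Proof.
by move=> mf; rewrite wnorm_fin// unlock.
Qed.

Lemma poweR_wnorm q f : 0 < q -> measurableO f ->
  (wnorm q%:E f `^ q = \int[nu]_x (`|(f \_ Omega) x| `^ q)%:E)%E.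
Proof.
move=> q0 mf; rewrite wnorm_fin// -poweRrM mulVf ?gt_eqF// poweRe1//.
by apply: integral_ge0 => x _; rewrite lee_fin powR_ge0.
Qed.

Lemma wnorm_bound q (A : \bar R) f : 0 < q -> (0 <= A)%E -> measurableO f ->
  (\int[nu]_x (`|(f \_ Omega) x| `^ q)%:E <= A `^ q -> wnorm q%:E f <= A)%E.
Proof.
move=> q0 A0 mf H; have qV0 : 0 <= q^-1 by rewrite invr_ge0 ltW.
have I0 : (0 <= \int[nu]_x (`|(f \_ Omega) x| `^ q)%:E)%E.
  by apply: integral_ge0 => x _; rewrite lee_fin powR_ge0.
have := poweR_le qV0 I0 H.
by rewrite -wnorm_fin// -poweRrM mulfV ?gt_eqF// poweRe1.
Qed.

Lemma wspace_lin p (c : R) f g : (1 <= p)%E -> wspace p f -> wspace p g ->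
  wspace p (fun x => c * f x + g x) /\
  normw p (fun x => c * f x + g x) <= `|c| * normw p f + normw p g.
Proof.
move=> p1 Xf Xg.
have mf := wspace_measurable Xf; have mg := wspace_measurable Xg.
pose h x := c * f x + g x.
suff [ch nh] : (if p is +oo%E then {within Omega, continuous h} else measurableO h)
    /\ (wnorm p h <= (`|c| * normw p f + normw p g)%:E)%E.
  have Xh : wspace p h by split => //; apply: le_lt_trans nh (ltry _).
  by split => //; rewrite -lee_fin -wspaceE.
case: p p1 Xf Xg => [q||//] q1 Xf Xg.
- rewrite lee_fin in q1; have q0 : 0 < q by lra.
  have mcf : measurableO (fun x => c * f x) by exact: measurable_funM.
  have mh : measurableO h by exact: measurable_funD.
  split => //.
  have -> : (`|c| * normw q%:E f + normw q%:E g)%:E =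
      (`|c|%:E * wnorm q%:E f + wnorm q%:E g)%E.
    by rewrite (wspaceE Xf) (wspaceE Xg).
  rewrite (wnorm_Lnorm q mh).
  have -> : EFin \o h \_ Omega =
      EFin \o ((fun x => c * f x) \_ Omega \+ g \_ Omega)%R.
    by apply/funext => x /=; rewrite !patchE; case: ifP => // _; rewrite addr0.
  have m1 := measurable_ext0 mcf.
  have m2 := measurable_ext0 mg.
  apply: le_trans (minkowski_EFin nu m1 m2 q1) _.
  rewrite -(wnorm_Lnorm q mcf) -(wnorm_Lnorm q mg); apply: leeD => //.
  apply: wnorm_bound => //; first by rewrite mule_ge0 ?wnorm_ge0.
  rewrite poweRM ?wnorm_ge0// poweR_wnorm// poweR_EFin.
  have mfq : measurable_fun (setT : set (borelV R d))
      (fun x : borelV R d => (`|(f \_ Omega) x| `^ q)%:E : \bar R).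
    apply/measurable_EFinP; apply: (measurableT_comp (measurable_powR q)).
    by apply: measurableT_comp => //; exact: measurable_ext0.
  have fq0 (x : borelV R d) : setT x -> (0 <= (`|(f \_ Omega) x| `^ q)%:E)%E.
    by move=> _; rewrite lee_fin powR_ge0.
  have cq0 : (0 <= (`|c| `^ q)%:E)%E by rewrite lee_fin powR_ge0.
  rewrite -(ge0_integralZl nu measurableT mfq fq0 cq0).
  rewrite le_eqVlt; apply/orP; left; apply/eqP; apply: eq_integral => x _.
  rewrite -EFinM -powRM// -normrM !patchE.
  by case: ifP => // _; rewrite mulr0.
- split.
    have [/subspace_continuousP cf _] := Xf.
    have [/subspace_continuousP cg _] := Xg.
    apply/subspace_continuousP => x Ox.
    exact: cvgD (cvgM (cvg_cst c) (cf x Ox)) (cg x Ox).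
  apply: ge_ereal_sup => _ [x Ox <-]; rewrite lee_fin.
  have ub k : wspace +oo%E k -> `|k x| <= normw +oo%E k.
    by move=> Xk; rewrite -lee_fin -wspaceE//; apply: ereal_sup_ubound; exists x.
  apply: le_trans (ler_normD _ _) _; rewrite normrM lerD ?ub//.
  by apply: ler_wpM2l => //; exact: ub.
Qed.

Lemma wspace_bounded p f (C : R) : (1 <= p)%E -> 0 <= C ->
  {within Omega, continuous f} -> (forall x, Omega x -> `|f x| <= C) ->
  wspace p f /\ normw p f <= C.
Proof.
move=> p1 C0 cf fC; have mf := within_continuous_measurable mOmega cf.
suff nf : (wnorm p f <= C%:E)%E.
  have Xf : wspace p f.
    split; last exact: le_lt_trans nf (ltry _).
    by case: (p).
  by split => //; rewrite -lee_fin -wspaceE.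
case: p p1 => [q||//] q1; last first.
  by apply: ge_ereal_sup => _ [x Ox <-]; rewrite lee_fin fC.
rewrite lee_fin in q1; have q0 : 0 < q by lra.
apply: wnorm_bound => //.
apply: (@le_trans _ _ (\int[nu]_x (cst (C `^ q)%:E x))%E).
  apply: ge0_le_integral => //.
  - apply/measurable_EFinP; apply: (measurableT_comp (measurable_powR q)).
    apply: measurableT_comp => //.
    exact: measurable_ext0.
  - move=> x _; rewrite lee_fin ge0_ler_powR ?nnegrE ?(ltW q0)// patchE.
    by case: ifPn => [/[!inE]/fC//|_]; rewrite normr0.
by rewrite integral_prob_cst.
Qed.

(** As [nu] has mass 1, Jensen with the constant kernel 1 embeds the space in L^1 with constant
    1. *)
Lemma wspace_L1 p f : (1 <= p)%E -> wspace p f ->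
  L1 f /\ Int (fun x => `|f x|) <= normw p f.
Proof.
move=> p1 Xf; have mf := wspace_measurable Xf.
case: p p1 Xf => [q||//] q1 Xf; last first.
  have ub x : Omega x -> `|f x| <= normw +oo%E f.
    by move=> Ox; rewrite -lee_fin -wspaceE//; apply: ereal_sup_ubound; exists x.
  have Lf : L1 f by exact: (@L1_bounded _ (borelV R d) R nu Omega mOmega f _ mf ub).
  split => //.
  by rewrite -[leRHS]Int_cst; apply: Int_le => //; [exact: L1_norm|exact: L1_cst].
rewrite lee_fin in q1; have q0 : 0 < q by lra.
have m0 := measurable_ext0 mf.
have mn0 : measurableA (fun x => `|(f \_ Omega) x|) by exact: measurableT_comp.
have := @integral_powR_le _ (borelV R d) R nu (cst 1)
  (fun x => `|(f \_ Omega) x|) q 1 q1 ltr01 (measurable_cst _) mn0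
  (fun=> ler01) (fun=> normr_ge0 _).
rewrite integral_prob_cst lexx powR1 mul1e => /(_ isT).
under [X in (_ <= X)%E]eq_integral do rewrite mul1r.
under [X in (X `^ _ <= _)%E]eq_integral do rewrite mul1r.
rewrite -poweR_wnorm// => H.
have E : (\int[nu]_x (`|(f \_ Omega) x|)%:E = \int[nu]_(x in Omega) (`|f x|)%:E)%E.
  rewrite (@weighted_restrict _ (borelV R d) _ Omega mOmega nu nuO); first last.
  - by move=> x; rewrite lee_fin.
  - exact/measurable_EFinP.
  by apply: eq_integral => x xO; rewrite patchE xO.
have H' : (\int[nu]_(x in Omega) (`|f x|)%:E <= wnorm q%:E f)%E.
  have qV0 : 0 <= q^-1 by rewrite invr_ge0 ltW.
  rewrite -E; have := poweR_le qV0 (poweR_ge0 _ _) H.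
  have I0 : (0 <= \int[nu]_x (`|(f \_ Omega) x|)%:E)%E.
    by apply: integral_ge0 => x _; rewrite lee_fin.
  rewrite -(poweRrM (wnorm q%:E f) q) -poweRrM mulfV ?gt_eqF//.
  by rewrite (poweRe1 I0) (poweRe1 (wnorm_ge0 _ _)).
have Lf : L1 f.
  apply/integrableP; split; first exact/measurable_EFinP.
  by apply: le_lt_trans H' _; case: Xf.
split => //; rewrite -lee_fin -Int_EFin//; last exact: L1_norm.
by rewrite -wspaceE.
Qed.

End WeightedLp.

Section LpOperators.
Context {R : realType} {d : nat}.
Variables (Omega : set 'rV[R]_d) (dist : 'rV[R]_d -> 'rV[R]_d -> R).
Variable m : {measure set (borelV R d) -> \bar R}.
Variable w : 'rV[R]_d -> R.
Variable nu : probability (borelV R d) R.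
Hypothesis mOmega : measurable (Omega : set (borelV R d)).
Hypothesis hdist : metric_on Omega dist.
Hypothesis hw : doubling_weight Omega dist m w.
Hypothesis nuw : weighted m Omega w nu.
Hypothesis nuO : nu Omega = 1%E.

Local Notation L1 := (@L1 _ (borelV R d) R nu Omega).
Local Notation Int := (@Pint _ (borelV R d) R nu Omega).
Local Notation measurableO f :=
  (measurable_fun (Omega : set (borelV R d)) (f : borelV R d -> R)).
Local Notation measurableA f :=
  (measurable_fun (setT : set (borelV R d)) (f : borelV R d -> R)).
Local Notation wnorm := (wnorm Omega m w).
Local Notation wspace := (wspace Omega m w).
Local Notation normw := (normw Omega m w).

Definition bounded_continuous (f : 'rV[R]_d -> R) :=
  {within Omega, continuous f} /\ exists C : R, forall x, Omega x -> `|f x| <= C.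

Lemma within_continuous_sum (I : Type) (s : seq I) (a : I -> R)
    (F : I -> 'rV[R]_d -> R) : (forall i, {within Omega, continuous (F i)}) ->
  {within Omega, continuous (fun x => \sum_(i <- s) a i * F i x)}.
Proof.
move=> Fc; apply/subspace_continuousP => x Ox; elim: s => [|i s IH].
  by under eq_fun do rewrite big_nil; exact: cvg_cst.
under eq_fun do rewrite big_cons.
have /subspace_continuousP/(_ x Ox) Fx := Fc i.
exact: cvgD (cvgM (cvg_cst (a i)) Fx) IH.
Qed.

Section Kernel.
Variables (J : nat) (u l : 'I_J -> 'rV[R]_d -> R) (K : 'rV[R]_d -> 'rV[R]_d -> R).
Hypothesis uc : forall i, bounded_continuous (u i).
Hypothesis lc : forall i, bounded_continuous (l i).
Hypothesis KE : forall x y, Omega x -> Omega y -> K x y = \sum_i u i x * l i y.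
Hypothesis Ksym : forall x y, Omega x -> Omega y -> K x y = K y x.

Local Notation opK f := (fun x => Int (fun y => f y * K x y)).

Let L1l f i : L1 f -> L1 (fun y => f y * l i y).
Proof.
move=> Lf; have [cl [C HC]] := lc i.
exact: (L1_M mOmega Lf (within_continuous_measurable mOmega cl) HC).
Qed.

Let opKE f x : L1 f -> Omega x ->
  opK f x = \sum_i Int (fun y => f y * l i y) * u i x.
Proof.
move=> Lf Ox; transitivity (Int (fun y => \sum_i u i x * (f y * l i y))).
  apply: Int_eq => y Oy; rewrite KE// mulr_sumr; apply: eq_bigr => i _; ring.
rewrite Int_sum//; last by move=> i; apply: L1_Z => //; exact: L1l.
by apply: eq_bigr => i _; rewrite (Int_Z mOmega _ (L1l i Lf)) mulrC.
Qed.

Lemma kernel_op_wspace p f : (1 <= p)%E -> L1 f -> wspace p (opK f).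
Proof.
move=> p1 Lf.
have [C HC] := choice (fun i => (uc i).2).
pose a i := Int (fun y => f y * l i y).
pose g x := \sum_i a i * u i x.
pose B := \sum_i `|a i| * `|C i|.
have cg : {within Omega, continuous g}.
  by apply: within_continuous_sum => i; case: (uc i).
have B0 : 0 <= B by apply: sumr_ge0 => i _; rewrite mulr_ge0.
have gB x : Omega x -> `|g x| <= B.
  move=> Ox; apply: le_trans (ler_norm_sum _ _ _) _; apply: ler_sum => i _.
  by rewrite normrM ler_wpM2l// (le_trans (HC i x Ox))// ler_norm.
have [Xg _] := wspace_bounded mOmega hw nuw nuO p1 B0 cg gB.
by apply: wspace_ext Xg => x Ox; rewrite opKE.
Qed.

Lemma kernel_section_measurable x : Omega x -> measurableO (K x).
Proof.
move=> Ox; have : measurableO (fun y => \sum_i u i x * l i y).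
  apply: within_continuous_measurable => //.
  by apply: within_continuous_sum => i; case: (lc i).
by apply: eq_measurable_fun => y /[!inE] Oy; rewrite KE.
Qed.

(** For p = +oo the row bound suffices. For finite p it is Schur's test, where the symmetry of [K]
    supplies the column bound. *)
Lemma kernel_op_norm p f (C : R) : (1 <= p)%E -> 0 < C -> wspace p f ->
  (forall x, Omega x -> (\int[nu]_(y in Omega) (`|K x y|)%:E <= C%:E)%E) ->
  normw p (opK f) <= C * normw p f.
Proof.
move=> p1 C0 Xf HK.
have [Lf _] := wspace_L1 mOmega hw nuw nuO p1 Xf.
have XT := kernel_op_wspace p1 Lf.
have mf := wspace_measurable mOmega Xf.
have mT := wspace_measurable mOmega XT.
have LK x : Omega x -> L1 (K x).
  move=> Ox; apply/integrableP; split.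
    by apply/measurable_EFinP; exact: kernel_section_measurable Ox.
  exact: le_lt_trans (HK _ Ox) (ltry _).
rewrite -lee_fin EFinM -(wspaceE nuO XT) -(wspaceE nuO Xf).
case: p p1 Xf XT => [q||//] q1 Xf XT; last first.
  apply: ge_ereal_sup => _ [x Ox <-].
  rewrite (wspaceE nuO Xf) -EFinM lee_fin.
  have ub y : Omega y -> `|f y| <= normw +oo%E f.
    by move=> Oy; rewrite -lee_fin -(wspaceE nuO Xf); apply: ereal_sup_ubound; exists y.
  have LfK : L1 (fun y => f y * K x y).
    have := L1_M mOmega (LK x Ox) mf ub.
    by apply: (L1_eq mOmega) => y _; rewrite mulrC.
  apply: le_trans (Int_norm mOmega LfK) _.
  apply: (@le_trans _ _ (Int (fun y => normw +oo%E f * `|K x y|))).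
    apply: (Int_le mOmega (L1_norm LfK) (L1_Z mOmega _ (L1_norm (LK x Ox)))).
    by move=> y Oy; rewrite normrM ler_wpM2r// ub.
  rewrite (Int_Z mOmega _ (L1_norm (LK x Ox))) mulrC ler_wpM2r//.
    exact: normw_ge0 nuO _ _.
  rewrite -lee_fin -(Int_EFin mOmega (L1_norm (LK x Ox))).
  exact: HK.
rewrite lee_fin in q1; have q0 : 0 < q by lra.
have CA0 : (0 <= C%:E * wnorm q%:E f)%E.
  by apply: mule_ge0; [rewrite lee_fin ltW|exact: wnorm_ge0 nuO _ _].
apply: (wnorm_bound mOmega hw nuw nuO q0 CA0 mT).
have C0' : (0 <= C%:E)%E by rewrite lee_fin ltW.
rewrite (poweRM _ C0' (wnorm_ge0 m w nuO _ _)) (poweR_wnorm mOmega hw nuw nuO q0 mf).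
(* Extending the factors by zero, rather than [K], makes the extended kernel jointly measurable as a
   finite sum of products. *)
pose u0 i := u i \_ Omega; pose l0 i := l i \_ Omega.
pose K0 x y := \sum_i u0 i x * l0 i y.
have K0E x y : Omega x -> Omega y -> K0 x y = K x y.
  move=> Ox Oy; rewrite KE//; apply: eq_bigr => i _.
  by rewrite /u0 /l0 !patchE !mem_set.
have K0out1 x y : ~ Omega x -> K0 x y = 0.
  move=> Ox; rewrite /K0 big1// => i _.
  by rewrite /u0 patchE memNset// mul0r.
have K0out2 x y : ~ Omega y -> K0 x y = 0.
  move=> Ox; rewrite /K0 big1// => i _.
  by rewrite /l0 patchE memNset// mulr0.
have mu0 i : measurableA (u0 i).
  by apply: measurable_ext0 => //; apply: within_continuous_measurable => //; case: (uc i).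
have ml0 i : measurableA (l0 i).
  by apply: measurable_ext0 => //; apply: within_continuous_measurable => //; case: (lc i).
have mK0 : measurable_fun (setT : set (borelV R d * borelV R d)%type)
    (fun z => K0 z.1 z.2).
  apply: measurable_sum => i; apply: measurable_funM.
    exact: (measurableT_comp (mu0 i) measurable_fst).
  exact: (measurableT_comp (ml0 i) measurable_snd).
have mK0x x : measurableA (K0 x).
  by apply: measurable_sum => i; exact: measurable_funM.
have K0sym x y : K0 x y = K0 y x.
  have [Ox|Ox] := pselect (Omega x); last by rewrite K0out1// K0out2.
  have [Oy|Oy] := pselect (Omega y); last by rewrite K0out2// K0out1.
  by rewrite !K0E// Ksym.
have K0C x : (\int[nu]_y (`|K0 x y|)%:E <= C%:E)%E.
  have [Ox|Ox] := pselect (Omega x); last first.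
    under eq_integral do rewrite K0out1// normr0.
    by rewrite integral0 lee_fin ltW.
  rewrite (@weighted_restrict _ (borelV R d) _ Omega mOmega nu nuO); first last.
  - by move=> y; rewrite lee_fin.
  - by apply/measurable_EFinP; exact: measurableT_comp.
  rewrite (eq_integral (fun y : borelV R d => (`|K x y|)%:E)) ?HK// => y /[!inE] Oy.
  by rewrite K0E.
have K0C' y : (\int[nu]_x (`|K0 x y|)%:E <= C%:E)%E.
  by under eq_integral do rewrite K0sym; exact: K0C.
have := @schur_test _ (borelV R d) R nu K0 (f \_ Omega) q C q1 C0 mK0
  (measurable_ext0 mOmega mf) K0C K0C'.
apply: le_trans; apply: le_integral_nomeas => x _.
  by rewrite lee_fin powR_ge0.
rewrite -poweR_EFin.
have I0 : (0 <= \int[nu]_y (`|K0 x y| * `|(f \_ Omega) y|)%:E)%E.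
  by apply: integral_ge0 => y _; rewrite lee_fin mulr_ge0.
apply: poweR_le; [exact: ltW|by rewrite lee_fin|].
rewrite patchE; case: ifPn => [/[!inE] Ox|_]; last by rewrite normr0.
have LfK : L1 (fun y => f y * K x y).
  have : L1 (fun y => \sum_i u i x * (f y * l i y)).
    by apply: L1_sum => // i; apply: L1_Z => //; exact: L1l.
  apply: (L1_eq mOmega) => y Oy; rewrite KE// mulr_sumr; apply: eq_bigr => i _; ring.
apply: (@le_trans _ _ (Int (fun y => `|f y * K x y|))%:E).
  by rewrite lee_fin; exact: Int_norm.
rewrite -(Int_EFin mOmega (L1_norm LfK)).
rewrite (@weighted_restrict _ (borelV R d) _ Omega mOmega nu nuO); first last.
- by move=> y; rewrite lee_fin mulr_ge0.
- apply/measurable_EFinP; apply: measurable_funM; apply: measurableT_comp => //.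
  exact: measurable_ext0.
rewrite le_eqVlt; apply/orP; left; apply/eqP; apply: eq_integral => y yO.
by rewrite normrM K0E ?patchE ?yO 1?mulrC//; rewrite inE in yO.
Qed.

End Kernel.

End LpOperators.

(** * Norm bounds for almost everywhere limits *)

Lemma fatou_ae d (T : measurableType d) (R : realType)
    (mu : {measure set T -> \bar R}) (D : set T) (h : nat -> T -> \bar R)
    (f : T -> \bar R) (c : \bar R) : measurable D ->
  (forall n, measurable_fun D (h n)) -> (forall n x, D x -> (0 <= h n x)%E) ->
  measurable_fun D f -> (forall x, D x -> (0 <= f x)%E) ->
  {ae mu, forall x, D x -> h n x @[n --> \oo] --> f x} ->
  (forall n, (\int[mu]_(x in D) h n x <= c)%E) ->
  (\int[mu]_(x in D) f x <= c)%E.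
Proof.
move=> mD mh h0 mf f0 hf hc.
have ml : measurable_fun D (fun x => limn_einf (h ^~ x)).
  have -> : (fun x => limn_einf (h ^~ x)) =
      (-%E \o (fun x => limn_esup ((fun n => -%E \o h n) ^~ x)))%E.
    apply/funext => x /=; rewrite -limn_einfN; apply: (congr1 limn_einf).
    by apply/funext => n; rewrite /= oppeK.
  apply: (measurableT_comp (@oppe_measurable R setT)).
  apply: measurable_fun_limn_esup => n.
  exact: (measurableT_comp (@oppe_measurable R setT)).
have l0 x : D x -> (0 <= limn_einf (h ^~ x))%E.
  move=> Dx; rewrite limn_einf_lim; apply: lime_ge; first exact: is_cvg_einfs.
  by apply: nearW => n; apply: le_ereal_inf_tmp => _ [k _ <-]; exact: h0.
apply: (@le_trans _ _ (\int[mu]_(x in D) limn_einf (h ^~ x))%E).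
  apply: ae_ge0_le_integral => //; apply: filterS hf => x hx Dx.
  by have [-> _] := cvg_limn_einf_sup (hx Dx).
apply: le_trans (fatou mu mD mh h0) _.
apply: le_trans (limn_einf_sup _) _; rewrite limn_esup_lim.
apply: lime_le; first exact: is_cvg_esups.
by apply: nearW => n; apply: ge_ereal_sup => _ [k _ <-]; exact: hc.
Qed.

Section Limits.
Context {R : realType} {d : nat}.
Variables (Omega : set 'rV[R]_d) (dist : 'rV[R]_d -> 'rV[R]_d -> R).
Variable m : {measure set (borelV R d) -> \bar R}.
Variable w : 'rV[R]_d -> R.
Variable nu : probability (borelV R d) R.
Hypothesis mOmega : measurable (Omega : set (borelV R d)).
Hypothesis hdist : metric_on Omega dist.
Hypothesis hw : doubling_weight Omega dist m w.
Hypothesis nuw : weighted m Omega w nu.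
Hypothesis nuO : nu Omega = 1%E.

Local Notation L1 := (@L1 _ (borelV R d) R nu Omega).
Local Notation measurableA f :=
  (measurable_fun (setT : set (borelV R d)) (f : borelV R d -> R)).
Local Notation wspace := (wspace Omega m w).
Local Notation normw := (normw Omega m w).

(* For finite p this is Fatou's lemma, applied to the tangents of t^p at |f x|
   evaluated at |F j x|, which avoids the continuity of t^p at 0. *)
Lemma normw_limit p f (F : nat -> 'rV[R]_d -> R) (e : R) : (1 <= p)%E ->
  wspace p f -> (forall j, wspace p (F j)) -> (forall j, normw p (F j) <= e) ->
  {ae nu, forall x, Omega x -> F j x @[j --> \oo] --> f x} ->
  normw p f <= e.
Proof.
move=> p1 Xf XF Fe Ff.
have e0 : 0 <= e by apply: le_trans (Fe 0%N); exact: normw_ge0 nuO _ _.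
have mf := wspace_measurable mOmega Xf.
have mF j := wspace_measurable mOmega (XF j).
rewrite -lee_fin -(wspaceE nuO Xf).
case: p p1 Xf XF Fe => [q||//] q1 Xf XF Fe; last first.
  apply: ge_ereal_sup => _ [x Ox <-]; rewrite lee_fin leNgt; apply/negP => fx.
  (* Continuity makes this set relatively open, so it has positive measure if it contains [x]; yet
     convergence fails at each of its points. *)
  pose A := [set y : 'rV[R]_d | Omega y /\ e < `|f y|].
  have [U oU UE] : exists2 U : set 'rV[R]_d, open U & U `&` Omega = A.
    have [/continuousP cf _] := Xf.
    have oe : open [set t : R | e < `|t|].
      apply: (@open_comp R R (fun t => `|t|) [set t | e < t]); last exact: open_gt.
      by move=> t _; exact: norm_continuous.
    have /open_subspaceP[U oU UE] := cf _ oe.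
    exists U => //; rewrite UE; apply/seteqP; split=> y /= []; by [].
  have Ux : nbhs x U.
    apply: open_nbhs_nbhs; split => //.
    by have : A x by []; rewrite -UE => -[].
  have mU : measurable (U : set (borelV R d)) by exact: sub_sigma_algebra.
  have := nbhs_wball mOmega hdist hw nuw nuO Ox Ux mU.
  case: Ff => N [mN N0 subN]; rewrite UE.
  rewrite (@subset_measure0 _ _ _ nu A N) ?ltxx//.
    by rewrite -UE; exact: measurableI.
  move=> y [Oy fy]; apply: subN => /= /(_ Oy) cv.
  have [j _ /(_ j (leqnn j))/=] := @cvgr_gt _ _ _ _ _ _ (cvg_norm cv) _ fy.
  rewrite ltNge; apply/negP; rewrite negbK; apply: le_trans (Fe j).
  by rewrite -lee_fin -(wspaceE nuO (XF j)); apply: ereal_sup_ubound; exists y.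
rewrite lee_fin in q1; have q0 : 0 < q by lra.
have e0E : (0 <= e%:E)%E by rewrite lee_fin.
apply: (wnorm_bound mOmega hw nuw nuO q0 e0E mf).
pose a x := `|(f \_ Omega) x|; pose s j x := `|(F j \_ Omega) x|.
have a0 x : 0 <= a x by exact: normr_ge0.
have s0 j x : 0 <= s j x by exact: normr_ge0.
have ma : measurableA a by apply: measurableT_comp => //; exact: measurable_ext0.
have ms j : measurableA (s j) by apply: measurableT_comp => //; exact: measurable_ext0.
pose t j x := q * a x `^ (q - 1) * s j x - (q - 1) * a x `^ q.
have mt j : measurableA (t j).
  apply: measurable_funB; do 2?[apply: measurable_funM => //].
    exact: (measurableT_comp (measurable_powR (q - 1))).
  exact: (measurableT_comp (measurable_powR q)).
(* The positive part of the tangent, because Fatou's lemma needs nonnegative functions. The limit is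
   unchanged, since the tangent tends to a^q >= 0. *)
pose H j x := (t j x + `|t j x|) / 2.
have mH j : measurableA (H j).
  apply: measurable_funM => //; apply: measurable_funD => //.
  exact: measurableT_comp.
have H0 j x : 0 <= H j x.
  by rewrite divr_ge0// -lerBlDl sub0r -normrN ler_norm.
have Hs j x : H j x <= s j x `^ q.
  have h1 := powR_tangent q1 (a0 x) (s0 j x).
  have ts : t j x <= s j x `^ q by rewrite /t lerBlDr.
  have sq0 := powR_ge0 (s j x) q.
  rewrite ler_pdivrMr//; have [h|h] := leP 0 (t j x).
    by rewrite ger0_norm//; lra.
  by rewrite ltr0_norm// subrr; lra.
have mE (g : 'rV[R]_d -> R) : measurableA g ->
    measurable_fun (setT : set (borelV R d)) (fun x : borelV R d => (g x)%:E : \bar R).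
  by move=> mg; exact/measurable_EFinP.
have mpow (g : 'rV[R]_d -> R) : measurableA g -> measurableA (fun x => g x `^ q).
  by move=> mg; exact: (measurableT_comp (measurable_powR q)).
apply: (@fatou_ae _ (borelV R d) R nu setT (fun j x => (H j x)%:E)) => //.
- by move=> j; exact: mE.
- by move=> j x _; rewrite lee_fin.
- by apply: mE; exact: mpow.
- case: Ff => N [mN N0 subN]; exists N; split => //.
  apply: subset_trans subN; apply: subsetC => x /= Fx _.
  apply: cvg_EFin; first exact: nearW.
  have sa : s j x @[j --> \oo] --> a x.
    apply: cvg_norm; rewrite patchE; case: ifPn => [/[!inE] Ox|Ox].
      apply: cvg_trans (Fx Ox); apply: near_eq_cvg; apply: nearW => j.
      by rewrite patchE mem_set.
    apply: cvg_near_cst; apply: nearW => j.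
    by rewrite patchE (negbTE Ox).
  have ta : t j x @[j --> \oo] --> a x `^ q.
    have -> : a x `^ q = q * a x `^ (q - 1) * a x - (q - 1) * a x `^ q.
      by rewrite -mulrA [X in q * X]mulrC mulr_powRB1//; ring.
    apply: cvgB; last exact: cvg_cst.
    by apply: cvgM => //; exact: cvg_cst.
  have -> : a x `^ q = (a x `^ q + `|a x `^ q|) / 2.
    by rewrite ger0_norm ?powR_ge0//; field.
  apply: cvgM; last exact: cvg_cst.
  by apply: cvgD => //; exact: cvg_norm.
move=> j; apply: (@le_trans _ _ (\int[nu]_x (s j x `^ q)%:E)%E).
  apply: ge0_le_integral => //.
  - by move=> x _; rewrite lee_fin.
  - by apply: mE; exact: mH.
  - by apply: mE; exact: mpow.
  - by move=> x _; rewrite lee_fin.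
rewrite -(poweR_wnorm mOmega hw nuw nuO q0 (mF j)).
apply: poweR_le; [exact: ltW|exact: wnorm_ge0 nuO _ _|].
by rewrite (wspaceE nuO (XF j)) lee_fin.
Qed.

End Limits.

(** * Lipschitz functions separate integrable functions *)

Section TestFunctions.
Context {R : realType} {d : nat}.
Variables (Omega : set 'rV[R]_d) (dist : 'rV[R]_d -> 'rV[R]_d -> R).
Variable nu : probability (borelV R d) R.
Hypothesis mOmega : measurable (Omega : set (borelV R d)).
Hypothesis hdist : metric_on Omega dist.

Local Notation L1 := (@L1 _ (borelV R d) R nu Omega).
Local Notation Int := (@Pint _ (borelV R d) R nu Omega).
Local Notation measurableO f :=
  (measurable_fun (Omega : set (borelV R d)) (f : borelV R d -> R)).
Local Notation measurableA f :=
  (measurable_fun (setT : set (borelV R d)) (f : borelV R d -> R)).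

Definition lipschitz1 (phi : 'rV[R]_d -> R) := (forall x, `|phi x| <= 1) /\
  exists k : R, forall x y, Omega x -> Omega y -> `|phi x - phi y| <= k * dist x y.

Lemma lipschitz1_measurable phi : lipschitz1 phi -> measurableO phi.
Proof.
move=> [_ [k Hk]]; apply: within_continuous_measurable => //.
exact: (lipschitz_within_continuous hdist Hk).
Qed.

(** The functions min(1, n rho), where rho is the distance to the part of [Omega] outside [U]; rho
    is positive on [U] because the metric induces the topology. *)
Lemma open_test_functions (U : set 'rV[R]_d) : open U ->
  exists phi : nat -> 'rV[R]_d -> R, (forall n, lipschitz1 (phi n)) /\
    forall x, Omega x -> phi n x @[n --> \oo] --> (\1_U x : R).
Proof.
(* If [U] covers [Omega], the distance would be an infimum over the empty set; the constant 1 is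
   used instead. *)
move=> oU; have [[y0 [Oy0 Uy0]]|noC] := pselect (exists y, Omega y /\ ~ U y); last first.
  exists (fun _ _ => 1); split=> [n|x Ox].
    split=> [x|]; first by rewrite normr1.
    by exists 0 => x y Ox Oy; rewrite subrr normr0 mul0r.
  rewrite indicE mem_set; first exact: cvg_cst.
  by apply: contrapT => Ux; apply: noC; exists x.
pose S x := [set dist x y | y in [set y | Omega y /\ ~ U y]].
pose rho x := inf (S x).
have S_lb x : Omega x -> lbound (S x) 0.
  by move=> Ox _ [y [Oy _] <-]; exact: (dist_ge0 hdist).
have S_inf x : Omega x -> has_inf (S x).
  move=> Ox; split; first by exists (dist x y0), y0.
  by exists 0; exact: S_lb.
have rho_ge0 x : Omega x -> 0 <= rho x.
  by move=> Ox; apply: lb_le_inf; [case: (S_inf _ Ox)|exact: S_lb].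
have rho_le x y : Omega x -> Omega y -> ~ U y -> rho x <= dist x y.
  move=> Ox Oy Uy; apply: ge_inf; first by case: (S_inf _ Ox).
  by exists y.
have rho_lip x y : Omega x -> Omega y -> rho x <= dist x y + rho y.
  move=> Ox Oy; rewrite -lerBlDl; apply: lb_le_inf; first by case: (S_inf _ Oy).
  move=> _ [z [Oz Uz] <-]; rewrite lerBlDl.
  exact: le_trans (rho_le _ _ Ox Oz Uz) (dist_triangle hdist Ox Oy Oz).
have rho_gt0 x : Omega x -> U x -> 0 < rho x.
  move=> Ox Ux; have nU : nbhs x U by exact: open_nbhs_nbhs.
  have [r r0 rU] := nbhs_mball hdist Ox nU.
  apply: lt_le_trans r0 _; apply: lb_le_inf; first by case: (S_inf _ Ox).
  move=> _ [z [Oz Uz] <-]; rewrite leNgt; apply/negP => /(rU _ Oz) //.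
pose phi n x : R := Order.min 1 (Order.max 0 (n%:R * rho x)).
have phi_le n x : `|phi n x| <= 1.
  by rewrite ger0_norm ?ge_min ?lexx// le_min ler01 le_max lexx.
exists phi; split=> [n|x Ox].
  split=> //; exists n%:R => x y Ox Oy.
  have key a b : Omega a -> Omega b -> phi n a <= n%:R * dist a b + phi n b.
    move=> Oa Ob; have d0 := dist_ge0 hdist Oa Ob.
    have nd : 0 <= n%:R * dist a b by rewrite mulr_ge0.
    have h : n%:R * rho a <= n%:R * dist a b + n%:R * rho b.
      by rewrite -mulrDr ler_wpM2l// rho_lip.
    have hb : 0 <= n%:R * rho b by rewrite mulr_ge0// rho_ge0.
    have ha : 0 <= n%:R * rho a by rewrite mulr_ge0// rho_ge0.
    rewrite /phi !max_r// addr_minr le_min; apply/andP; split.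
      by rewrite ge_min; apply/orP; left; lra.
    by rewrite ge_min h orbT.
  rewrite ler_norml; apply/andP; split; last by rewrite lerBlDr key.
  by rewrite lerBrDl lerBlDr addrC (dist_sym hdist Ox Oy) key.
have [Ux|Ux] := pselect (U x); last first.
  have -> : \1_U x = 0 :> R by rewrite indicE memNset.
  have rx : rho x = 0.
    apply/eqP; rewrite eq_le rho_ge0// andbT -(dist_xx hdist Ox).
    exact: rho_le.
  apply: cvg_near_cst; apply: nearW => n.
  by rewrite /phi rx mulr0 maxxx min_r.
rewrite indicE mem_set//; apply: cvg_near_cst.
have r0 := rho_gt0 _ Ox Ux.
exists (Num.truncn (rho x)^-1).+1 => // n /= hn.
rewrite /phi min_l// le_max; apply/orP; right.
rewrite -ler_pdivrMr// mul1r ltW// (lt_le_trans (truncnS_gt _))// ler_nat.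
exact: hn.
Qed.

Lemma test_open f U : L1 f -> open U -> (forall phi, lipschitz1 phi ->
    Int (fun x => f x * phi x) = 0) ->
  Int (fun x => f x * \1_U x) = 0.
Proof.
move=> Lf oU test; have [phi [Lphi phiU]] := open_test_functions oU.
have mf := L1_measurable Lf.
have mU : measurable (U : set (borelV R d)) by exact: sub_sigma_algebra.
have mphi n : measurableO (phi n) := lipschitz1_measurable (Lphi n).
have := @dominated_convergence _ (borelV R d) R nu Omega mOmega
  (fun n x => (f x * phi n x)%:E) (fun x => (f x * \1_U x)%:E) (fun x => (`|f x|)%:E).
case.
- by move=> n; apply/measurable_EFinP; exact: measurable_funM.
- by apply/measurable_EFinP; apply: measurable_funM.
- apply: aeW => x Ox; apply: cvg_EFin; first exact: nearW.
  by apply: cvgM; [exact: cvg_cst|exact: phiU].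
- exact: L1_norm.
- apply: aeW => x n Ox; rewrite abse_EFin lee_fin normrM ler_piMr//.
  by case: (Lphi n).
move=> _ _ cv.
rewrite /Pint /Rintegral -(cvg_lim _ cv)//.
have -> : (fun n => \int[nu]_(x in Omega) (f x * phi n x)%:E)%E = (fun=> 0%E).
  apply/funext => n; rewrite Int_EFin ?test//.
  by apply: (L1_M mOmega Lf (mphi n)) => x _; case: (Lphi n) => + _; exact.
by rewrite lim_cst.
Qed.

(** The positive and negative parts of [f] are densities of two finite measures. They agree on open
    sets by [test_open], hence on all Borel sets since open sets are stable under intersection, so
    the densities agree almost everywhere. *)
Lemma test_functions_ae0 f : L1 f -> (forall phi, lipschitz1 phi ->
    Int (fun x => f x * phi x) = 0) ->
  {ae nu, forall x, Omega x -> f x = 0}.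
Proof.
move=> Lf test; pose f0 : borelV R d -> R := f \_ Omega.
have mf0 : measurableA f0 by apply: measurable_ext0 => //; exact: L1_measurable Lf.
have If0 : nu.-integrable (setT : set (borelV R d)) (EFin \o f0).
  have /(integrable_mkcond _ mOmega) := Lf.
  by congr (nu.-integrable _ _); apply/funext => x; rewrite /f0 /= restrict_EFin.
have posneg x : f0^\+ x - f0^\- x = f0 x.
  by rewrite -[in RHS](funrposBneg f0).
have pos0 x : 0 <= f0^\+ x by exact: funrpos_ge0.
have neg0 x : 0 <= f0^\- x by exact: funrneg_ge0.
have mpos : measurableA (f0^\+)%R by exact: measurable_funrpos.
have mneg : measurableA (f0^\-)%R by exact: measurable_funrneg.
pose mu1 := density_measure nu pos0 mpos.
pose mu2 := density_measure nu neg0 mneg.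
have Ipos : nu.-integrable (setT : set (borelV R d)) (EFin \o f0^\+).
  exact: integrable_funrpos.
have Ineg : nu.-integrable (setT : set (borelV R d)) (EFin \o f0^\-).
  exact: integrable_funrneg.
have mu12 A : measurable (A : set (borelV R d)) -> mu1 A = mu2 A.
  apply: (@measure_unique _ R (borelV R d) (@open 'rV[R]_d)
    (fun=> setT) _ _ _ _ mu1 mu2).
  - by [].
  - by move=> A1 A2; exact: openI.
  - by move=> _; exact: openT.
  - by rewrite bigcup_const//; exists 0%N.
  - move=> U oU; rewrite /mu1 /mu2 /= /density_measure.
    have mU : measurable (U : set (borelV R d)) by exact: sub_sigma_algebra.
    have I1 := integrableS measurableT mU (@subsetT _ U) Ipos.
    have I2 := integrableS measurableT mU (@subsetT _ U) Ineg.
    rewrite -(fineK (integrable_fin_num mU I1)) -(fineK (integrable_fin_num mU I2)).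
    apply: (congr1 EFin); apply/eqP; rewrite -subr_eq0.
    have /esym := RintegralB mU I1 I2; rewrite /Rintegral /= => ->.
    rewrite -(test_open Lf oU test) /Pint Rintegral_mkcond.
    rewrite -/(Rintegral nu U _) [X in X == _]Rintegral_mkcond.
    apply/eqP; apply: eq_Rintegral => x _; rewrite !patchE indicE.
    rewrite posneg /f0 patchE.
    by case: (x \in U); case: (x \in Omega); rewrite ?mulr1 ?mulr0.
  move=> _; case/integrableP : Ipos => _; apply: le_lt_trans.
  rewrite /mu1 /density_measure le_eqVlt; apply/orP; left; apply/eqP.
  by apply: eq_integral => x _; rewrite /= ger0_norm.
have := @integral_ae_eq _ (borelV R d) R nu setT measurableT (EFin \o f0^\-)
  (EFin \o f0^\+) Ipos (measurable_int _ Ineg) (fun E _ mE => mu12 E mE).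
move=> [N [mN N0 subN]]; exists N; split => //.
apply: subset_trans subN; apply: subsetC => x /= H Ox.
have [pn] := H Logic.I.
by have := posneg x; rewrite /= pn subrr /f0 patchE mem_set.
Qed.

End TestFunctions.

(** * Multiplier operators *)

Section Multipliers.
Context {R : realType} {d : nat}.
Variables (Omega : set 'rV[R]_d) (dist : 'rV[R]_d -> 'rV[R]_d -> R).
Variable m : {measure set (borelV R d) -> \bar R}.
Variable w : 'rV[R]_d -> R.
Variable P : nat -> 'rV[R]_d -> 'rV[R]_d -> R.
Variable nu : probability (borelV R d) R.
Hypothesis mOmega : measurable (Omega : set (borelV R d)).
Hypothesis hdist : metric_on Omega dist.
Hypothesis hw : doubling_weight Omega dist m w.
Hypothesis nuw : weighted m Omega w nu.
Hypothesis nuO : nu Omega = 1%E.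
Hypothesis hP : forall n, reproducing_kernel Omega m w P n.
Hypothesis h1 : assertion1 Omega dist m w P.
Hypothesis h3 : assertion3 Omega dist m w.

Local Notation L1 := (@L1 _ (borelV R d) R nu Omega).
Local Notation Int := (@Pint _ (borelV R d) R nu Omega).
Local Notation measurableO f :=
  (measurable_fun (Omega : set (borelV R d)) (f : borelV R d -> R)).
Local Notation V := (orthopolys Omega m w).
Local Notation proj := (Defs.proj Omega m w P).
Local Notation wspace := (wspace Omega m w).
Local Notation normw := (normw Omega m w).

Definition multop (c : nat -> R) (n : nat) (f : 'rV[R]_d -> R) (x : 'rV[R]_d) : R :=
  \sum_(0 <= k < n) c k * proj k f x.

Definition mkern (c : nat -> R) (n : nat) (x y : 'rV[R]_d) : R :=
  \sum_(0 <= k < n) c k * P k x y.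

Let projV k f : L1 f -> V k (proj k f).
Proof. exact: (proj_V mOmega hdist hw nuw nuO hP h1). Qed.

Let projL k f : L1 f -> L1 (proj k f).
Proof.
move=> Lf; have Vf := projV k Lf.
exact: (polys_L1 mOmega hw nuw (orthopolysP Vf)).
Qed.

Lemma mult_L1 c n f : L1 f -> L1 (multop c n f).
Proof. by move=> Lf; apply: L1_sum => // k; apply: L1_Z => //; exact: projL. Qed.

Lemma mult_lin c n (a : R) f g x : L1 f -> L1 g -> Omega x ->
  multop c n (fun y => a * f y + g y) x = a * multop c n f x + multop c n g x.
Proof.
move=> Lf Lg Ox; rewrite /multop mulr_sumr -big_split/=; apply: eq_bigr => k _.
by rewrite (proj_lin mOmega hdist hw nuw nuO hP h1)//; ring.
Qed.

Lemma mult_widen c n k f x : (n <= k)%N -> (forall i, (n <= i)%N -> c i = 0) ->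
  multop c k f x = multop c n f x.
Proof.
move=> nk c0; rewrite /multop (big_cat_nat _ nk)//= [X in _ + X]big_nat_cond [X in _ + X]big1 ?addr0//.
by move=> i /andP[/andP[ni _] _]; rewrite c0// mul0r.
Qed.

Lemma mkern_polys c n x : Omega x -> polys Omega n (mkern c n x).
Proof.
move=> Ox; rewrite /mkern; under eq_fun do rewrite big_mkord.
apply: polys_sum => i; apply: polysZ; apply: polysW (kernel_polys hP i Ox).
exact: ltnW.
Qed.

Lemma mkern_sym c n x y : Omega x -> Omega y -> mkern c n x y = mkern c n y x.
Proof.
move=> Ox Oy; apply: eq_bigr => k _.
by rewrite (kernel_sym mOmega hw nuw hP).
Qed.

Lemma mult_kernel c n f x : L1 f -> Omega x ->
  multop c n f x = Int (fun y => f y * mkern c n x y).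
Proof.
move=> Lf Ox.
transitivity (Int (fun y => \sum_(0 <= k < n) c k * (f y * P k x y))).
  have LfP k : L1 (fun y => f y * P k x y).
    by apply: (L1_MV mOmega hdist hw nuw nuO hP h1 Lf); exact: (kernel_V hP k Ox).
  rewrite Int_sum//; last by move=> k; apply: L1_Z.
  apply: eq_bigr => k _; rewrite (Int_Z mOmega _ (LfP k)).
  by rewrite (projE mOmega hw nuw hP)//; exact: L1_measurable Lf.
by apply: Int_eq => y _; rewrite /mkern mulr_sumr; apply: eq_bigr => k _; ring.
Qed.

Lemma mkern_split c n : exists (J : nat) (u l : 'I_J -> 'rV[R]_d -> R),
  [/\ forall i, bounded_continuous Omega (u i),
      forall i, bounded_continuous Omega (l i) &
      forall x y, Omega x -> Omega y -> mkern c n x y = \sum_i u i x * l i y].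
Proof.
have bc g : polys Omega n g -> bounded_continuous Omega g.
  move=> gP; split; first exact: polys_within_continuous gP.
  exact: (polys_bounded mOmega hdist hw nuw nuO hP h1 gP).
have [I [e [_ es]]] := polys_span Omega n.
have [J [x [l [Ox Vl lE]]]] := @interpolation R _ Omega (polys Omega n)
  (@polys_lin R d Omega n) I e es.
exists J, (fun i => mkern c n (x i)), l; split => [i|i|y z Oy Oz].
- by apply: bc; exact: mkern_polys.
- exact: bc.
rewrite (lE _ (mkern_polys c n Oy) z Oz); apply: eq_bigr => i _.
by rewrite (mkern_sym c n Oy (Ox i)).
Qed.

Lemma mult_wspace c n p f : (1 <= p)%E -> wspace p f -> wspace p (multop c n f).
Proof.
move=> p1 Xf; have [Lf _] := wspace_L1 mOmega hw nuw nuO p1 Xf.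
have [J [u [l [uc lc KE]]]] := mkern_split c n.
have := kernel_op_wspace mOmega hw nuw nuO uc lc KE p1 Lf.
by apply: wspace_ext => x Ox; rewrite mult_kernel.
Qed.

Lemma mult_norm c n p f (C : R) : (1 <= p)%E -> 0 < C -> wspace p f ->
  (forall x, Omega x -> (\int[nu]_(y in Omega) (`|mkern c n x y|)%:E <= C%:E)%E) ->
  normw p (multop c n f) <= C * normw p f.
Proof.
move=> p1 C0 Xf HC; have [Lf _] := wspace_L1 mOmega hw nuw nuO p1 Xf.
have [J [u [l [uc lc KE]]]] := mkern_split c n.
have := kernel_op_norm mOmega hw nuw nuO uc lc KE (mkern_sym c n) p1 C0 Xf HC.
apply: le_trans; rewrite le_eqVlt; apply/orP; left; apply/eqP.
by apply: (congr1 fine); apply: wnorm_ext => x Ox; rewrite mult_kernel.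
Qed.

Lemma mkern_measurable c n x : Omega x -> measurableO (mkern c n x).
Proof. by move=> Ox; exact: (polys_measurable mOmega (mkern_polys c n Ox)). Qed.

Lemma proj_mult c n j f x : L1 f -> Omega x ->
  proj j (multop c n f) x = if (j < n)%N then c j * proj j f x else 0.
Proof.
move=> Lf Ox; rewrite /multop (proj_sum mOmega hdist hw nuw nuO hP h1)//; last first.
  by move=> k; exact: projL.
rewrite big_mkord; case: ifPn => jn.
  rewrite (bigD1 (Ordinal jn))//= big1 ?addr0.
    by rewrite (proj_id mOmega hw nuw hP (projV j Lf) Ox).
  move=> k kj; rewrite (proj_orth mOmega hw nuw hP (projV k Lf) _ Ox) ?mulr0//.
rewrite big1// => k _.
rewrite (proj_orth mOmega hw nuw hP (projV k Lf) _ Ox) ?mulr0//.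
by rewrite neq_ltn (leq_trans (ltn_ord k))// leqNgt.
Qed.

Lemma mult_comp c c' n f x : L1 f -> Omega x ->
  multop c n (multop c' n f) x = multop (fun k => c k * c' k) n f x.
Proof.
move=> Lf Ox; rewrite /multop big_nat_cond [RHS]big_nat_cond.
apply: eq_bigr => k /andP[/andP[_ kn] _].
by rewrite -/(multop c' n f) proj_mult// kn mulrA.
Qed.

Lemma mult_polys c n N f : L1 f -> (forall k, (N < k)%N -> c k = 0) ->
  polys Omega N (multop c n f).
Proof.
move=> Lf c0; rewrite /multop; apply: polys_sum => k.
have [kN|kN] := leqP k N.
  by apply: polysZ; exact: polysW kN (orthopolysP (projV k Lf)).
by apply: polys_ext (polys_cst _ N 0) => x _; rewrite c0// mul0r.
Qed.

Lemma proj_polys0 N k g x : polys Omega N g -> (N < k)%N -> Omega x ->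
  proj k g x = 0.
Proof.
move=> gP Nk Ox; have Lg := polys_L1 mOmega hw nuw gP.
have gE y : Omega y -> g y = \sum_(0 <= j < N.+1) 1 * proj j g y.
  move=> Oy; rewrite (polys_proj mOmega hdist hw nuw nuO hP h1 gP Oy).
  by apply: eq_bigr => j _; rewrite mul1r.
rewrite (proj_ext m w P k x gE) (proj_sum mOmega hdist hw nuw nuO hP h1)//; last first.
  by move=> j; exact: projL.
rewrite big_mkord big1// => j _.
rewrite (proj_orth mOmega hw nuw hP (projV j Lg) _ Ox) ?mulr0//.
by rewrite neq_ltn (leq_trans (ltn_ord j)).
Qed.

Lemma mult_polys_id c n N g x : polys Omega N g -> (N < n)%N ->
  (forall k, (k <= N)%N -> c k = 1) -> Omega x -> multop c n g x = g x.
Proof.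
move=> gP Nn c1 Ox.
rewrite (polys_proj mOmega hdist hw nuw nuO hP h1 gP Ox) /multop.
rewrite (big_cat_nat _ Nn)//= [X in _ + X]big_nat_cond [X in _ + X]big1 ?addr0.
  rewrite big_nat_cond [RHS]big_nat_cond; apply: eq_bigr => k /andP[/andP[_ kN] _].
  by rewrite c1// mul1r.
by move=> k /andP[/andP[Nk _] _]; rewrite (proj_polys0 gP)// mulr0.
Qed.

Lemma mult_polys_eq0 c n N g x : polys Omega N g ->
  (forall k, (k <= N)%N -> c k = 0) -> Omega x -> multop c n g x = 0.
Proof.
move=> gP c0 Ox; rewrite /multop big1// => k _.
have [kN|kN] := leqP k N; first by rewrite c0// mul0r.
by rewrite (proj_polys0 gP)// mulr0.
Qed.

Lemma mult_selfadjoint c n f g : L1 f -> L1 g ->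
  Int (fun x => multop c n f x * g x) = Int (fun x => f x * multop c n g x).
Proof.
move=> Lf Lg.
have pg k : L1 (fun x => proj k f x * g x).
  have := L1_MV mOmega hdist hw nuw nuO hP h1 Lg (projV k Lf).
  by apply: (L1_eq mOmega) => x _; rewrite mulrC.
have fp k : L1 (fun x => f x * proj k g x).
  exact: (L1_MV mOmega hdist hw nuw nuO hP h1 Lf (projV k Lg)).
transitivity (Int (fun x => \sum_(0 <= k < n) c k * (proj k f x * g x))).
  by apply: Int_eq => x _; rewrite /multop mulr_suml; apply: eq_bigr => k _; ring.
transitivity (Int (fun x => \sum_(0 <= k < n) c k * (f x * proj k g x))); last first.
  by apply: Int_eq => x _; rewrite /multop mulr_sumr; apply: eq_bigr => k _; ring.
rewrite !Int_sum//; try by move=> k; apply: L1_Z.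
apply: eq_bigr => k _.
rewrite (Int_Z mOmega _ (pg k)) (Int_Z mOmega _ (fp k)).
by rewrite (proj_selfadjoint mOmega hdist hw nuw nuO hP h1).
Qed.

Lemma mkern_Lker (a : R -> R) n :
  mkern (fun k => a (k%:R / n%:R)) (2 * n).+1 = Lker P a n.
Proof. by []. Qed.

Lemma cutoff_moment : exists2 C : R, 0 < C & forall n x, (0 < n)%N -> Omega x ->
  (\int[nu]_(y in Omega) (`|Lker P (@cutoff R) n x y| * (1 + n%:R * dist x y))%:E
     <= C%:E)%E.
Proof.
have [|n x Ox|k k0|C C0 HC] := @localized_moment R d Omega dist m w nu mOmega hdist
  hw nuw nuO h3 (Lker P (@cutoff R)) (fun=> 1).
- by [].
- by rewrite -mkern_Lker; exact: mkern_measurable.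
- have [c Hc] := h1 (@admissible_cutoff R) k0.
  by exists c => n x y n0 Ox Oy; rewrite mulr1; exact: Hc.
by exists C => // n x n0 Ox; have := HC n x n0 Ox; rewrite mulr1.
Qed.

(** Constants are reproduced, so the error is the integral of K(x,y) (phi(y) - phi(x)), which the
    Lipschitz constant times the first moment of the kernel bounds by a multiple of 1/n. *)
Lemma approx_identity phi : lipschitz1 Omega dist phi ->
  exists C : R, forall n x, (0 < n)%N -> Omega x ->
    `|multop (fun k => cutoff (k%:R / n%:R)) (2 * n).+1 phi x - phi x| <= C / n%:R.
Proof.
move=> Lphi; have [phi1 [k Hk]] := Lphi; have [C C0 HC] := cutoff_moment.
have mphi := lipschitz1_measurable mOmega hdist Lphi.
have Lp : L1 phi by exact: (@L1_bounded _ (borelV R d) R nu Omega mOmega phi 1 mphi).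
exists (`|k| * C) => n x n0 Ox.
set c := fun _ => _; set N := (2 * n).+1.
have nR : 0 < n%:R :> R by rewrite ltr0n.
have onep : polys Omega 0 (fun=> 1) by exact: polys_cst.
have one : multop c N (fun=> 1) x = 1.
  rewrite (mult_polys_id onep)// => j; rewrite leqn0 => /eqP ->.
  by rewrite /c mul0r cutoff1// ler01.
have L1one : L1 (fun=> 1) by exact: L1_cst.
have LK : L1 (mkern c N x).
  exact: (polys_L1 mOmega hw nuw (mkern_polys c N Ox)).
have mK := L1_measurable LK.
have phixE : phi x = phi x * multop c N (fun=> 1) x by rewrite one mulr1.
rewrite mult_kernel// [X in `|_ - X|]phixE mult_kernel//.
have LpK : L1 (fun y => phi y * mkern c N x y).
  have := L1_M mOmega LK mphi (fun y _ => phi1 y).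
  by apply: (L1_eq mOmega) => y _; rewrite mulrC.
have -> : Int (fun y => 1 * mkern c N x y) = Int (mkern c N x).
  by apply: Int_eq => y _; rewrite mul1r.
rewrite -(Int_Z mOmega (phi x) LK) -Int_B//; last exact: L1_Z.
have LD : L1 (fun y => phi y * mkern c N x y - phi x * mkern c N x y).
  by apply: L1_B => //; exact: L1_Z.
apply: le_trans (Int_norm mOmega LD) _.
rewrite -lee_fin -(Int_EFin mOmega (L1_norm LD)).
apply: (@le_trans _ _ ((`|k| / n%:R)%:E *
  \int[nu]_(y in Omega) (`|mkern c N x y| * (1 + n%:R * dist x y))%:E)%E); last first.
  have := HC n x n0 Ox; rewrite -mkern_Lker -/c -/N => h.
  rewrite (_ : `|k| * C / n%:R = `|k| / n%:R * C); last by rewrite mulrAC.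
  by rewrite [leRHS]EFinM; apply: lee_wpmul2l => //; rewrite lee_fin divr_ge0// ltW.
have mg : measurable_fun (Omega : set (borelV R d))
    (fun y : borelV R d => (`|mkern c N x y| * (1 + n%:R * dist x y))%:E : \bar R).
  apply/measurable_EFinP; apply: measurable_funM; first exact: measurableT_comp.
  apply: measurable_funD => //; apply: measurable_funM => //.
  exact: measurable_dist.
have g0 y : Omega y -> (0 <= (`|mkern c N x y| * (1 + n%:R * dist x y))%:E)%E.
  by move=> Oy; rewrite lee_fin mulr_ge0// addr_ge0// mulr_ge0// (dist_ge0 hdist).
rewrite -(ge0_integralZl nu mOmega mg g0); last by rewrite lee_fin divr_ge0// ltW.
apply: le_integral_nomeas => y Oy; first by rewrite lee_fin.
rewrite -EFinM lee_fin -mulrBl normrM mulrC mulrCA; apply: ler_wpM2l => //.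
rewrite (@le_trans _ _ (`|k| * dist x y))//.
  rewrite distrC; apply: le_trans (Hk _ _ Ox Oy) _.
  by apply: ler_wpM2r (ler_norm _); exact: (dist_ge0 hdist).
rewrite -mulrA; apply: ler_wpM2l => //.
by rewrite mulrDr mulr1 mulrA mulVf ?gt_eqF// mul1r lerDr invr_ge0 ltW.
Qed.

End Multipliers.

(** * Convergence of the low-pass operators *)

(** The sum [S] of the absolute increments is integrable, hence finite almost everywhere. This gives
    both the limit and the integrable majorant |F 0| + S. *)
Lemma L1_telescope dd (T : measurableType dd) (R : realType) (nu : probability T R)
    (D : set T) (F : nat -> T -> R) (A : R) : measurable D ->
  (forall j, L1 nu D (F j)) ->
  (forall n, \sum_(0 <= j < n) Pint nu D (fun x => `|F j.+1 x - F j x|) <= A) ->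
  exists (G : T -> R) (h : T -> \bar R),
  [/\ measurable_fun D G,
      {ae nu, forall x, D x -> F j x @[j --> \oo] --> G x},
      nu.-integrable D h & forall j x, D x -> ((`|F j x|)%:E <= h x)%E].
Proof.
move=> mD LF HA.
pose a j x := (`|F j.+1 x - F j x|)%:E : \bar R.
pose S x := (\sum_(0 <= j <oo) a j x)%E.
have La j : L1 nu D (fun x => `|F j.+1 x - F j x|) by apply/L1_norm/L1_B.
have ma j : measurable_fun D (a j) by exact/measurable_EFinP/(L1_measurable (La j)).
have a0 j x : D x -> (0 <= a j x)%E by move=> _; rewrite lee_fin.
have mS : measurable_fun D S.
  by have := @ge0_emeasurable_sum _ T R D a xpredT (fun k x Dx _ => a0 k x Dx) (fun k _ => ma k).
have S0 x : (0 <= S x)%E by apply: nneseries_ge0 => j _ _; rewrite lee_fin.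
have IS : (\int[nu]_(x in D) S x <= A%:E)%E.
  rewrite /S integral_nneseries//; apply: lime_le.
    by apply: is_cvg_nneseries => j _ _; exact: integral_ge0 (a0 j).
  apply: nearW => n; under eq_bigr do rewrite (Int_EFin mD (La _)).
  by rewrite sumEFin lee_fin.
have ISi : nu.-integrable D S.
  apply/integrableP; split => //; apply: le_lt_trans (ltry A).
  rewrite (_ : (\int[nu]_(x in D) `|S x| = \int[nu]_(x in D) S x)%E)//.
  by apply: eq_integral => x _; rewrite gee0_abs.
have FS j x : D x -> ((`|F j x|)%:E <= (`|F 0%N x|)%:E + S x)%E.
  move=> Dx; have -> : F j x = F 0%N x + \sum_(0 <= i < j) (F i.+1 x - F i x).
    by rewrite telescope_sumr// addrC subrK.
  apply: (@le_trans _ _ (`|F 0%N x| + \sum_(0 <= i < j) `|F i.+1 x - F i x|)%:E).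
    by rewrite lee_fin (le_trans (ler_normD _ _))// lerD2l ler_norm_sum.
  rewrite EFinD leeD2l// -sumEFin.
  by apply: nneseries_lim_ge => i _ _; rewrite lee_fin.
(* An upper limit is defined and measurable everywhere; it equals the limit wherever the series
   converges. *)
exists (fun x => fine (limn_esup (fun j => (F j x)%:E))),
  (fun x => (`|F 0%N x|)%:E + S x)%E; split => //.
- apply: measurableT_comp; first exact: fine_measurable.
  apply: measurable_fun_limn_esup => // j.
  exact/measurable_EFinP/(L1_measurable (LF j)).
- have [N [mN N0 subN]] := integrable_ae mD ISi; exists N; split => //.
  apply: subset_trans subN; apply: subsetC => x /= Hx Dx.
  have {Hx} Sfin := Hx Dx.
  suff cF : cvgn (fun j => F j x).
    have /cvg_limn_einf_sup[_ ->] :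
        (F j x)%:E @[j --> \oo] --> (limn (fun j => F j x))%:E.
      by apply: cvg_EFin cF; exact: nearW.
    exact: cF.
  have : cvgn (series (fun j => F j.+1 x - F j x)).
    apply: normed_cvg; apply: nondecreasing_is_cvgn.
      by apply: (@nondecreasing_series _ _ xpredT) => i _ _ /=.
    exists (fine (S x)) => _ [n _ <-]; rewrite -lee_fin fineK//.
    rewrite /series /= -sumEFin.
    by apply: nneseries_lim_ge => i _ _; rewrite lee_fin.
  move=> cs; rewrite (_ : (fun j => F j x) =
      (fun j => F 0%N x + series (fun j => F j.+1 x - F j x) j)).
    exact: is_cvgD (is_cvg_cst _) cs.
  by apply/funext => j; rewrite /series /= telescope_sumr// addrC subrK.
- by apply: integrableD => //; exact: L1_norm (LF 0%N).
Qed.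

Lemma cvg_shiftl (R : realType) (u : nat -> R) (l : R) (j0 : nat) :
  u j @[j --> \oo] --> l -> u (j0 + j)%N @[j --> \oo] --> l.
Proof. by rewrite -(cvg_shiftn j0 u); under eq_fun do rewrite addnC. Qed.

Section Limit.
Context {R : realType} {d : nat}.
Variables (Omega : set 'rV[R]_d) (dist : 'rV[R]_d -> 'rV[R]_d -> R).
Variable m : {measure set (borelV R d) -> \bar R}.
Variable w : 'rV[R]_d -> R.
Variable P : nat -> 'rV[R]_d -> 'rV[R]_d -> R.
Variable nu : probability (borelV R d) R.
Hypothesis mOmega : measurable (Omega : set (borelV R d)).
Hypothesis hdist : metric_on Omega dist.
Hypothesis hw : doubling_weight Omega dist m w.
Hypothesis nuw : weighted m Omega w nu.
Hypothesis nuO : nu Omega = 1%E.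
Hypothesis hP : forall n, reproducing_kernel Omega m w P n.
Hypothesis h1 : assertion1 Omega dist m w P.
Hypothesis h3 : assertion3 Omega dist m w.

Local Notation L1 := (@L1 _ (borelV R d) R nu Omega).
Local Notation Int := (@Pint _ (borelV R d) R nu Omega).
Local Notation mult := (multop Omega m w P).
Local Notation wspace := (wspace Omega m w).
Local Notation normw := (normw Omega m w).

Lemma normw_ext p f g : (forall x, Omega x -> f x = g x) -> normw p f = normw p g.
Proof. by move=> fg; apply: (congr1 fine); exact: wnorm_ext. Qed.

Lemma wspaceB p f g : (1 <= p)%E -> wspace p f -> wspace p g ->
  wspace p (fun x => f x - g x) /\
  normw p (fun x => f x - g x) <= normw p f + normw p g.
Proof.
move=> p1 Xf Xg; have [H1 H2] := wspace_lin mOmega hw nuw nuO (-1) p1 Xg Xf.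
have E x : Omega x -> -1 * g x + f x = f x - g x by move=> _; ring.
split; first exact: wspace_ext E H1.
by rewrite -(normw_ext p E) (le_trans H2)// normrN1 mul1r addrC.
Qed.

Lemma wspaceD p f g : (1 <= p)%E -> wspace p f -> wspace p g ->
  wspace p (fun x => f x + g x) /\
  normw p (fun x => f x + g x) <= normw p f + normw p g.
Proof.
move=> p1 Xf Xg; have [H1 H2] := wspace_lin mOmega hw nuw nuO 1 p1 Xf Xg.
have E x : Omega x -> 1 * f x + g x = f x + g x by move=> _; ring.
split; first exact: wspace_ext E H1.
by rewrite -(normw_ext p E) (le_trans H2)// normr1 mul1r.
Qed.

Lemma wspaceZ p (c : R) f : (1 <= p)%E -> wspace p f ->
  wspace p (fun x => c * f x) /\ normw p (fun x => c * f x) <= `|c| * normw p f.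
Proof.
move=> p1 Xf.
have [X0 n0] : wspace p (cst 0) /\ normw p (cst 0) <= 0.
  apply: (wspace_bounded mOmega hw nuw nuO p1 (lexx 0)) => [|x _].
    by apply: continuous_subspaceT; exact: cst_continuous.
  by rewrite normr0.
have [H1 H2] := wspace_lin mOmega hw nuw nuO c p1 Xf X0.
have E x : Omega x -> c * f x + cst 0 x = c * f x by move=> _; rewrite addr0.
split; first exact: wspace_ext E H1.
rewrite -(normw_ext p E); apply: le_trans H2 _.
by move: n0; lra.
Qed.

Lemma normw_sum p (s : seq nat) (F : nat -> 'rV[R]_d -> R) : (1 <= p)%E ->
  (forall j, wspace p (F j)) ->
  wspace p (fun x => \sum_(j <- s) F j x) /\
  normw p (fun x => \sum_(j <- s) F j x) <= \sum_(j <- s) normw p (F j).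
Proof.
move=> p1 XF; elim: s => [|j s [IH1 IH2]].
  have E x : Omega x -> 0 * F 0%N x = \sum_(j <- [::]) F j x.
    by rewrite big_nil mul0r.
  have [H1 H2] := wspaceZ 0 p1 (XF 0%N).
  split; first exact: wspace_ext E H1.
  by rewrite -(normw_ext p E) big_nil (le_trans H2)// normr0 mul0r.
have E x : Omega x -> F j x + \sum_(j <- s) F j x = \sum_(i <- j :: s) F i x.
  by rewrite big_cons.
have [H1 H2] := wspaceD p1 (XF j) IH1.
split; first exact: wspace_ext E H1.
by rewrite -(normw_ext p E) big_cons (le_trans H2)// lerD2l.
Qed.

Definition lowcut (j k : nat) : R := cutoff (k%:R / (2 ^ j)%:R).

(** The truncation is that of [Lker], so the kernel of this operator is [Lker P cutoff (2 ^ j)]. *)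
Definition lowpass (j : nat) (f : 'rV[R]_d -> R) := mult (lowcut j) (2 * 2 ^ j).+1 f.

(** Self-adjointness moves the operator from [g], which is merely integrable, to [phi], where
    convergence is uniform. *)
Lemma low_weak_cvg g phi : L1 g -> lipschitz1 Omega dist phi ->
  Int (fun x => lowpass j g x * phi x) @[j --> \oo] --> Int (fun x => g x * phi x).
Proof.
move=> Lg Lphi; have mphi := lipschitz1_measurable mOmega hdist Lphi.
have phi1 := Lphi.1.
have Lp : L1 phi.
  by apply: (@L1_bounded _ (borelV R d) R nu Omega mOmega phi 1 mphi) => x _.
have [C HC] := approx_identity mOmega hdist hw nuw nuO hP h1 h3 Lphi.
have n2 j : (0 < 2 ^ j)%N by rewrite expn_gt0.
have C0 : 0 <= C.
  have [x Ox] := domain_nonempty nuO.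
  by have := HC 1%N x isT Ox; rewrite divr1; exact: le_trans.
have key j : `|Int (fun x => lowpass j g x * phi x) - Int (fun x => g x * phi x)| <=
    C * Int (fun x => `|g x|) / (2 ^ j)%:R.
  rewrite (mult_selfadjoint mOmega hdist hw nuw nuO hP h1)//.
  have Llow : L1 (lowpass j phi).
    exact: (mult_L1 mOmega hdist hw nuw nuO hP h1).
  have Lglow : L1 (fun x => g x * lowpass j phi x).
    have [b Hb] : exists b, forall x, Omega x -> `|lowpass j phi x| <= b.
      exists (1 + C / (2 ^ j)%:R) => x Ox.
      rewrite -[lowpass j phi x](subrK (phi x)) addrC (le_trans (ler_normD _ _))//.
      by rewrite lerD// HC.
    exact: (L1_M mOmega Lg (L1_measurable Llow) Hb).
  have Lgp : L1 (fun x => g x * phi x) by exact: (L1_M mOmega Lg mphi (fun x _ => phi1 x)).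
  rewrite -Int_B//; apply: le_trans (Int_norm mOmega (L1_B mOmega Lglow Lgp)) _.
  rewrite mulrAC -(Int_Z mOmega (C / (2 ^ j)%:R) (L1_norm Lg)).
  apply: (Int_le mOmega); first exact/L1_norm/L1_B.
    by apply: L1_Z => //; exact: L1_norm.
  move=> x Ox; rewrite -mulrBr normrM mulrC ler_wpM2r// HC//.
apply/cvgrPdist_le => e e0; near=> j.
rewrite distrC (le_trans (key j))// ler_pdivrMr ?ltr0n//.
near: j; exists (Num.truncn (C * Int (fun x => `|g x|) / e)).+1 => // j /= hj.
rewrite -ler_pdivrMl// mulrC (le_trans (ltW (truncnS_gt _)))// ler_nat.
exact: leq_trans hj (ltnW (ltn_expl _ _)).
Unshelve. all: by end_near.
Qed.

(* A summable telescoping series has an a.e. limit; testing against Lipschitz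
   functions identifies it with [g]. *)
Lemma low_cvg p g (F := fun j => lowpass j g) (A : R) j0 : (1 <= p)%E -> wspace p g ->
  (forall n, \sum_(0 <= j < n) normw p (fun x => F (j0 + j.+1)%N x - F (j0 + j)%N x) <= A) ->
  {ae nu, forall x, Omega x -> F (j0 + j)%N x @[j --> \oo] --> g x}.
Proof.
move=> p1 Xg HA; have [Lg _] := wspace_L1 mOmega hw nuw nuO p1 Xg.
have XF j : wspace p (F j).
  exact: (mult_wspace mOmega hdist hw nuw nuO hP h1).
have LF j : L1 (F j) by exact: (mult_L1 mOmega hdist hw nuw nuO hP h1).
pose F' j := F (j0 + j)%N.
have HA' n : \sum_(0 <= j < n) Int (fun x => `|F' j.+1 x - F' j x|) <= A.
  apply: le_trans (HA n); apply: ler_sum => j _.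
  by have [] := wspace_L1 mOmega hw nuw nuO p1 (wspaceB p1 (XF (j0 + j.+1)%N) (XF (j0 + j)%N)).1.
have [G [h [mG FG Ih Fh]]] := L1_telescope mOmega (fun j => LF (j0 + j)%N) HA'.
have dom phi : lipschitz1 Omega dist phi -> L1 (fun x => G x * phi x) /\
    Int (fun x => F' j x * phi x) @[j --> \oo] --> Int (fun x => G x * phi x).
  move=> Lphi; have mphi := lipschitz1_measurable mOmega hdist Lphi.
  have := @dominated_convergence _ (borelV R d) R nu Omega mOmega
    (fun n x => (F' n x * phi x)%:E) (fun x => (G x * phi x)%:E) h.
  case=> //.
  - move=> n; apply/measurable_EFinP; apply: measurable_funM => //.
    exact: L1_measurable (LF _).
  - by apply/measurable_EFinP; exact: measurable_funM.
  - have [N [mN N0 subN]] := FG; exists N; split => //.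
    apply: subset_trans subN; apply: subsetC => x /= Hx Ox.
    apply: cvg_EFin; first exact: nearW.
    by apply: cvgM; [exact: Hx|exact: cvg_cst].
  - apply: aeW => x n Ox; apply: le_trans (Fh n x Ox).
    by rewrite abse_EFin lee_fin normrM ler_piMr//; exact: Lphi.1.
  move=> IG _ cv; have LG : L1 (fun x => G x * phi x) by exact: IG.
  split => //; move: cv; rewrite (Int_EFin mOmega LG) => /fine_cvg.
  exact.
(* The constant test function gives the integrability of the limit [G] itself. *)
have one : lipschitz1 Omega dist (fun=> 1).
  split=> [x|]; first by rewrite normr1.
  by exists 0 => x y Ox Oy; rewrite subrr normr0 mul0r.
have LG : L1 G.
  by have [+ _] := dom _ one; apply: (L1_eq mOmega) => x _; rewrite mulr1.
have LGg : L1 (fun x => G x - g x) by exact: L1_B.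
have ae0 : {ae nu, forall x, Omega x -> G x - g x = 0}.
  apply: (test_functions_ae0 mOmega hdist LGg) => phi Lphi.
  have mphi := lipschitz1_measurable mOmega hdist Lphi.
  have [LGp cG] := dom _ Lphi.
  have Lgp : L1 (fun x => g x * phi x).
    by apply: (L1_M mOmega Lg mphi (C := 1)) => x _; exact: Lphi.1.
  have cg : Int (fun x => F' j x * phi x) @[j --> \oo] --> Int (fun x => g x * phi x).
    exact: (cvg_shiftl (u := fun j => Int (fun x => lowpass j g x * phi x)) j0
      (low_weak_cvg Lg Lphi)).
  transitivity (Int (fun x => G x * phi x) - Int (fun x => g x * phi x)).
    by rewrite -Int_B//; apply: Int_eq => x _; rewrite mulrBl.
  by apply/eqP; rewrite subr_eq0; apply/eqP; exact: (cvg_unique _ cG cg).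
apply: negligibleS (negligibleU FG ae0); rewrite -setCI; apply: subsetC => x /= [H1 H2] Ox.
have /eqP := H2 Ox; rewrite subr_eq0 => /eqP <-; exact: H1.
Qed.

(** Each partial sum of the increments has norm at most the full geometric sum, and [normw_limit]
    carries this bound to the almost everywhere limit. *)
Lemma low_limit p g (C rho : R) j0 : (1 <= p)%E -> wspace p g -> 0 <= C ->
  0 < rho < 1 ->
  (forall j, normw p (fun x => lowpass (j0 + j).+1 g x - lowpass (j0 + j) g x) <= C * rho ^+ j) ->
  normw p (fun x => g x - lowpass j0 g x) <= C / (1 - rho).
Proof.
move=> p1 Xg C0 /andP[r0 r1] HC.
have XF j : wspace p (lowpass j g).
  exact: (mult_wspace mOmega hdist hw nuw nuO hP h1).
have HA n : \sum_(0 <= j < n) normw p (fun x => lowpass (j0 + j.+1)%N g x - lowpass (j0 + j)%N g x)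
    <= C / (1 - rho).
  apply: (@le_trans _ _ (series (geometric C rho) n)).
    by apply: ler_sum => j _; rewrite addnS; exact: HC.
  by apply: geometric_le_lim => //; rewrite ger0_norm// ltW.
have cv := low_cvg p1 Xg HA.
apply: (normw_limit mOmega hdist hw nuw nuO
  (F := fun j x => lowpass (j0 + j) g x - lowpass j0 g x) p1).
- exact: (wspaceB p1 Xg (XF j0)).1.
- by move=> j; exact: (wspaceB p1 (XF _) (XF j0)).1.
- move=> j; apply: le_trans (HA j).
  rewrite (normw_ext p (g := fun x => \sum_(0 <= i < j)
    (lowpass (j0 + i.+1) g x - lowpass (j0 + i) g x))).
    apply: (normw_sum _ p1 _).2 => i; exact: (wspaceB p1 (XF _) (XF _)).1.
  by move=> x _; rewrite (telescope_sumr (fun i => lowpass (j0 + i) g x))// addn0.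
have [N [mN N0 subN]] := cv; exists N; split => //.
apply: subset_trans subN; apply: subsetC => x /= Hx Ox.
by apply: cvgB; [exact: Hx|exact: cvg_cst].
Qed.

End Limit.

(** * Norm bounds for multipliers *)

Section MultiplierBounds.
Context {R : realType} {d : nat}.
Variables (Omega : set 'rV[R]_d) (dist : 'rV[R]_d -> 'rV[R]_d -> R).
Variable m : {measure set (borelV R d) -> \bar R}.
Variable w : 'rV[R]_d -> R.
Variable P : nat -> 'rV[R]_d -> 'rV[R]_d -> R.
Variable mu : {poly R}.
Variable nu : probability (borelV R d) R.
Hypothesis mOmega : measurable (Omega : set (borelV R d)).
Hypothesis hdist : metric_on Omega dist.
Hypothesis hw : doubling_weight Omega dist m w.
Hypothesis nuw : weighted m Omega w nu.
Hypothesis nuO : nu Omega = 1%E.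
Hypothesis hP : forall n, reproducing_kernel Omega m w P n.
Hypothesis h1 : assertion1 Omega dist m w P.
Hypothesis h3 : assertion3 Omega dist m w.
Hypothesis h5 : assertion5 Omega dist m w P mu.
Variable p : \bar R.
Hypothesis p1 : (1 <= p)%E.

Local Notation mult := (multop Omega m w P).
Local Notation mkern := (mkern P).
Local Notation wspace := (wspace Omega m w).
Local Notation normw := (normw Omega m w).

(* [c] is a finite multiplier sequence whose operator has norm at most [C] on the
   space under consideration; the truncation order is irrelevant by [opb_at]. *)
Definition opb (c : nat -> R) (C : R) := 0 <= C /\
  exists2 n, (forall k, (n <= k)%N -> c k = 0) &
    forall f, wspace p f -> normw p (mult c n f) <= C * normw p f.

Lemma opb_at c C n f : opb c C -> (forall k, (n <= k)%N -> c k = 0) ->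
  wspace p f -> normw p (mult c n f) <= C * normw p f.
Proof.
move=> [C0 [n' c0 H]] c0' Xf.
rewrite (normw_ext m w p (g := mult c n' f)); first exact: H.
move=> x _; have [nn|nn] := leqP n n'.
  by rewrite (mult_widen _ _ _ _ _ _ nn c0').
by rewrite (mult_widen _ _ _ _ _ _ (ltnW nn) c0).
Qed.

Lemma opb_le c C C' : C <= C' -> opb c C -> opb c C'.
Proof.
move=> CC [C0 [n c0 H]]; split; first exact: le_trans CC.
exists n => // f Xf; apply: le_trans (H f Xf) _.
by apply: ler_wpM2r => //; exact: normw_ge0 nuO _ _.
Qed.

Lemma opb_ext c c' C : c =1 c' -> opb c C -> opb c' C.
Proof. by move=> /funext <-. Qed.

Lemma opb_support c C : opb c C -> exists n, forall k, (n <= k)%N -> c k = 0.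
Proof. by case=> _ [n c0 _]; exists n. Qed.

Let mX c n f : wspace p f -> wspace p (mult c n f).
Proof. exact: (mult_wspace mOmega hdist hw nuw nuO hP h1). Qed.

Let XL f : wspace p f -> L1 (nu : probability (borelV R d) R) Omega f.
Proof. by move=> /(wspace_L1 mOmega hw nuw nuO p1)[]. Qed.

Lemma opb_add c c' C C' : opb c C -> opb c' C' -> opb (fun k => c k + c' k) (C + C').
Proof.
move=> o o'; have [n c0] := opb_support o; have [n' c0'] := opb_support o'.
split; first by apply: addr_ge0; [case: o|case: o'].
exists (maxn n n') => [k|f Xf]; first by rewrite geq_max => /andP[? ?]; rewrite c0// c0'// addr0.
rewrite (normw_ext m w p (g := fun x => mult c (maxn n n') f x + mult c' (maxn n n') f x)).
  have [_ H] := wspaceD mOmega hw nuw nuO p1 (mX c (maxn n n') Xf) (mX c' (maxn n n') Xf).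
  apply: le_trans H _; rewrite mulrDl lerD//.
    by apply: opb_at Xf => // k; rewrite geq_max => /andP[/c0].
  by apply: opb_at Xf => // k; rewrite geq_max => /andP[_ /c0'].
by move=> x _; rewrite /multop -big_split/=; apply: eq_bigr => k _; rewrite mulrDl.
Qed.

Lemma opb_scale (a : R) c C : opb c C -> opb (fun k => a * c k) (`|a| * C).
Proof.
move=> [C0 [n c0 H]]; split; first exact: mulr_ge0.
exists n => [k nk|f Xf]; first by rewrite c0// mulr0.
rewrite (normw_ext m w p (g := fun x => a * mult c n f x)).
  have [_ H'] := wspaceZ mOmega hw nuw nuO a p1 (mX c n Xf).
  by apply: le_trans H' _; rewrite -mulrA ler_wpM2l// H.
by move=> x _; rewrite /multop mulr_sumr; apply: eq_bigr => k _; rewrite mulrA.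
Qed.

Lemma opb_mul c c' C C' : opb c C -> opb c' C' -> opb (fun k => c k * c' k) (C * C').
Proof.
move=> o o'; have [n c0] := opb_support o; have [n' c0'] := opb_support o'.
have [C0 _] := o; have [C0' _] := o'.
split; first exact: mulr_ge0.
exists (maxn n n') => [k|f Xf]; first by rewrite geq_max => /andP[/c0 -> _]; rewrite mul0r.
rewrite (normw_ext m w p (g := mult c (maxn n n') (mult c' (maxn n n') f))).
  apply: (le_trans (opb_at o _ (mX _ _ Xf))) => [k|]; first by rewrite geq_max => /andP[/c0].
  rewrite -mulrA ler_wpM2l//.
  by apply: opb_at Xf => // k; rewrite geq_max => /andP[_ /c0'].
move=> x Ox; rewrite (mult_comp mOmega hdist hw nuw nuO hP h1)//.
exact: XL.
Qed.

Lemma opb_exp c C M : opb c C -> opb (fun k => c k ^+ M.+1) (C ^+ M.+1).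
Proof.
move=> o; elim: M => [|M IH]; first exact: o.
by rewrite exprS; apply: opb_ext (opb_mul o IH) => k; rewrite [RHS]exprS.
Qed.

Lemma opb_schur c n C : 0 < C -> (forall k, (n <= k)%N -> c k = 0) ->
  (forall x, Omega x -> (\int[nu]_(y in Omega) (`|mkern c n x y|)%:E <= C%:E)%E) ->
  opb c C.
Proof.
move=> C0 c0 H; split; first exact: ltW.
exists n => // f Xf; exact: (mult_norm mOmega hdist hw nuw nuO hP h1).
Qed.

Lemma opb_fin c n : (forall k, (n <= k)%N -> c k = 0) -> exists C, opb c C.
Proof.
move=> c0.
have HK k : exists C : R, forall x y, Omega x -> Omega y -> `|P k x y| <= C.
  by have [C _ HC] := kernel_bounded mOmega hdist hw nuw nuO hP h1 k; exists C.
have [B HB] := choice HK.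
pose C := \sum_(0 <= k < n) `|c k| * `|B k|.
have C0 : 0 <= C by apply: sumr_ge0 => k _; exact: mulr_ge0.
exists (C + 1); apply: (opb_schur (n := n)) => //; first by rewrite ltr_wpDl.
move=> x Ox; apply: (@le_trans _ _ (\int[nu]_(y in Omega) (C + 1)%:E)%E).
  apply: le_integral_nomeas => y Oy; rewrite lee_fin//.
  apply: (@le_trans _ _ C); last by rewrite lerDl.
  apply: le_trans (ler_norm_sum _ _ _) _; apply: ler_sum => k _.
  by rewrite normrM ler_wpM2l// (le_trans (HB _ _ _ Ox Oy))// ler_norm.
have H : (\int[nu]_(y in Omega) (cst (C + 1)%:E y) <= (C + 1)%:E)%E.
  rewrite integral_cst//; apply: (@le_trans _ _ ((C + 1)%:E * 1)%E).
    rewrite le_eqVlt; apply/orP; left; apply/eqP.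
    exact: (congr1 (fun z => (C + 1)%:E * z)%E nuO).
  by rewrite mule1.
exact: H.
Qed.

(** The blocks below [j0] enter the constant through the sum of their ratios b_j / v_j. *)
Lemma opb_uniform (c : nat -> nat -> R) (v : nat -> R) (C : R) (j0 : nat) :
  (forall j, 0 < v j) -> (forall j, exists n, forall k, (n <= k)%N -> c j k = 0) ->
  (forall j, (j0 <= j)%N -> opb (c j) (C * v j)) ->
  exists2 C', 0 < C' & forall j, opb (c j) (C' * v j).
Proof.
move=> v0 cfin Hc.
have Hb j : exists b, opb (c j) b by have [n /opb_fin] := cfin j.
have [b Hb'] := choice Hb.
have b0 j : 0 <= b j by case: (Hb' j).
pose S := \sum_(0 <= j < j0) b j / v j.
have S0 : 0 <= S by apply: sumr_ge0 => j _; rewrite divr_ge0// ltW.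
exists (`|C| + S + 1) => [|j]; first by rewrite ltr_wpDl// addr_ge0.
have [jj|jj] := leqP j0 j.
  apply: opb_le (Hc j jj); rewrite ler_wpM2r ?(ltW (v0 j))//.
  by rewrite (le_trans (ler_norm _))// -addrA lerDl addr_ge0.
apply: opb_le (Hb' j); rewrite -ler_pdivrMr//.
apply: (@le_trans _ _ S); last by have := normr_ge0 C; lra.
rewrite /S big_mkord (bigD1 (Ordinal jj))//= lerDl sumr_ge0// => i _.
by rewrite divr_ge0// ltW.
Qed.

Lemma admissible_eq0 (a : R -> R) t : admissible a -> 2 < t -> a t = 0.
Proof.
case=> _ _ [[_ a0]|sub] t2; first exact: a0.
apply/eqP/negP => /negP at0; have := sub t (@subset_closure _ [set t | a t != 0] t at0).
by rewrite /= in_itv/= => /andP[_]; rewrite leNgt t2.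
Qed.

Lemma admissible_support (a : R -> R) n k : admissible a -> (0 < n)%N ->
  ((2 * n).+1 <= k)%N -> a (k%:R / n%:R) = 0.
Proof.
move=> aa n0 nk; apply: admissible_eq0 => //.
by rewrite ltr_pdivlMr ?ltr0n// -natrM ltr_nat.
Qed.

Lemma opb_localized (K : nat -> 'rV[R]_d -> 'rV[R]_d -> R) (N : nat -> R)
    (c : nat -> nat -> R) : (forall n, (0 < n)%N -> 0 < N n) ->
  (forall n, K n = mkern (c n) (2 * n).+1) ->
  localized Omega dist m w K N ->
  exists2 C, 0 < C & forall n, (0 < n)%N ->
    (forall k, ((2 * n).+1 <= k)%N -> c n k = 0) -> opb (c n) (C * N n).
Proof.
move=> N0 KE locK.
have [|C C0 HC] := localized_moment mOmega hdist hw nuw nuO h3 N0 _ locK.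
  by move=> n x Ox; rewrite KE; exact: (mkern_measurable mOmega).
exists C => // n n0 c0; apply: opb_schur c0 _; first by rewrite mulr_gt0// N0.
move=> x Ox; apply: le_trans (HC n x n0 Ox); rewrite KE.
apply: le_integral_nomeas => y Oy; first by rewrite lee_fin.
by rewrite lee_fin ler_peMr// lerDl mulr_ge0// (dist_ge0 hdist).
Qed.

Lemma opb_admissible (a : R -> R) : admissible a ->
  exists2 C, 0 < C & forall n, (0 < n)%N -> opb (fun k => a (k%:R / n%:R)) C.
Proof.
move=> aa; have [|||C C0 HC] := opb_localized (N := fun=> 1)
  (K := Lker P a) (c := fun n k => a (k%:R / n%:R)) => //.
  move=> k k0; have [c Hc] := h1 aa k0; exists c => n x y n0 Ox Oy.
  by rewrite mulr1; exact: Hc.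
exists C => // n n0; have := HC n n0; rewrite mulr1; apply.
by move=> k; exact: admissible_support.
Qed.

Lemma opb_admissible_pow (a : R -> R) (r : R) : admissible a -> 0 < r ->
  exists2 C, 0 < C & forall n, (0 < n)%N ->
    opb (fun k => a (k%:R / n%:R) * mu.[k%:R] `^ (r / 2)) (C * n%:R `^ r).
Proof.
move=> aa r0; have [|||C C0 HC] := opb_localized (N := fun n => n%:R `^ r)
  (K := Lker_pow P mu r a) (c := fun n k => a (k%:R / n%:R) * mu.[k%:R] `^ (r / 2)).
- by move=> n n0; rewrite powR_gt0// ltr0n.
- by [].
- by move=> k k0; have [c Hc] := h5 aa r0 k0; exists c.
exists C => // n n0; apply: HC => // k nk.
by rewrite (admissible_support aa n0 nk) mul0r.
Qed.

(* The a priori finiteness of the norm of a finite-rank operator turns the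
   implicit equation c = a + e c into a bound. *)
Lemma opb_absorb (c a e : nat -> R) A n : opb a A -> opb e 2^-1 ->
  (forall k, (n <= k)%N -> c k = 0) ->
  (forall k, c k = a k + e k * c k) -> opb c (2 * A).
Proof.
move=> oa oe c0 cE; have [A0 _] := oa.
split; first by rewrite mulr_ge0.
have [n1 a0] := opb_support oa; have [n2 e0] := opb_support oe.
pose N := maxn n (maxn n1 n2).
have nN k : (N <= k)%N -> [/\ (n <= k)%N, (n1 <= k)%N & (n2 <= k)%N].
  by rewrite !geq_max => /and3P[].
have c0' k : (N <= k)%N -> c k = 0 by case/nN => /c0.
exists N => // f Xf.
have Xc := mX c N Xf.
have H1 : normw p (mult c N f) <=
    normw p (mult a N f) + normw p (mult e N (mult c N f)).
  rewrite {1}(normw_ext m w p (g := fun x => mult a N f x + mult e N (mult c N f) x)).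
    exact: (wspaceD mOmega hw nuw nuO p1 (mX a N Xf) (mX e N Xc)).2.
  move=> x Ox; rewrite (mult_comp mOmega hdist hw nuw nuO hP h1)//; last exact: XL.
  rewrite /multop -big_split/=; apply: eq_bigr => k _.
  by rewrite {1}cE mulrDl.
have H2 : normw p (mult a N f) <= A * normw p f.
  by apply: opb_at oa _ Xf => k /nN[_ /a0].
have H3 : normw p (mult e N (mult c N f)) <= 2^-1 * normw p (mult c N f).
  by apply: opb_at oe _ Xc => k /nN[_ _ /e0].
lra.
Qed.

End MultiplierBounds.

Lemma dyadicM_invsq (R : realType) (t : R) : 0 < t ->
  dyadic t * invsq t = dyadic t / t ^+ 2.
Proof.
move=> t0; have [h|h] := leP t 2^-1; first by rewrite dyadic0l// !mul0r.
by rewrite invsqE// ltW.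
Qed.

Lemma dyadicM_inv (R : realType) (t : R) : 0 < t ->
  dyadic t * (t * invsq t) = dyadic t / t.
Proof.
by move=> t0; rewrite mulrCA dyadicM_invsq//; field; rewrite gt_eqF.
Qed.

(** * The eigenvalue polynomial and its negative powers *)

Section Eigenvalues.
Context {R : realType} {d : nat}.
Variables (Omega : set 'rV[R]_d).
Variable m : {measure set (borelV R d) -> \bar R}.
Variable w : 'rV[R]_d -> R.
Variable mu : {poly R}.
Variable D : ('rV[R]_d -> R) -> 'rV[R]_d -> R.
Hypothesis hA : eigen_assumption Omega m w mu D.

(** The constant 1 lies in V_0, and an operator without zero order term kills it. *)
Lemma eigenvalue0 : Omega !=set0 -> mu.[0] = 0.
Proof.
move=> [x Ox]; have [D2 _ _ HD] := hA.
have V1 : orthopolys Omega m w 0 (fun=> 1) by split => //; exact: polys_cst.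
have := HD 0%N _ V1 x Ox; rewrite (second_order_derivation_cst _ D2 Ox) mulr1.
by move=> /eqP; rewrite eq_sym oppr_eq0 => /eqP.
Qed.

(** As mu(0) = 0, the quadratic has the factor x. A negative [al] would make mu(k) negative for
    large k, and mu(1) >= 0 gives 1 + ga >= 0. Since mu(1) may be 0, strict positivity starts at k =
    2. *)
Lemma eigenvalue_form : Omega !=set0 -> exists al ga : R,
  [/\ 0 < al, forall x, mu.[x] = al * x * (x + ga) &
      forall k, (1 < k)%N -> 0 < k%:R + ga].
Proof.
move=> O0; have mu0 := eigenvalue0 O0; have [_ s3 mu_ge0 _] := hA.
pose b := mu`_1; pose al := mu`_2.
have muE x : mu.[x] = b * x + al * x ^+ 2.
  rewrite horner_coef s3 !big_ord_recr big_ord0/= add0r expr0 mulr1 expr1.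
  by rewrite -(horner_coef0 mu) mu0 add0r.
have al0 : al != 0.
  have : lead_coef mu != 0 by rewrite lead_coef_eq0 -size_poly_eq0 s3.
  by rewrite lead_coefE s3.
have al_gt0 : 0 < al.
  rewrite lt_neqAle eq_sym al0/= leNgt; apply/negP => alN.
  pose k := (Num.truncn (b / - al)).+1.
  have kp : 0 < k%:R :> R by rewrite ltr0n.
  have : b / - al < k%:R by exact: truncnS_gt.
  rewrite ltr_pdivrMr ?oppr_gt0// => h.
  have := mu_ge0 k; rewrite muE expr2 mulrA -mulrDl pmulr_lge0//.
  by rewrite leNgt => /negP; apply; move: h; lra.
exists al, (b / al); split => //.
  by move=> x; rewrite muE; field.
move=> k k1; have := mu_ge0 1%N; rewrite muE expr1n !mulr1.
have -> : b + al = al * (1 + b / al) by field.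
rewrite pmulr_rge0// => h; have : 1 < k%:R :> R by rewrite ltr1n.
by move: h; set z := b / al; lra.
Qed.

End Eigenvalues.

Section NegativePowers.
Context {R : realType} {d : nat}.
Variables (Omega : set 'rV[R]_d) (dist : 'rV[R]_d -> 'rV[R]_d -> R).
Variable m : {measure set (borelV R d) -> \bar R}.
Variable w : 'rV[R]_d -> R.
Variable P : nat -> 'rV[R]_d -> 'rV[R]_d -> R.
Variable mu : {poly R}.
Variable nu : probability (borelV R d) R.
Hypothesis mOmega : measurable (Omega : set (borelV R d)).
Hypothesis hdist : metric_on Omega dist.
Hypothesis hw : doubling_weight Omega dist m w.
Hypothesis nuw : weighted m Omega w nu.
Hypothesis nuO : nu Omega = 1%E.
Hypothesis hP : forall n, reproducing_kernel Omega m w P n.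
Hypothesis h1 : assertion1 Omega dist m w P.
Hypothesis h3 : assertion3 Omega dist m w.
Hypothesis h5 : assertion5 Omega dist m w P mu.
Variable p : \bar R.
Hypothesis p1 : (1 <= p)%E.
Variables al ga : R.
Hypothesis al0 : 0 < al.
Hypothesis muE : forall x, mu.[x] = al * x * (x + ga).
Hypothesis ga0 : forall k, (1 < k)%N -> 0 < k%:R + ga.

Local Notation opb := (opb Omega m w P p).

Definition dy (j k : nat) : R := dyadic (k%:R / (2 ^ j)%:R).

Let N0 j : 0 < (2 ^ j)%:R :> R.
Proof. by rewrite ltr0n expn_gt0. Qed.

Let NS j : (2 ^ j.+1)%:R = 2 * (2 ^ j)%:R :> R.
Proof. by rewrite expnS natrM. Qed.

Lemma dy_supp j k : dy j k != 0 :> R -> 2^-1 < (k%:R / (2 ^ j)%:R : R) < 2.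
Proof.
rewrite /dy => h; rewrite !ltNge -negb_or.
by apply: contra h => /orP[h|h]; [rewrite dyadic0l|rewrite dyadic0r].
Qed.

Lemma dy_eq0l j k : (k <= 2 ^ j)%N -> dy j.+1 k = 0.
Proof.
move=> kj; apply: dyadic0l; rewrite ler_pdivrMr// NS mulrA mulVf// mul1r.
by rewrite ler_nat.
Qed.

Lemma dy_eq0r j k : (2 ^ j.+1 <= k)%N -> dy j k = 0.
Proof.
by move=> kj; apply: dyadic0r; rewrite ler_pdivlMr// -NS ler_nat.
Qed.

(** Blocks of positive index avoid k = 0 and k = 1, where mu may vanish; hence the shift [j.+1] in
    the estimates below. *)
Lemma dyS_gt1 j k : dy j.+1 k != 0 -> (1 < k)%N.
Proof.
rewrite ltnNge; apply: contra => k1; rewrite dy_eq0l// (leq_trans k1)// expn_gt0//.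
Qed.

Lemma eigenvalue_gt0 k : (1 < k)%N -> 0 < mu.[k%:R].
Proof.
move=> k1; rewrite muE !mulr_gt0// ?ga0// ltr0n.
exact: leq_trans k1.
Qed.

Lemma dy_halve j k : dy j.+1 k = dyadic (k%:R / (2 ^ j)%:R / 2).
Proof. by rewrite /dy NS invfM mulrA (mulrAC _ _ 2^-1). Qed.

(** The symbol 1/mu on a block, rescaled to have size about 1. If mu(1) = 0, the block 0 takes the
    value 0 there, which is harmless. *)
Let Tm (j k : nat) : R := dy j k * (2 ^ j)%:R ^+ 2 / mu.[k%:R].

(* From 1 / (k (k + ga)) = 1 / k^2 - (ga / k) / (k (k + ga)), where 1 / k is
   N^-1 times a sum of three admissible cut-offs on the support of [Tm]. *)
Let TmS_eq j k : let N := (2 ^ j.+1)%:R in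
  let S i := dyadic (k%:R / (2 ^ i)%:R) * (k%:R / (2 ^ i)%:R * invsq (k%:R / (2 ^ i)%:R)) in
  Tm j.+1 k = al^-1 * (dyadic (k%:R / N) * invsq (k%:R / N))
    + - (ga / N) * (2^-1 * S j.+2 + (S j.+1 + 2 * S j)) * Tm j.+1 k.
Proof.
move=> N S.
have [h0|h0] := eqVneq (dy j.+1 k) 0.
  have -> : Tm j.+1 k = 0 by rewrite /Tm h0 !mul0r.
  by move: h0; rewrite /dy -/N => ->; rewrite mul0r !mulr0 addr0.
have k1 := dyS_gt1 h0.
have k0 : 0 < k%:R :> R by rewrite ltr0n (leq_trans _ k1).
have {}NN : 0 < N by exact: N0.
have [t1 t2] := andP (dy_supp h0).
rewrite -/N in t1 t2; set t := k%:R / N in t1 t2 *.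
have t0 : 0 < t by lra.
have kE : k%:R = t * N by rewrite divfK// gt_eqF.
have S2 : S j.+2 = dyadic (t / 2) / (t / 2).
  rewrite /S dyadicM_inv ?divr_gt0// NS -/N.
  by rewrite (_ : k%:R / (2 * N) = t / 2)//; rewrite kE; field; rewrite gt_eqF.
have S1 : S j.+1 = dyadic t / t by rewrite /S -/N -/t dyadicM_inv.
have S0 : S j = dyadic (2 * t) / (2 * t).
  rewrite /S dyadicM_inv ?divr_gt0//.
  rewrite (_ : k%:R / (2 ^ j)%:R = 2 * t)//; rewrite /t /N NS; field.
  by rewrite gt_eqF.
have SS : 2^-1 * S j.+2 + (S j.+1 + 2 * S j) = t^-1.
  have := @dyadic_sum3 R t; rewrite !ltW// => /(_ isT) s3.
  transitivity ((dyadic (t / 2) + dyadic t + dyadic (2 * t)) / t); last by rewrite s3 mul1r.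
  by rewrite S2 S1 S0; field; rewrite gt_eqF.
rewrite SS /Tm /dy -/N -/t dyadicM_invsq// muE kE.
have g0 := ga0 k1; rewrite kE in g0.
by field; rewrite !gt_eqF.
Qed.

Lemma Tm_bounded : exists2 C, 0 < C & forall j, opb (Tm j) C.
Proof.
have [C1 C10 H1] := opb_admissible mOmega hdist hw nuw nuO hP h1 h3 p1 (@admissible_dyadic1 R).
have [C2 C20 H2] := opb_admissible mOmega hdist hw nuw nuO hP h1 h3 p1 (@admissible_dyadic2 R).
have Tfin j : exists n, forall k, (n <= k)%N -> Tm j k = 0.
  by exists (2 ^ j.+1)%N => k /dy_eq0r; rewrite /Tm => ->; rewrite !mul0r.
(* The correction has norm at most (|ga| / N) (1/2 + 1 + 2) C1, which is at most 1/2 once N >= 7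
   |ga| C1; this fixes the first good block. The bound 2 (C2 / al) is the one given by
   absorption. *)
have [|||C C0 HC] := @opb_uniform _ _ _ _ _ _ _ _ mOmega hdist hw nuw nuO hP h1 _ p1
  Tm (fun=> 1) (2 * (al^-1 * C2)) (Num.truncn (7 * `|ga| * C1)).+2 => //.
  case=> // j hj; rewrite mulr1.
  have n2 i : (0 < 2 ^ i)%N by rewrite expn_gt0.
  have [n Tn] := Tfin j.+1.
  pose S i k : R := dyadic (k%:R / (2 ^ i)%:R) * (k%:R / (2 ^ i)%:R * invsq (k%:R / (2 ^ i)%:R)).
  have oS i : opb (S i) C1 by exact: H1.
  have ala : `|al^-1| = al^-1 by rewrite ger0_norm// invr_ge0 ltW.
  have oE : opb (fun k => - (ga / (2 ^ j.+1)%:R) * (2^-1 * S j.+2 k + (S j.+1 k + 2 * S j k))) 2^-1.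
    have := opb_scale mOmega hdist hw nuw nuO hP h1 p1 (- (ga / (2 ^ j.+1)%:R))
      (opb_add mOmega hdist hw nuw nuO hP h1 p1
      (opb_scale mOmega hdist hw nuw nuO hP h1 p1 2^-1 (oS j.+2))
      (opb_add mOmega hdist hw nuw nuO hP h1 p1 (oS j.+1)
        (opb_scale mOmega hdist hw nuw nuO hP h1 p1 2 (oS j)))).
    apply: opb_le; first exact: nuO.
    rewrite normrN normrM normfV (ger0_norm (ltW (N0 _))) mulrAC ler_pdivrMr//.
    rewrite normfV normr_nat.
    have : 7 * `|ga| * C1 <= (2 ^ j.+1)%:R.
      apply: ltW (lt_le_trans (truncnS_gt _) _); rewrite ler_nat.
      by apply: leq_trans (ltnW (ltn_expl _ _)) => //; exact: ltnW.
    set N := (2 ^ _)%:R; set z := `|ga|; lra.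
  have := opb_absorb mOmega hdist hw nuw nuO hP h1 p1
    (opb_scale mOmega hdist hw nuw nuO hP h1 p1 al^-1 (H2 _ (n2 j.+1))) oE Tn (TmS_eq j).
  by rewrite ala.
by exists C => // j; have := HC j; rewrite mulr1.
Qed.

(* Assertion 5 only covers positive powers of [mu], so mu^(-r/2) is written as
   mu^(-M) mu^(M - r/2) with M > r / 2, and mu^(-1) is handled by [Tm]. *)
Lemma negative_power (r : R) : exists2 C, 0 < C &
  forall j, opb (fun k => dy j.+1 k * mu.[k%:R] `^ (- (r / 2)))
    (C * (2 ^ j.+1)%:R `^ (- r)).
Proof.
pose M := Num.truncn r; have rM : r < M.+1%:R by exact: truncnS_gt.
(* Chosen positive and such that mu^(s/2) = mu^(M+1) mu^(-r/2). *)
pose s := 2 * M.+1%:R - r.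
have s0 : 0 < s.
  have : 0 <= M%:R :> R by [].
  by rewrite /s; move: rM; rewrite -natr1; lra.
have [C1 C10 HT] := Tm_bounded.
have [C5 C50 H5] := opb_admissible_pow mOmega hdist hw nuw nuO hP h1 h3 h5 p1
  (@admissible_dyadic R) s0.
(* The weights undo the different rescalings of neighbouring blocks, so by [dyadic_sum3] this equals
   N^2 / mu(k) on the support of the middle block. Powers of [Q] therefore carry no powers of
   [dyadic]. *)
pose Q j k := 4^-1 * Tm j.+2 k + (Tm j.+1 k + 4 * Tm j k).
pose CQ := `|4^-1| * C1 + (C1 + `|4| * C1).
have oQ j : opb (Q j) CQ.
  exact: (opb_add mOmega hdist hw nuw nuO hP h1 p1
      (opb_scale mOmega hdist hw nuw nuO hP h1 p1 4^-1 (HT j.+2))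
      (opb_add mOmega hdist hw nuw nuO hP h1 p1 (HT j.+1)
        (opb_scale mOmega hdist hw nuw nuO hP h1 p1 4 (HT j)))).
have CQ0 : 0 < CQ by rewrite /CQ !ger0_norm ?invr_ge0//; lra.
exists (CQ ^+ M.+1 * C5) => [|j]; first by rewrite mulr_gt0// exprn_gt0.
have n2 : (0 < 2 ^ j.+1)%N by rewrite expn_gt0.
set N : R := (2 ^ j.+1)%:R.
have NN : 0 < N by exact: N0.
have := opb_scale mOmega hdist hw nuw nuO hP h1 p1 (N ^- (2 * M.+1))
  (opb_mul mOmega hdist hw nuw nuO hP h1 p1
  (opb_exp mOmega hdist hw nuw nuO hP h1 p1 M (oQ j)) (H5 _ n2)).
rewrite -/N (_ : `|_| * _ = CQ ^+ M.+1 * C5 * N `^ (- r)); last first.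
  rewrite ger0_norm ?invr_ge0 ?exprn_ge0 ?(ltW NN)//.
  rewrite /s powRD ?(gt_eqF NN) ?implybT// -natrM powR_mulrn ?(ltW NN)//.
  have X0 : N ^+ (2 * M.+1) != 0 by rewrite expf_neq0// gt_eqF.
  by move: X0; set X := N ^+ _ => X0; field.
apply: opb_ext => k.
have [h0|h0] := eqVneq (dy j.+1 k) 0.
  rewrite h0; move: h0; rewrite /dy -/N => ->.
  by rewrite !mul0r !mulr0.
have k1 := dyS_gt1 h0; have mk0 := eigenvalue_gt0 k1.
have QE : Q j k = N ^+ 2 / mu.[k%:R].
  have [t1 t2] := andP (dy_supp h0).
  rewrite -/N in t1 t2.
  have H2 : dy j.+2 k = dyadic (k%:R / N / 2) by exact: dy_halve.
  have H0 : dy j k = dyadic (2 * (k%:R / N)).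
    by apply: (congr1 (@dyadic R)); rewrite /N NS; field; rewrite gt_eqF.
  rewrite /Q /Tm H2 H0 (NS j.+1) -/N (_ : (2 ^ j)%:R = N / 2); last first.
    by rewrite /N NS; field.
  have := @dyadic_sum3 R (k%:R / N); rewrite !ltW// => /(_ isT) s3.
  transitivity ((dyadic (k%:R / N / 2) + dyadic (k%:R / N) + dyadic (2 * (k%:R / N)))
    * (N ^+ 2 / mu.[k%:R])); last by rewrite s3 mul1r.
  by rewrite /dy -/N; field; rewrite gt_eqF.
rewrite QE -/(dy j.+1 k) /dy -/N.
have -> : mu.[k%:R] `^ (s / 2) = mu.[k%:R] ^+ M.+1 * mu.[k%:R] `^ (- (r / 2)).
  rewrite -powR_mulrn ?(ltW mk0)// -powRD ?(gt_eqF mk0) ?implybT//.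
  by congr (_ `^ _); rewrite /s; field.
by rewrite expr_div_n exprM; field; rewrite !gt_eqF// ?exprn_gt0.
Qed.

End NegativePowers.

(** * The direct and inverse estimates *)

Lemma lowcut_dyadic (R : realType) j k :
  lowcut j.+1 k - lowcut j k = dy j.+1 k :> R.
Proof.
rewrite /lowcut /dy /dyadic; congr (_ - cutoff _).
by rewrite expnS natrM; field; rewrite pnatr_eq0 expn_eq0.
Qed.

Lemma lowcut_eq0 (R : realType) j k : (2 ^ j.+1 <= k)%N -> lowcut j k = 0 :> R.
Proof.
move=> jk; apply: cutoff0; rewrite ler_pdivlMr ?ltr0n ?expn_gt0//.
by rewrite -natrM ler_nat -expnS.
Qed.

Lemma lowcut_eq1 (R : realType) j k : (k <= 2 ^ j)%N -> lowcut j k = 1 :> R.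
Proof.
by move=> kj; apply: cutoff1; rewrite ler_pdivrMr ?ltr0n ?expn_gt0// mul1r ler_nat.
Qed.

Lemma powR_pow2 (R : realType) (s : R) i : (2 ^ i)%:R `^ s = (2 `^ s) ^+ i.
Proof.
by elim: i => [|i IH]; rewrite ?expn0 ?powR1// expnS natrM powRM// IH exprS.
Qed.

(** With M = 2^J, the M indices 2^J < k <= 2^(J+1) satisfy M <= k+1 <= 4M and, [e] being
    nonincreasing, e(k) >= e(2^(J+1)). Writing x^(r-1) as x^r / x bounds it below by M^r / (4M)
    whatever the sign of r - 1; this gives the constant 4 * 4^r. *)
Lemma dyadic_block_sum (R : realType) (r : R) : 0 < r -> exists2 B, 1 <= B &
  forall (e : nat -> R) J, (forall k, 0 <= e k) -> {homo e : i j / (i <= j)%N >-> j <= i} ->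
    \sum_(0 <= i < J.+1) (2 ^ i.+1)%:R `^ r * e (2 ^ i)%N <=
    B * \sum_(1 <= k < (2 ^ J).+1) k.+1%:R `^ (r - 1) * e k.
Proof.
move=> r0.
have four : 1 <= 4 `^ r :> R.
  have : 1 `^ r <= 4 `^ r :> R by rewrite ge0_ler_powR ?nnegrE ?(ltW r0)// ler1n.
  by rewrite powR1.
have xpow M x : 0 < M -> M <= x -> x <= 4 * M -> M `^ r / (4 * M) <= x `^ (r - 1) :> R.
  move=> M0 Mx xM; have x0 : 0 < x by exact: lt_le_trans Mx.
  rewrite powRD ?(gt_eqF x0) ?implybT// powR_inv1 ?(ltW x0)//.
  apply: ler_pM; rewrite ?powR_ge0 ?invr_ge0 ?mulr_ge0 ?(ltW M0)//.
    by rewrite ge0_ler_powR ?nnegrE ?(ltW r0) ?(ltW M0) ?(ltW x0).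
  by rewrite lef_pV2 ?posrE ?mulr_gt0.
exists (4 * 4 `^ r) => [|e J e0 ea]; first lra.
elim: J => [|J IH].
  rewrite !big_nat1 expn1 expn0 mulrA ler_wpM2r//.
  have := @xpow 1 2 ltr01; rewrite powR1 => /(_ ltac:(lra) ltac:(lra)) h.
  have h2 : 2 `^ r <= 4 `^ r :> R by rewrite ge0_ler_powR ?nnegrE ?(ltW r0)//; lra.
  have := ler_wpM2l (powR_ge0 4 r) h; lra.
rewrite big_nat_recr//= (@big_cat_nat _ _ _ (2 ^ J).+1 1 (2 ^ J.+1).+1)//=; last first.
  by rewrite ltnS leq_exp2l.
rewrite mulrDr lerD//.
set M : R := (2 ^ J)%:R; have M0 : 0 < M by rewrite ltr0n expn_gt0.
have E2 : (2 ^ J.+2)%:R = 4 * M by rewrite /M -natrM !expnS mulnA.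
apply: (@le_trans _ _ (4 * 4 `^ r * \sum_((2 ^ J).+1 <= k < (2 ^ J.+1).+1)
    (M `^ r / (4 * M) * e (2 ^ J.+1)%N))); last first.
  rewrite ler_wpM2l ?mulr_ge0 ?powR_ge0//.
  apply: ler_sum_nat => k /andP[k1 k2].
  apply: ler_pM => //; first by rewrite divr_ge0 ?powR_ge0 ?mulr_ge0 ?(ltW M0).
    apply: xpow => //; first by rewrite ler_nat (leq_trans (leqnSn _))// ltnW.
    by rewrite -E2 ler_nat (leq_trans k2)// ltn_exp2l.
  by apply: ea; rewrite -ltnS.
rewrite sumr_const_nat subSS (_ : (2 ^ J.+1 - 2 ^ J)%N = (2 ^ J)%N); last first.
  by rewrite expnS mul2n -addnn addnK.
rewrite -[X in _ <= _ * X]mulr_natl -/M E2 powRM ?(ltW M0)//.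
by rewrite le_eqVlt; apply/orP; left; apply/eqP; field; rewrite gt_eqF.
Qed.

Section Main.
Context {R : realType} {d : nat}.
Variables (Omega : set 'rV[R]_d) (dist : 'rV[R]_d -> 'rV[R]_d -> R).
Variable m : {measure set (borelV R d) -> \bar R}.
Variable w : 'rV[R]_d -> R.
Variable P : nat -> 'rV[R]_d -> 'rV[R]_d -> R.
Variable mu : {poly R}.
Variable nu : probability (borelV R d) R.
Hypothesis mOmega : measurable (Omega : set (borelV R d)).
Hypothesis hdist : metric_on Omega dist.
Hypothesis hw : doubling_weight Omega dist m w.
Hypothesis nuw : weighted m Omega w nu.
Hypothesis nuO : nu Omega = 1%E.
Hypothesis hP : forall n, reproducing_kernel Omega m w P n.
Hypothesis h1 : assertion1 Omega dist m w P.
Hypothesis h3 : assertion3 Omega dist m w.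
Hypothesis h5 : assertion5 Omega dist m w P mu.
Variable p : \bar R.
Hypothesis p1 : (1 <= p)%E.
Variables al ga : R.
Hypothesis al0 : 0 < al.
Hypothesis muE : forall x, mu.[x] = al * x * (x + ga).
Hypothesis ga0 : forall k, (1 < k)%N -> 0 < k%:R + ga.
Variable r : R.
Hypothesis r0 : 0 < r.

Local Notation opb := (opb Omega m w P p).
Local Notation mult := (multop Omega m w P).
Local Notation low := (lowpass Omega m w P).
Local Notation wspace := (wspace Omega m w).
Local Notation normw := (normw Omega m w).
Local Notation wnorm := (wnorm Omega m w).
Local Notation frac_power := (frac_power Omega m w P mu r).
Local Notation best := (best_approx Omega m w p).
Local Notation K := (K_functional Omega m w P mu p r).

Let mX c n f : wspace p f -> wspace p (mult c n f).
Proof. exact: (mult_wspace mOmega hdist hw nuw nuO hP h1). Qed.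

Let XL f : wspace p f -> L1 (nu : probability (borelV R d) R) Omega f.
Proof. by move=> /(wspace_L1 mOmega hw nuw nuO p1)[]. Qed.

Let XB f g : wspace p f -> wspace p g -> wspace p (fun x => f x - g x).
Proof. by move=> Xf Xg; case: (wspaceB mOmega hw nuw nuO p1 Xf Xg). Qed.

Let N0 j : 0 < (2 ^ j)%:R :> R.
Proof. by rewrite ltr0n expn_gt0. Qed.

Lemma low_diff j f x :
  low j.+1 f x - low j f x = mult (dy j.+1) (2 * 2 ^ j.+1).+1 f x.
Proof.
rewrite /lowpass -(@mult_widen _ _ _ _ _ _ (lowcut j) (2 * 2 ^ j).+1 (2 * 2 ^ j.+1).+1).
- rewrite /multop -sumrB; apply: eq_bigr => k _.
  by rewrite -mulrBl lowcut_dyadic.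
- by rewrite ltnS leq_mul2l/= leq_exp2l.
- by move=> k; rewrite -expnS => /ltnW; exact: lowcut_eq0.
Qed.

Lemma sobolev_low : exists2 C, 0 < C & forall g h j, wspace p g -> wspace p h ->
  frac_power g h ->
  normw p (fun x => g x - low j g x) <= C * (2 ^ j.+1)%:R `^ (- r) * normw p h.
Proof.
have [C C0 HC] := negative_power mOmega hdist hw nuw nuO hP h1 h3 h5 p1 al0 muE ga0 r.
pose rho : R := 2 `^ (- r).
have rho0 : 0 < rho by rewrite powR_gt0.
have rho1 : rho < 1.
  have h : 1 < 2 `^ r :> R.
    have : 1 `^ r < 2 `^ r :> R by rewrite gt0_ltr_powR ?nnegrE// ltr1n.
    by rewrite powR1.
  by rewrite /rho powRN invf_lt1// (lt_trans ltr01).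
exists (C / (1 - rho)) => [|g h j Xg Xh gh]; first by rewrite divr_gt0// subr_gt0.
have diff i : normw p (fun x => low i.+1 g x - low i g x) <=
    C * (2 ^ i.+1)%:R `^ (- r) * normw p h.
  (* On the block mu(k) > 0, so the projections of [g] are mu^(-r/2) times those of [h]. *)
  rewrite (normw_ext m w p (g := mult (fun k => dy i.+1 k * mu.[k%:R] `^ (- (r / 2)))
    (2 * 2 ^ i.+1).+1 h)).
    apply: (opb_at (HC i)) Xh => k; rewrite -expnS => /ltnW ik.
    by rewrite dy_eq0r// mul0r.
  move=> x Ox; rewrite low_diff; apply: eq_bigr => k _.
  rewrite gh//; have [->|h0] := eqVneq (dy i.+1 k : R) 0; first by rewrite !mul0r.
  have mk0 := eigenvalue_gt0 al0 muE ga0 (dyS_gt1 h0).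
  rewrite -mulrA (mulrA (_ `^ _)) -powRD ?(gt_eqF mk0) ?implybT//.
  by rewrite addNr powRr0 mul1r.
have r01 : 0 < rho < 1 by rewrite rho0 rho1.
have A0 : 0 <= C * (2 ^ j.+1)%:R `^ (- r) * normw p h.
  by rewrite !mulr_ge0 ?(ltW C0) ?powR_ge0//; exact: normw_ge0 nuO _ _.
have -> : C / (1 - rho) * (2 ^ j.+1)%:R `^ (- r) * normw p h =
    C * (2 ^ j.+1)%:R `^ (- r) * normw p h / (1 - rho) by ring.
apply: (low_limit mOmega hdist hw nuw nuO hP h1 h3 p1 Xg A0 r01) => i.
apply: le_trans (diff _) _; rewrite -addSn expnD natrM.
rewrite powRM ?ler0n// le_eqVlt; apply/orP; left; apply/eqP.
rewrite (powR_pow2 _ i) -/rho.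
by ring.
Qed.

Lemma low_polys j n f : wspace p f -> (2 ^ j.+1 <= n.+1)%N -> polys Omega n (low j f).
Proof.
move=> Xf jn; apply: (mult_polys mOmega hdist hw nuw nuO hP h1); first exact: XL.
by move=> k nk; apply: lowcut_eq0; exact: leq_trans jn nk.
Qed.

Lemma polys_wspace n q : polys Omega n q -> wspace p q.
Proof.
move=> qP; have [C HC] := polys_bounded mOmega hdist hw nuw nuO hP h1 qP.
have [x Ox] := domain_nonempty nuO.
have C0 : 0 <= C by exact: le_trans (HC x Ox).
exact: (wspace_bounded mOmega hw nuw nuO p1 C0 (polys_within_continuous qP) HC).1.
Qed.

Lemma wnormB f g : wspace p f -> wspace p g ->
  wnorm p (f \- g) = (normw p (fun x => f x - g x))%:E.
Proof. by move=> Xf Xg; apply: (wspaceE nuO); exact: XB. Qed.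

Lemma best_le n f q : wspace p f -> polys Omega n q ->
  (best n f <= (normw p (fun x => f x - q x))%:E)%E.
Proof.
move=> Xf qP; rewrite -wnormB//; last exact: polys_wspace qP.
by apply: ereal_inf_lbound; exists q.
Qed.

Definition bestr (n : nat) (f : 'rV[R]_d -> R) : R := fine (best n f).

Lemma best_ge0 n f : (0 <= best n f)%E.
Proof. by apply: le_ereal_inf_tmp => _ [q _ <-]; exact: wnorm_ge0 nuO _ _. Qed.

Lemma bestE n f : wspace p f -> best n f = (bestr n f)%:E.
Proof.
move=> Xf; rewrite fineK// ge0_fin_numE ?best_ge0//.
by apply: le_lt_trans (best_le Xf (polys_cst Omega n 0)) (ltry _).
Qed.

Lemma bestr_ge0 n f : 0 <= bestr n f.
Proof. exact/fine_ge0/best_ge0. Qed.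

Lemma bestr_anti f : wspace p f -> {homo bestr^~ f : i j / (i <= j)%N >-> j <= i}.
Proof.
move=> Xf i j ij; rewrite -lee_fin -!bestE//.
apply: le_ereal_inf_tmp => _ [q qP <-].
by apply: ereal_inf_lbound; exists q => //; exact: polysW qP.
Qed.

Lemma le_bestr n f (a C : R) : 0 < C -> wspace p f ->
  (forall q, polys Omega n q -> a <= C * normw p (fun x => f x - q x)) ->
  a <= C * bestr n f.
Proof.
move=> C0 Xf H; rewrite -ler_pdivrMl// -lee_fin -bestE//.
apply: le_ereal_inf_tmp => _ [q qP <-].
rewrite wnormB//; last exact: polys_wspace qP.
by rewrite lee_fin ler_pdivrMl// H.
Qed.

Lemma mult_sub_polys c n f q N x : wspace p f -> polys Omega N q ->
  (forall k, (k <= N)%N -> c k = 0) -> Omega x ->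
  mult c n f x = mult c n (fun x => f x - q x) x.
Proof.
move=> Xf qP c0 Ox; have Xq := polys_wspace qP.
have := mult_lin mOmega hdist hw nuw nuO hP h1 c n (-1) (XL Xq) (XL Xf) Ox.
rewrite (mult_polys_eq0 mOmega hdist hw nuw nuO hP h1 n qP c0 Ox) mulr0 add0r => <-.
apply: eq_bigr => k _; congr (_ * _).
by apply: (proj_ext m w P) => y _; ring.
Qed.

Lemma mult_best c n C N f : 0 < C -> opb c C ->
  (forall k, (n <= k)%N -> c k = 0) -> (forall k, (k <= N)%N -> c k = 0) ->
  wspace p f -> normw p (mult c n f) <= C * bestr N f.
Proof.
move=> C0 oc cn cN Xf; apply: le_bestr => // q qP.
rewrite (normw_ext m w p (fun x => mult_sub_polys n Xf qP cN)).
by apply: (opb_at oc cn); apply: XB => //; exact: polys_wspace qP.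
Qed.

(** The operator reproduces any q of degree at most 2^j, so the error for [f] equals the error for f
    - q; boundedness and the infimum over q conclude. *)
Lemma low_best : exists2 C, 0 < C & forall j f, wspace p f ->
  normw p (fun x => f x - low j f x) <= C * bestr (2 ^ j) f.
Proof.
have [C C0 HC] := opb_admissible mOmega hdist hw nuw nuO hP h1 h3 p1 (@admissible_cutoff R).
exists (1 + C) => [|j f Xf]; first by rewrite addr_gt0.
apply: le_bestr => // [|q qP]; first by rewrite addr_gt0.
have Xq := polys_wspace qP; have Xfq := XB Xf Xq.
rewrite (normw_ext m w p (g := fun x => (f x - q x) - low j (fun y => f y - q y) x)).
  apply: le_trans (wspaceB mOmega hw nuw nuO p1 Xfq (mX _ _ Xfq)).2 _.
  rewrite mulrDl mul1r lerD2l; apply: opb_at Xfq.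
    by apply: HC; rewrite expn_gt0.
  by move=> k; rewrite -expnS => /ltnW; exact: lowcut_eq0.
move=> x Ox.
have qE : low j q x = q x.
  apply: (mult_polys_id mOmega hdist hw nuw nuO hP h1 qP) => //.
    by rewrite ltnS leq_pmull.
  by move=> k kj; exact: lowcut_eq1.
have := mult_lin mOmega hdist hw nuw nuO hP h1 (lowcut j) (2 * 2 ^ j).+1 (-1) (XL Xq) (XL Xf) Ox.
rewrite -/(low j q x) qE mulN1r => E.
have -> : low j (fun y => f y - q y) x = - q x + low j f x.
  rewrite -E; apply: eq_bigr => k _; congr (_ * _).
  by apply: (proj_ext m w P) => y _; ring.
by ring.
Qed.

Lemma high_best : exists2 C, 0 < C & forall J f, wspace p f ->
  normw p (mult (fun k => lowcut J k * mu.[k%:R] `^ (r / 2)) (2 * 2 ^ J).+1 f) <=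
  C * (bestr 0 f + \sum_(0 <= i < J) (2 ^ i.+1)%:R `^ r * bestr (2 ^ i) f).
Proof.
pose c J k : R := lowcut J k * mu.[k%:R] `^ (r / 2).
have cn J k : (2 ^ J.+1 <= k)%N -> c J k = 0.
  by move=> ?; rewrite /c lowcut_eq0// mul0r.
have [C1 o1] := opb_fin mOmega hdist hw nuw nuO hP h1 p1 (cn 0%N).
have [C10 _] := o1.
have [C5 C50 H5] := opb_admissible_pow mOmega hdist hw nuw nuO hP h1 h3 h5 p1
  (@admissible_dyadic R) r0.
exists (C1 + 1 + C5) => [|J f Xf]; first lra.
elim: J => [|J IH].
  rewrite big_geq// addr0.
  apply: (@le_trans _ _ ((C1 + 1) * bestr 0 f)); last first.
    by rewrite ler_wpM2r ?bestr_ge0//; lra.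
  apply: mult_best => //; first lra.
  - by apply: (opb_le nuO _ o1); lra.
  - by move=> k kn; apply: cn; exact: ltnW kn.
  (* Since mu(0) = 0 and r > 0, the symbol vanishes at k = 0, so constants are killed and the base
     case is bounded by the error of degree 0. *)
  - move=> k; rewrite leqn0 => /eqP ->.
    by rewrite /c muE mulr0 mul0r powR0 ?mulr0// gt_eqF// divr_gt0.
rewrite (normw_ext m w p (g := fun x => mult (c J) (2 * 2 ^ J).+1 f x +
   mult (fun k => dyadic (k%:R / (2 ^ J.+1)%:R) * mu.[k%:R] `^ (r / 2)) (2 * 2 ^ J.+1).+1 f x)).
  apply: le_trans (wspaceD mOmega hw nuw nuO p1 (mX _ _ Xf) (mX _ _ Xf)).2 _.
  rewrite big_nat_recr//= addrA mulrDr lerD//.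
  have N1 : (0 < 2 ^ J.+1)%N by rewrite expn_gt0.
  have := H5 _ N1 => o5.
  have P0 : 0 < (2 ^ J.+1)%:R `^ r :> R by rewrite powR_gt0.
  apply: (@le_trans _ _ (C5 * (2 ^ J.+1)%:R `^ r * bestr (2 ^ J) f)).
    apply: mult_best o5 _ _ Xf.
    - by rewrite mulr_gt0.
    - by move=> k; rewrite -expnS => /ltnW/dy_eq0r; rewrite /dy => ->; rewrite mul0r.
    - by move=> k /dy_eq0l; rewrite /dy => ->; rewrite mul0r.
  rewrite -mulrA ler_wpM2r ?mulr_ge0 ?bestr_ge0 ?(ltW P0)//; lra.
move=> x Ox.
rewrite -(@mult_widen _ _ _ _ _ _ (c J) (2 * 2 ^ J).+1 (2 * 2 ^ J.+1).+1).
- rewrite /multop -big_split/=; apply: eq_bigr => k _.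
  by rewrite -mulrDl -/(dy J.+1 k) -lowcut_dyadic /c; ring.
- by rewrite ltnS leq_mul2l/= leq_exp2l.
- by move=> k; rewrite -expnS => /ltnW; exact: cn.
Qed.

Lemma frac_power_low J f : wspace p f ->
  frac_power (low J f) (mult (fun k => lowcut J k * mu.[k%:R] `^ (r / 2)) (2 * 2 ^ J).+1 f).
Proof.
move=> Xf n x Ox; rewrite !(proj_mult mOmega hdist hw nuw nuO hP h1)//; try exact: XL.
by case: ifP => _; ring.
Qed.

Lemma direct_estimate : exists2 c : R, 0 < c &
  forall f n, wspace p f -> (0 < n)%N -> (best n f <= c%:E * K n%:R^-1 f)%E.
Proof.
have [C C0 HC] := sobolev_low.
have P0 : 0 < 2 `^ r :> R by rewrite powR_gt0.
pose c := 1 + C * 2 `^ r.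
have CP : 0 < C * 2 `^ r by rewrite mulr_gt0.
have c0 : 0 < c by rewrite addr_gt0.
exists c => // f n Xf n0; rewrite -lee_pdivrMl//.
apply: le_ereal_inf_tmp => _ [g [h [Xg Xh gh ->]]].
rewrite lee_pdivrMl//.
have n1 : (0 < n.+1)%N by [].
(* The level satisfies 2^(j+1) <= n+1 < 2^(j+2). The symbol of [low j] vanishes from 2^(j+1) on, so
   the degree is at most n, while n <= 2 * 2^(j+1) gives the factor 2^r. Taking the logarithm of n+1
   rather than n includes n = 1. *)
have := trunc_logP (isT : (1 < 2)%N) n1; have := trunc_log_ltn n.+1 (isT : (1 < 2)%N).
case: (trunc_log 2 n.+1) => [|j]; first by rewrite expn1 ltnS ltnNge n0.
move=> nj jn.
apply: le_trans (best_le Xf (low_polys Xg jn)) _.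
rewrite (wnormB Xf Xg) (wspaceE nuO Xh) -!EFinM lee_fin.
rewrite (normw_ext m w p (g := fun x => (f x - g x) + (g x - low j g x))); last first.
  by move=> x _; ring.
apply: le_trans (wspaceD mOmega hw nuw nuO p1 (XB Xf Xg) (XB Xg (mX _ _ Xg))).2 _.
have nf0 : 0 <= normw p (fun x => f x - g x) by exact: normw_ge0 nuO _ _.
have nh0 : 0 <= normw p h by exact: normw_ge0 nuO _ _.
have H := HC g h j Xg Xh gh.
have H2 : (2 ^ j.+1)%:R `^ (- r) <= 2 `^ r * n%:R^-1 `^ r :> R.
  rewrite -powRM ?invr_ge0// -(invrK (2 ^ j.+1)%:R) -powR_inv1 ?invr_ge0//.
  rewrite -powRrM mulN1r opprK ge0_ler_powR ?nnegrE ?(ltW r0)//.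
  rewrite ler_pdivlMr ?ltr0n// ler_pdivrMl// -natrM ler_nat mulnC -expnS.
  exact: leq_trans (leqnSn n) (ltnW nj).
have H3 : C * (2 ^ j.+1)%:R `^ (- r) * normw p h <=
    C * 2 `^ r * (n%:R^-1 `^ r * normw p h).
  rewrite -!mulrA ler_wpM2l ?(ltW C0)// mulrA ler_wpM2r//.
have t0 : 0 <= n%:R^-1 `^ r * normw p h by rewrite mulr_ge0// powR_ge0.
have := le_trans H H3; rewrite /c.
move: nf0 t0 CP; set a := normw p _; set b := n%:R^-1 `^ r * _; set D := C * _.
by move=> a0 b0 D0 H4; rewrite mulrDr !mulrDl !mul1r; have := mulr_ge0 (ltW D0) a0; lra.
Qed.

Lemma inverse_estimate : exists2 c : R, 0 < c &
  forall f n, wspace p f -> (0 < n)%N ->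
    (K n%:R^-1 f <= (c * n%:R `^ (- r))%:E *
      \sum_(0 <= k < n.+1) ((k.+1%:R `^ (r - 1))%:E * best k f))%E.
Proof.
have [C1 C10 H1] := low_best; have [C2 C20 H2] := high_best.
have [B B1 HB] := dyadic_block_sum r0.
have CB : 0 < (C1 + C2) * B by rewrite mulr_gt0 ?addr_gt0// (lt_le_trans ltr01).
exists ((C1 + C2) * B) => // f n Xf n0.
have -> : (\sum_(0 <= k < n.+1) ((k.+1%:R `^ (r - 1))%:E * best k f) =
    (\sum_(0 <= k < n.+1) k.+1%:R `^ (r - 1) * bestr k f)%:E)%E.
  by rewrite -sumEFin; apply: eq_bigr => k _; rewrite bestE.
have := trunc_logP (isT : (1 < 2)%N) n0; have := trunc_log_ltn n (isT : (1 < 2)%N).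
set J := trunc_log 2 n => nJ Jn.
set h := mult (fun k => lowcut J k * mu.[k%:R] `^ (r / 2)) (2 * 2 ^ J).+1 f.
have Xl : wspace p (low J f) by exact: mX.
have Xh : wspace p h by exact: mX.
apply: (@le_trans _ _ (wnorm p (f \- low J f)%R + (n%:R^-1 `^ r)%:E * wnorm p h)%E).
  by apply: ereal_inf_lbound; exists (low J f), h; split => //; exact: frac_power_low.
rewrite (wnormB Xf Xl) (wspaceE nuO Xh) -!EFinM -EFinD lee_fin.
have nr : n%:R^-1 `^ r = n%:R `^ (- r) :> R.
  by rewrite -powR_inv1// -powRrM mulN1r.
rewrite nr; set t := n%:R `^ (- r).
have nR : 0 < n%:R :> R by rewrite ltr0n.
have t0 : 0 < t by rewrite powR_gt0.
set e := bestr^~ f.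
have e0 k : 0 <= e k by exact: bestr_ge0.
have ea : {homo e : i j / (i <= j)%N >-> j <= i} by exact: bestr_anti.
(* One term more than [high_best] needs: as n < 2^(J+1), the term i = J times n^-r dominates the
   error of [low J f]. *)
set S := \sum_(0 <= i < J.+1) (2 ^ i.+1)%:R `^ r * e (2 ^ i)%N.
have S1 : S = \sum_(0 <= i < J) (2 ^ i.+1)%:R `^ r * e (2 ^ i)%N +
    (2 ^ J.+1)%:R `^ r * e (2 ^ J)%N by rewrite /S big_nat_recr.
have S2 : 0 <= \sum_(0 <= i < J) (2 ^ i.+1)%:R `^ r * e (2 ^ i)%N.
  by apply: sumr_ge0 => i _; rewrite mulr_ge0// powR_ge0.
have A1 : normw p (fun x => f x - low J f x) <= C1 * t * S.
  apply: le_trans (H1 J f Xf) _; rewrite -mulrA ler_wpM2l ?(ltW C10)//.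
  rewrite -/(e _).
  have tn : t * n%:R `^ r = 1.
    by rewrite /t -powRD ?(gt_eqF nR) ?implybT// addNr powRr0.
  rewrite -[leLHS]mul1r -tn -mulrA ler_wpM2l ?(ltW t0)// S1.
  apply: (@le_trans _ _ ((2 ^ J.+1)%:R `^ r * e (2 ^ J)%N)); last by rewrite lerDr.
  rewrite ler_wpM2r// ge0_ler_powR ?nnegrE ?(ltW r0)// ler_nat.
  exact: ltnW.
have A2 : normw p h <= C2 * (e 0%N + S).
  apply: le_trans (H2 J f Xf) _; rewrite ler_wpM2l ?(ltW C20)// lerD2l S1.
  by rewrite lerDl mulr_ge0// powR_ge0.
have A3 := HB e J e0 ea; rewrite -/S in A3.
set Sn := \sum_(0 <= k < n.+1) k.+1%:R `^ (r - 1) * e k.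
(* The error of degree 0 is the term k = 0 of [Sn], which is where 1 <= B enters; [S] is controlled
   by the terms 1 <= k <= 2^J, and 2^J <= n. *)
have A4 : e 0%N + S <= B * Sn.
  rewrite /Sn big_ltn// powR1 mul1r mulrDr; apply: lerD.
    by rewrite ler_peMl.
  apply: le_trans A3 _; rewrite ler_wpM2l ?(le_trans ler01)//.
  rewrite [leRHS](@big_cat_nat _ _ _ (2 ^ J).+1)//= lerDl sumr_ge0// => k _.
  by rewrite mulr_ge0// powR_ge0.
have A5 : t * normw p h <= C2 * t * (e 0%N + S).
  by rewrite (mulrC C2) -mulrA ler_wpM2l// ltW.
have A6 : C1 * t * S <= C1 * t * (e 0%N + S).
  by rewrite (ler_wpM2l (ltW (mulr_gt0 C10 t0)))// lerDr.
apply: (@le_trans _ _ ((C1 + C2) * t * (e 0%N + S))).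
  by rewrite 2!mulrDl lerD// (le_trans A1).
have := ler_wpM2l (ltW (mulr_gt0 (addr_gt0 C10 C20) t0)) A4.
by move=> h'; apply: le_trans h' _; rewrite le_eqVlt; apply/orP; left; apply/eqP; ring.
Qed.

End Main.

Theorem theorem3p12 (R : realType) (d : nat) (Omega : set 'rV[R]_d)
    (dist : 'rV[R]_d -> 'rV[R]_d -> R)
    (m : {measure set (borelV R d) -> \bar R})
    (w : 'rV[R]_d -> R)
    (P : nat -> 'rV[R]_d -> 'rV[R]_d -> R)
    (D : ('rV[R]_d -> R) -> 'rV[R]_d -> R) (mu : {poly R})
    (hOmega : homogeneous_domain Omega dist m)
    (hw : doubling_weight Omega dist m w)
    (hP : forall n, reproducing_kernel Omega m w P n)
    (hA : eigen_assumption Omega m w mu D)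
    (hB : addition_formula Omega P)
    (h1 : assertion1 Omega dist m w P)
    (h3 : assertion3 Omega dist m w)
    (h5 : assertion5 Omega dist m w P mu)
    (p : \bar R) (hp : (1 <= p)%E) (r : R) (hr : 0 < r) :
  (exists2 c : R, 0 < c &
     forall (f : 'rV[R]_d -> R) (n : nat), wspace Omega m w p f -> (0 < n)%N ->
       (best_approx Omega m w p n f
        <= c%:E * K_functional Omega m w P mu p r n%:R^-1 f)%E)
  /\
  (exists2 c : R, 0 < c &
     forall (f : 'rV[R]_d -> R) (n : nat), wspace Omega m w p f -> (0 < n)%N ->
       (K_functional Omega m w P mu p r n%:R^-1 f
        <= (c * n%:R `^ (- r))%:E
           * \sum_(0 <= k < n.+1)
               ((k.+1%:R `^ (r - 1))%:E * best_approx Omega m w p k f))%E).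
Proof.
have mOmega := hd_measurable hOmega; have hdist := hd_metric hOmega.
have [nu [nuw nuO]] := @weighted_probability _ (borelV R d) R m Omega w mOmega
  (dw_measurable hw) (dw_ge0 hw) (dw_unit hw).
have [al [ga [al0 muE ga0]]] := eigenvalue_form hA (domain_nonempty nuO).
split.
- exact: (direct_estimate mOmega hdist hw nuw nuO hP h1 h3 h5 hp al0 muE ga0 hr).
- exact: (inverse_estimate mOmega hdist hw nuw nuO hP h1 h3 h5 hp muE hr).
Qed.
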